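(* Let $n \in \mathbb{N}$ with $n\geq 4$, let $\mathfrak{k}$ be the maximal compact Lie subalgebra of the split real Kac--Moody Lie algebra of type $E_n$, let $C=C(\mathbb{R}^n,q)$ be the Clifford algebra with respect to the standard positive definite quadratic form $q$, and let $\rho : \mathfrak{k} \to C$ be the standard generalized spin representation. Then $\operatorname{im}(\rho)$ is isomorphic, as a Lie algebra, to (0) $\mathfrak{so}(2^{\frac{n}{2}}) \leq \mathbb{R}\otimes_{\mathbb{R}} M(2^{\frac{n}{2}},\mathbb{R})$, if $n \equiv 0 \pmod 8$; (1) $\mathfrak{so}(2^{\frac{n-1}{2}}) \oplus \mathfrak{so}(2^{\frac{n-1}{2}}) \leq (\mathbb{R} \oplus \mathbb{R}) \otimes_{\mathbb{R}} M(2^{\frac{n-1}{2}},\mathbb{R})$, if $n \equiv 1 \pmod 8$; (2) $\mathfrak{so}(2^{\frac{n}{2}}) \leq M(2,\mathbb{R}) \otimes_{\mathbb{R}} M(2^{\frac{n-2}{2}},\mathbb{R})$, if $n \equiv 2 \pmod 8$; (3) $\mathfrak{su}(2^{\frac{n-1}{2}}) \leq M(2,\mathbb{C}) \otimes_{\mathbb{R}} M(2^{\frac{n-3}{2}},\mathbb{R})$, if $n \equiv 3 \pmod 8$; (4) $\mathfrak{sp}(2^{\frac{n-2}{2}}) \leq M(2,\mathbb{H}) \otimes_{\mathbb{R}} M(2^{\frac{n-4}{2}},\mathbb{R})$, if $n \equiv 4 \pmod 8$; (5) $\mathfrak{sp}(2^{\frac{n-3}{2}})\oplus \mathfrak{sp}(2^{\frac{n-3}{2}})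 \leq (M(2,\mathbb{H}) \oplus M(2,\mathbb{H})) \otimes_{\mathbb{R}} M(2^{\frac{n-5}{2}},\mathbb{R})$, if $n \equiv 5 \pmod 8$; (6) $\mathfrak{sp}(2^{\frac{n-2}{2}}) \leq M(4,\mathbb{H}) \otimes_{\mathbb{R}} M(2^{\frac{n-6}{2}},\mathbb{R})$, if $n \equiv 6 \pmod 8$; (7) $\mathfrak{su}(2^{\frac{n-1}{2}}) \leq M(8,\mathbb{C}) \otimes_{\mathbb{R}} M(2^{\frac{n-7}{2}},\mathbb{R})$, if $n \equiv 7 \pmod 8$; i.e., $\operatorname{im}(\rho)$ is a maximal semisimple compact Lie subalgebra of $C$.
   Context: **Notation.** $\mathbb{N}=\{1,2,3,\dots\}$; $\mathbb{H}$ denotes the quaternions; $M(m,\mathbb{D})$ is the algebra of $m\times m$ matrices over the division ring $\mathbb{D}$, regarded as a real algebra. $\mathfrak{so}(m)$, $\mathfrak{su}(m)$, $\mathfrak{sp}(m)$ denote the compact real Lie algebras of skew-symmetric real, traceless skew-Hermitian complex, and skew-Hermitian quaternionic $m\times m$ matrices, respectively; so $\dim_{\mathbb{R}}\mathfrak{sp}(m)=m(2m+1)$. Associative algebras are considered as Lie algebras via $[A,B]=AB-BA$. **Clifford algebra.** $C(\mathbb{R}^n,q)$, with $q=x_1^2+\cdots+x_n^2$, is the unital associative real algebra generated by the standard basis vectors $v_1,\dots,v_n$ of $\mathbb{R}^n$ subject to $v_i^2=1$ and $v_iv_j=-v_jv_i$ for $i\neq j$. By the classical Cartan--Bott periodicity,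 $C(\mathbb{R}^n,q)$ is isomorphic as an $\mathbb{R}$-algebra to the algebra on the right-hand side of $\leq$ in the respective case; the symbol $\leq$ indicates that the Lie algebra on the left is a Lie subalgebra of that algebra in the natural way. **Type $E_n$.** The Dynkin diagram of type $E_n$ ($n\ge 4$) has nodes $1,2,\dots,n$ and simple edges $\{1,3\}$, $\{j,j+1\}$ for $3\le j<n$, and $\{2,4\}$, and no other edges (so $E_4=A_4$, $E_5=D_5$). Let $\mathfrak{g}$ be the split real Kac--Moody Lie algebra of type $E_n$, with Chevalley generators $e_i,f_i$ ($1\le i\le n$) and Cartan subalgebra $\mathfrak{h}$. Its maximal compact Lie subalgebra $\mathfrak{k}$ is the fixed point subalgebra of the Cartan--Chevalley involution, determined by $e_i\mapsto -f_i$, $f_i\mapsto -e_i$, $h\mapsto -h$ ($h\in\mathfrak{h}$). The Lie algebra $\mathfrak{k}$ is generated by the Berman generators $X_i=e_i-f_i$, $1\le i\le n$, and is presented by the relations $[X_i,[X_i,X_j]]=-X_j$ if $i,j$ are adjacent in the diagram and $[X_i,X_j]=0$ if they are not. **Standard generalized spin representation.** $\rho:\mathfrak{k}\to C(\mathbb{R}^n,q)$ is the Lie algebra homomorphism determined by $X_1\mapsto \tfrac12 v_1v_2$, $X_2\mapsto \tfrac12 v_1v_2v_3$, $X_j\mapsto \tfrac12 v_{j-1}v_j$ for $3\le j\le n$. Its image is the Lie subalgebra of $C(\mathbb{R}^n,q)$ generated by $v_1v_2v_3$ and all $v_iv_{i+1}$, $1\le i<n$. **Compactness.** A Lie subalgebra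 of $C$ is called compact if it is the Lie algebra of a compact subgroup of the unit group $C^\times$; maximality of semisimple compact subalgebras is with respect to inclusion among semisimple compact subalgebras. *)

(* Defs.v *)
From HB Require Import structures.
From mathcomp Require Import all_boot all_order all_algebra falgebra.
From mathcomp Require Import complex ring.
From mathcomp Require Import boolp classical_sets functions reals topology.
From mathcomp Require Import normedtype.

Set Implicit Arguments.
Unset Strict Implicit.
Unset Printing Implicit Defensive.

Import Order.TTheory GRing.Theory Num.Theory.
Import numFieldNormedType.Exports.

Local Open Scope classical_set_scope.
Local Open Scope ring_scope.

HB.mixin Record Lmodule_isLieAlgebra (R : pzRingType) L
    of GRing.Lmodule R L := {
  lie : L -> L -> L;
  lie_linearl : forall z : L, linear (lie^~ z);
  lie_linearr : forall z : L, linear (lie z);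
  liexx : forall x : L, lie x x = 0;
  lie_jacobi : forall x y z : L,
    lie x (lie y z) + lie y (lie z x) + lie z (lie x y) = 0
}.

#[short(type="lieAlgType")]
HB.structure Definition LieAlgebra (R : pzRingType) :=
  {L of GRing.Lmodule R L & Lmodule_isLieAlgebra R L}.

HB.mixin Record isLieMorphism (R : pzRingType) (L M : lieAlgType R)
    (f : L -> M) := {
  lie_morph : {morph f : x y / lie x y}
}.

HB.structure Definition LieMorphism (R : pzRingType) (L M : lieAlgType R) :=
  {f of @GRing.Linear R L M *:%R f & isLieMorphism R L M f}.

Notation "{ 'lie' L -> M }" := (LieMorphism.type L%type M%type)
  (at level 0, L at level 98, M at level 99, format "{ 'lie'  L  ->  M }")
  : type_scope.

(* The associative algebra A regarded as a Lie algebra under the commutator. *)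
Definition lie_of (R : pzRingType) (A : algType R) : Type := A.

Section LieOf.
Variables (R : pzRingType) (A : algType R).

HB.instance Definition _ := GRing.Lmodule.on (lie_of A).

Definition commutator (x y : A) : A := x * y - y * x.

Lemma commutator_linearl (z : A) : linear (commutator^~ z).
Proof.
move=> a x y; rewrite /commutator mulrDl mulrDr -scalerAl -scalerAr.
by rewrite scalerBr addrACA opprD.
Qed.

Lemma commutator_linearr (z : A) : linear (commutator z).
Proof.
move=> a x y; rewrite /commutator mulrDl mulrDr -scalerAl -scalerAr.
by rewrite scalerBr addrACA opprD.
Qed.

Lemma commutatorxx (x : A) : commutator x x = 0.
Proof. exact: subrr. Qed.

Lemma commutator_jacobi (x y z : A) :
  commutator x (commutator y z) + commutator y (commutator z x)
    + commutator z (commutator x y) = 0.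
Proof.
rewrite /commutator !mulrBl !mulrBr !opprB !mulrA.
rewrite [LHS](AC ((2*2)*(2*2)*(2*2))%AC
  ((1*12)*(7*2)*(3*10)*(5*4)*(11*6)*(9*8))%AC).
by rewrite /= !subrr !addr0.
Qed.

HB.instance Definition _ := Lmodule_isLieAlgebra.Build R (lie_of A)
  commutator_linearl commutator_linearr commutatorxx commutator_jacobi.

End LieOf.

Section FixedSubalgebra.
Variables (R : pzRingType) (L : lieAlgType R) (omega : {lie L -> L}).

Definition fixed_pred : pred L := fun x => omega x == x.
Arguments fixed_pred _ /.

Lemma fixed_submod_closed : submod_closed fixed_pred.
Proof.
split=> [|a x y]; first by rewrite unfold_in /= linear0.
by rewrite !unfold_in /= => /eqP fx /eqP fy; rewrite linearP /= fx fy.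
Qed.

HB.instance Definition _ :=
  GRing.isSubmodClosed.Build R L fixed_pred fixed_submod_closed.

Record fixed_subalg := FixedSubalg {
  fixed_val :> L;
  _ : fixed_pred fixed_val
}.

HB.instance Definition _ := [isSub for fixed_val].
HB.instance Definition _ := [Choice of fixed_subalg by <:].
HB.instance Definition _ := [SubChoice_isSubLmodule of fixed_subalg by <:].

Fact fixed_lie_subproof (x y : fixed_subalg) : fixed_pred (lie (val x) (val y)).
Proof.
by apply/eqP; rewrite lie_morph (eqP (valP x)) (eqP (valP y)).
Qed.

Definition fixed_lie (x y : fixed_subalg) : fixed_subalg :=
  FixedSubalg (fixed_lie_subproof x y).

Fact fixed_lie_linearl z : linear (fixed_lie^~ z).
Proof. by move=> a x y; apply: val_inj; rewrite linearP /= lie_linearl. Qed.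

Fact fixed_lie_linearr z : linear (fixed_lie z).
Proof. by move=> a x y; apply: val_inj; rewrite linearP /= lie_linearr. Qed.

Fact fixed_liexx x : fixed_lie x x = 0.
Proof. by apply: val_inj; rewrite /= liexx. Qed.

Fact fixed_lie_jacobi x y z :
  fixed_lie x (fixed_lie y z) + fixed_lie y (fixed_lie z x)
    + fixed_lie z (fixed_lie x y) = 0.
Proof. by apply: val_inj; rewrite !raddfD /= lie_jacobi. Qed.

HB.instance Definition _ := Lmodule_isLieAlgebra.Build R fixed_subalg
  fixed_lie_linearl fixed_lie_linearr fixed_liexx fixed_lie_jacobi.

End FixedSubalgebra.

(* En_edge takes 1-based labels; the node i : 'I_n has label i.+1. *)
Definition En_edge (i j : nat) : bool :=
  [|| (i == 1) && (j == 3), (i == 2) && (j == 4) | (3 <= i) && (j == i.+1)]%N.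

Definition En_adjacent n (i j : 'I_n) : bool :=
  En_edge i.+1 j.+1 || En_edge j.+1 i.+1.

Definition En_cartan n : 'M[int]_n :=
  \matrix_(i, j)
    (if i == j then 2 else if En_adjacent i j then -1 else 0).

Section KacMoody.
Variables (R : fieldType) (n : nat) (A : 'M[int]_n).

Definition cartan_realization (H : vectType R)
    (root : 'I_n -> 'Hom(H, R^o)) (coroot : 'I_n -> H) : Prop :=
  [/\ free [seq root i | i <- enum 'I_n],
      free [seq coroot i | i <- enum 'I_n],
      forall i j, root j (coroot i) = (A i j)%:~R
    & (\dim {:H} + \rank (map_mx (intr : int -> R) A) = n + n)%N].

Record kac_moody_relations (H : vectType R)
    (root : 'I_n -> 'Hom(H, R^o)) (coroot : 'I_n -> H)
    (L : lieAlgType R) (h : {linear H -> L}) (e f : 'I_n -> L) : Prop := {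
  km_hh : forall x y, lie (h x) (h y) = 0;
  km_he : forall x i, lie (h x) (e i) = root i x *: e i;
  km_hf : forall x i, lie (h x) (f i) = - (root i x *: f i);
  km_ef : forall i j, lie (e i) (f j) = if i == j then h (coroot i) else 0;
  km_serre_e : forall i j, i != j -> iter `|1 - A i j|%N (lie (e i)) (e j) = 0;
  km_serre_f : forall i j, i != j -> iter `|1 - A i j|%N (lie (f i)) (f j) = 0
}.

(* g is presented by the generators h(H), e_i, f_i subject to the
   Chevalley-Serre relations.  For symmetrizable A this agrees, by Gabber and
   Kac, with the definition that instead of imposing the Serre relations
   divides by the largest ideal meeting h(H) trivially. *)
Definition is_kac_moody (H : vectType R)
    (root : 'I_n -> 'Hom(H, R^o)) (coroot : 'I_n -> H)
    (g : lieAlgType R) (h : {linear H -> g}) (e f : 'I_n -> g) : Prop :=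
  [/\ cartan_realization root coroot,
      kac_moody_relations root coroot h e f
    & forall (L : lieAlgType R) (h' : {linear H -> L}) (e' f' : 'I_n -> L),
        kac_moody_relations root coroot h' e' f' ->
        exists phi : {lie g -> L},
          [/\ phi \o h =1 h', phi \o e =1 e', phi \o f =1 f'
            & forall psi : {lie g -> L},
                psi \o h =1 h' -> psi \o e =1 e' -> psi \o f =1 f' ->
                psi =1 phi]].

Definition is_chevalley_involution (H : vectType R) (g : lieAlgType R)
    (h : {linear H -> g}) (e f : 'I_n -> g) (omega : {lie g -> g}) : Prop :=
  [/\ forall i, omega (e i) = - f i, forall i, omega (f i) = - e i
    & forall x, omega (h x) = - h x].

End KacMoody.

Section Clifford.
Variables (R : fieldType) (n : nat).

Definition clifford_relations (A : algType R) (v : 'I_n -> A) : Prop :=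
  (forall i, v i * v i = 1) /\
  (forall i j, i != j -> v i * v j = - (v j * v i)).

Definition is_clifford (C : algType R) (v : 'I_n -> C) : Prop :=
  clifford_relations v /\
  forall (A : algType R) (w : 'I_n -> A), clifford_relations w ->
    exists phi : {lrmorphism C -> A},
      phi \o v =1 w /\
      forall psi : {lrmorphism C -> A}, psi \o v =1 w -> psi =1 phi.

(* In 1-based labels: the big product is taken in increasing order of j, so it
   is v_1 v_2 for i = 1, v_1 v_2 v_3 for i = 2 and v_(i-1) v_i for i >= 3. *)
Definition spin_support (i j : nat) : bool :=
  (if i == 1 then j <= 2 else if i == 2 then j <= 3
   else (j == i.-1) || (j == i))%N.

Definition spin_generator (C : algType R) (v : 'I_n -> C) (i : 'I_n) : C :=
  2^-1 *: \prod_(j < n | spin_support i.+1 j.+1) v j.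

(* e i - f i is the i-th Berman generator; it is a fixed point of the
   Cartan-Chevalley involution omega. *)
Definition is_spin_representation (C : algType R) (v : 'I_n -> C)
    (g : lieAlgType R) (e f : 'I_n -> g) (omega : {lie g -> g})
    (rho : {lie fixed_subalg omega -> lie_of C}) : Prop :=
  forall (i : 'I_n) (X : fixed_subalg omega),
    val X = e i - f i -> rho X = spin_generator v i.

End Clifford.

(* Hamilton's quaternions a + b i + c j + d k. *)
Record quaternion (R : Type) := Quaternion { q1 : R; qi : R; qj : R; qk : R }.

Section QuaternionChoice.
Variable R : Type.
Definition quaternion_tuple (x : quaternion R) := (q1 x, qi x, qj x, qk x).
Definition tuple_quaternion (t : R * R * R * R) :=
  let: (a, b, c, d) := t in Quaternion a b c d.
Lemma quaternion_tupleK : cancel quaternion_tuple tuple_quaternion.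
Proof. by case. Qed.
End QuaternionChoice.

HB.instance Definition _ (R : choiceType) :=
  Choice.copy (quaternion R) (can_type (@quaternion_tupleK R)).

Section Quaternion.
Variable R : comNzRingType.
Implicit Types (x y z : quaternion R) (a b : R).

Lemma quaternionP x y :
  q1 x = q1 y -> qi x = qi y -> qj x = qj y -> qk x = qk y -> x = y.
Proof. by case: x y => ???? [????] /= -> -> -> ->. Qed.

Definition qzero : quaternion R := Quaternion 0 0 0 0.
Definition qone : quaternion R := Quaternion 1 0 0 0.
Definition qopp x := Quaternion (- q1 x) (- qi x) (- qj x) (- qk x).
Definition qadd x y :=
  Quaternion (q1 x + q1 y) (qi x + qi y) (qj x + qj y) (qk x + qk y).
Definition qmul x y := Quaternion
  (q1 x * q1 y - qi x * qi y - qj x * qj y - qk x * qk y)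
  (q1 x * qi y + qi x * q1 y + qj x * qk y - qk x * qj y)
  (q1 x * qj y - qi x * qk y + qj x * q1 y + qk x * qi y)
  (q1 x * qk y + qi x * qj y - qj x * qi y + qk x * q1 y).
Definition qscale a x := Quaternion (a * q1 x) (a * qi x) (a * qj x) (a * qk x).
Definition qconj x := Quaternion (q1 x) (- qi x) (- qj x) (- qk x).

Ltac quaternion_ring := repeat intro; apply: quaternionP => /=; ring.

Fact qaddA : associative qadd. Proof. by quaternion_ring. Qed.
Fact qaddC : commutative qadd. Proof. by quaternion_ring. Qed.
Fact qadd0 : left_id qzero qadd. Proof. by quaternion_ring. Qed.
Fact qaddN : left_inverse qzero qopp qadd. Proof. by quaternion_ring. Qed.

HB.instance Definition _ :=
  GRing.isZmodule.Build (quaternion R) qaddA qaddC qadd0 qaddN.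

Fact qmulA : associative qmul. Proof. by quaternion_ring. Qed.
Fact qmul1l : left_id qone qmul. Proof. by quaternion_ring. Qed.
Fact qmul1r : right_id qone qmul. Proof. by quaternion_ring. Qed.
Fact qmulDl : left_distributive qmul +%R. Proof. by quaternion_ring. Qed.
Fact qmulDr : right_distributive qmul +%R. Proof. by quaternion_ring. Qed.
Fact qone_neq0 : qone != 0.
Proof. by apply/eqP => /(congr1 (@q1 R)) /= /eqP; rewrite oner_eq0. Qed.

HB.instance Definition _ := GRing.Zmodule_isNzRing.Build (quaternion R)
  qmulA qmul1l qmul1r qmulDl qmulDr qone_neq0.

Fact qscaleA a b x : qscale a (qscale b x) = qscale (a * b) x.
Proof. by quaternion_ring. Qed.
Fact qscale1 : left_id 1 qscale. Proof. by quaternion_ring. Qed.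
Fact qscaleDr : right_distributive qscale +%R. Proof. by quaternion_ring. Qed.
Fact qscaleDl x : {morph qscale^~ x : a b / a + b}.
Proof. by quaternion_ring. Qed.

HB.instance Definition _ := GRing.Zmodule_isLmodule.Build R (quaternion R)
  qscaleA qscale1 qscaleDr qscaleDl.

Fact qscaleAl a x y : a *: (x * y) = a *: x * y.
Proof. by quaternion_ring. Qed.
HB.instance Definition _ :=
  GRing.Lmodule_isLalgebra.Build R (quaternion R) qscaleAl.

Fact qscaleAr a x y : a *: (x * y) = x * (a *: y).
Proof. by quaternion_ring. Qed.
HB.instance Definition _ :=
  GRing.Lalgebra_isAlgebra.Build R (quaternion R) qscaleAr.

End Quaternion.

(* Rcomplex R is the library's name for R[i] as an algebra over R. *)
Fact Rcomplex_scalerAr (R : rcfType) (a : R) (x y : Rcomplex R) :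
  a *: (x * y) = x * (a *: y).
Proof. by rewrite mulrC scalerAl mulrC. Qed.

HB.instance Definition _ (R : rcfType) :=
  GRing.Lalgebra_isAlgebra.Build R (Rcomplex R) (@Rcomplex_scalerAr R).

(* M(m, D) as an algebra over R, for m > 0.  The plain matrix type carries a
   module structure over D instead, and is a nontrivial ring only when its size
   is syntactically a successor. *)
Definition matrix_algebra (R : comNzRingType) (D : algType R) (m : nat) :
  Type := 'M[D]_(m.-1.+1).

Section MatrixAlgebra.
Variables (R : comNzRingType) (D : algType R) (m : nat).
Local Notation MD := (matrix_algebra D m).

HB.instance Definition _ := GRing.NzRing.on MD.

Definition mxscale (a : R) (M : MD) : MD := \matrix_(i, j) (a *: M i j).

Fact mxscaleA a b M : mxscale a (mxscale b M) = mxscale (a * b) M.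
Proof. by apply/matrixP => i j; rewrite !mxE scalerA. Qed.
Fact mxscale1 : left_id 1 mxscale.
Proof. by move=> M; apply/matrixP => i j; rewrite !mxE scale1r. Qed.
Fact mxscaleDr : right_distributive mxscale +%R.
Proof. by move=> a M N; apply/matrixP => i j; rewrite !mxE scalerDr. Qed.
Fact mxscaleDl M : {morph mxscale^~ M : a b / a + b}.
Proof. by move=> a b; apply/matrixP => i j; rewrite !mxE scalerDl. Qed.

HB.instance Definition _ := GRing.Zmodule_isLmodule.Build R MD
  mxscaleA mxscale1 mxscaleDr mxscaleDl.

Fact mxscaleAl (a : R) (M N : MD) : a *: (M * N) = a *: M * N.
Proof.
apply/matrixP => i j; rewrite !mxE scaler_sumr.
by apply: eq_bigr => k _; rewrite !mxE scalerAl.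
Qed.
HB.instance Definition _ := GRing.Lmodule_isLalgebra.Build R MD mxscaleAl.

Fact mxscaleAr (a : R) (M N : MD) : a *: (M * N) = M * (a *: N).
Proof.
apply/matrixP => i j; rewrite !mxE scaler_sumr.
by apply: eq_bigr => k _; rewrite !mxE scalerAr.
Qed.
HB.instance Definition _ := GRing.Lalgebra_isAlgebra.Build R MD mxscaleAr.

End MatrixAlgebra.

Definition conj_transpose (R : comNzRingType) (D : algType R) (conj : D -> D)
    (m : nat) (M : matrix_algebra D m) : matrix_algebra D m :=
  map_mx conj (trmx M).

Section CompactClassical.
Variable R : realType.

Definition so (m : nat) : set (matrix_algebra R^o m) :=
  [set M | trmx M = - M].

Definition su (m : nat) : set (matrix_algebra (Rcomplex R) m) :=
  [set M | conj_transpose (@conjc R : Rcomplex R -> Rcomplex R) M = - M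
           /\ mxtrace M = 0].

Definition sp (m : nat) : set (matrix_algebra (quaternion R) m) :=
  [set M | conj_transpose (@qconj R) M = - M].

End CompactClassical.

Section Isomorphisms.
Variable R : comNzRingType.

Definition algebra_isom (A B : algType R) : Prop :=
  exists phi : {lrmorphism A -> B}, bijective phi.

(* T is the tensor product of A and B over R, with i a * j b in the role of
   the pure tensor of a and b. *)
Definition is_tensor_product (A B T : algType R) : Prop :=
  exists (i : {lrmorphism A -> T}) (j : {lrmorphism B -> T}),
    (forall a b, i a * j b = j b * i a) /\
    forall (W : lmodType R) (beta : A -> B -> W),
      (forall a, linear (beta a)) -> (forall b, linear (beta^~ b)) ->
      exists h : {linear T -> W},
        (forall a b, h (i a * j b) = beta a b) /\
        forall h' : {linear T -> W},
          (forall a b, h' (i a * j b) = beta a b) -> h' =1 h.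

(* Only the restriction of phi to the Lie subalgebra U matters. *)
Definition lie_isom (L M : lieAlgType R) (U : set L) (V : set M) : Prop :=
  exists phi : L -> M,
    [/\ set_bij U V phi,
        forall a x y, U x -> U y -> phi (a *: x + y) = a *: phi x + phi y
      & forall x y, U x -> U y -> phi (lie x y) = lie (phi x) (phi y)].

End Isomorphisms.

Section LieSubalgebras.
Variables (R : realType) (C : falgType R).
Implicit Types (U V W I : {vspace C}) (G : set C).

Definition is_lie_subalgebra V : Prop :=
  forall x y, x \in V -> y \in V -> commutator x y \in V.

Definition lie_prod U V : {vspace C} :=
  <<[seq commutator x y | x <- vbasis U, y <- vbasis V]>>%VS.

Definition is_lie_ideal I V : Prop := (I <= V)%VS /\ (lie_prod V I <= I)%VS.

Definition is_lie_solvable V : Prop :=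
  exists k, iter k (fun U => lie_prod U U) V = 0%VS.

Definition is_lie_semisimple V : Prop :=
  is_lie_subalgebra V /\
  forall I, is_lie_ideal I V -> is_lie_solvable I -> I = 0%VS.

(* The topology of the finite-dimensional space C is transported from row
   vectors along coordinates in a basis; it does not depend on the basis. *)
Definition coords (x : C) : 'rV[R]_(\dim {:C}) := 
  passmx.rVof (vbasis {:C}) x.

Definition is_exp (x y : C) : Prop :=
  (fun N : nat => coords (\sum_(k < N) (k`!%:R)^-1 *: x ^+ k)) @ \oo
    --> coords y.

Definition is_compact_unit_subgroup G : Prop :=
  [/\ G `<=` [set x | x \is a GRing.unit], G 1,
      forall x y, G x -> G y -> G (x * y), forall x, G x -> G x^-1
    & compact (coords @` G)].

(* The Lie algebra of a closed subgroup G consists of the x such that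
   exp(t x) lies in G for all real t. *)
Definition is_lie_algebra_of V G : Prop :=
  forall x, x \in V <-> forall t : R, exists2 y, is_exp (t *: x) y & G y.

Definition is_lie_compact V : Prop :=
  exists2 G, is_compact_unit_subgroup G & is_lie_algebra_of V G.

Definition is_maximal_semisimple_compact V : Prop :=
  [/\ is_lie_semisimple V, is_lie_compact V
    & forall W, is_lie_semisimple W -> is_lie_compact W -> (V <= W)%VS ->
        W = V].

End LieSubalgebras.

(* V is isomorphic as a Lie algebra to X, a Lie subalgebra of T, where T is
   isomorphic to C and is the tensor product of A and M(k, R). *)
Definition isomorphic_within (R : realType) (C : falgType R) (V : {vspace C})
    (A : algType R) (k : nat) (T : algType R) (X : set T) : Prop :=
  [/\ @lie_isom R (lie_of C) (lie_of T) [set` V] X,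
      algebra_isom C T
    & is_tensor_product A (matrix_algebra R^o k) T].

(* Main.v *)
Require Import Defs.
From HB Require Import structures.
From mathcomp Require Import all_boot all_order all_algebra falgebra.
From mathcomp Require Import complex sesquilinear spectral ring zify.
From mathcomp Require Import boolp classical_sets functions reals topology.
From mathcomp Require Import normedtype sequences exp trigo.

Set Implicit Arguments.
Unset Strict Implicit.
Unset Printing Implicit Defensive.

Import Order.TTheory GRing.Theory Num.Theory.
Import numFieldNormedType.Exports.

Local Open Scope ring_scope.

(* The monomials v_S (S a subset of the indices, factors in increasing order)
   form a basis of C.  Let tau be the anti-automorphism fixing the v_i.  The
   image of rho is spanned by the v_S with tau v_S = - v_S, i.e. |S| mod 4 in
   {2, 3}, without the volume element when n mod 4 = 3: the bracket with a pair
   exchanges one index of S for another, and brackets with triples raise the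
   size of S.
   The form tr (tau x * y), with tr the coefficient of 1, is positive definite,
   which makes the image semisimple with trivial center.  The x with
   exp (t x) unitary (tau y * y = 1) for all t are those with tau x = - x, so the
   unitary group proves compactness; when n mod 4 = 3 one adds the condition
   det = 1.  If W is compact semisimple and contains the image, a tau-fixed a in
   W vanishes, because tr (exp a + exp (- a)) >= tr (a ^+ 2) while exp (t a)
   stays bounded; hence W is the image plus a center, and the center is 0.
   In explicit matrix models of C, obtained from Kronecker products with Pauli
   matrices, tau is the conjugate transpose, which identifies the image with
   so, su or sp. *)

(** * Clifford monomials *)

(** Both [g] and [C] are known only through universal properties, so no basis is given. Applied to
    the subalgebra of elements satisfying a closed predicate, such a property yields induction over
    generators. For odd n the automorphism sending [v i] to [- v i] shows that the volume element is
    not a scalar, which is the one obstruction to independence of the monomials. The matrix models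
    need no separate classification: n anticommuting hermitian involutions give a morphism from [C],
    injective by independence and surjective by a dimension count, and tau is the conjugate
    transpose transported along it. The residue of n modulo 4 enters through the volume element,
    which is central for odd n. If n mod 4 = 1 it has square 1 and is fixed by tau, whence the two
    summands. If n mod 4 = 3 it has square -1 and is skew, and it accounts for the difference
    between u and su. In the maximality argument W is not known to be stable under tau, so the
    hermitian part of an element of W cannot be used directly; only its brackets with the image
    can. *)

Definition symdiff (T : finType) (A B : {set T}) : {set T} :=
  [set x | (x \in A) (+) (x \in B)].

Lemma symdiff_eq0 (T : finType) (A B : {set T}) : (symdiff A B == finset.set0) = (A == B).
Proof.
apply/eqP/eqP => [AB|->]; last by apply/setP => x; rewrite !inE addbb.
apply/setP => x; have := congr1 (fun E : {set T} => x \in E) AB.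
by rewrite !inE; case: (x \in A); case: (x \in B).
Qed.

Lemma signr_eq_odd (R : pzRingType) (a b : nat) :
  odd a = odd b -> (-1) ^+ a = (-1) ^+ b :> R.
Proof. by rewrite -(signr_odd _ a) -(signr_odd _ b) => ->. Qed.

Section CliffordMonomials.
Variables (R : realType) (n : nat) (A : algType R) (v : 'I_n -> A).

Definition seqmon (s : seq 'I_n) : A := \prod_(i <- s) v i.
Definition mon (S : {set 'I_n}) : A := seqmon (enum S).

Lemma mon0 : mon finset.set0 = 1.
Proof. by rewrite /mon enum_set0 /seqmon big_nil. Qed.

Lemma mon1 i : mon [set i] = v i.
Proof. by rewrite /mon enum_set1 /seqmon big_seq1. Qed.

Lemma seqmon_cons i s : seqmon (i :: s) = v i * seqmon s.
Proof. exact: big_cons. Qed.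

Lemma seqmon_cat s t : seqmon (s ++ t) = seqmon s * seqmon t.
Proof. exact: big_cat. Qed.

Lemma seqmon_rev_cons i s : seqmon (rev (i :: s)) = seqmon (rev s) * v i.
Proof. by rewrite rev_cons -cats1 seqmon_cat /seqmon big_seq1. Qed.

Hypothesis hv : clifford_relations v.

Lemma cliff_sq i : v i * v i = 1. Proof. by case: hv. Qed.

Lemma cliff_comm i j : v i * v j = (-1) ^+ (i != j) *: (v j * v i).
Proof.
by case: eqP => [->|/eqP/(hv.2 _ _) ->]; rewrite ?scale1r ?scaleN1r.
Qed.

(** Passing a letter other than [v i] costs a sign and passing [v i] costs none. The exponent is the
    size minus the count, written as a sum because only its parity matters. *)
Lemma gen_seqmonC i s :
  v i * seqmon s = (-1) ^+ (size s + count_mem i s) *: (seqmon s * v i).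
Proof.
elim: s => [|j s IH].
  by rewrite /seqmon big_nil mulr1 mul1r scale1r.
rewrite seqmon_cons mulrA cliff_comm -scalerAl -(mulrA (v j) (v i)) IH -scalerAr scalerA.
rewrite -!mulrA -exprD /=; congr (_ *: _); apply: signr_eq_odd.
by rewrite eq_sym; case: eqP => _ /=; lia.
Qed.

(** Only the existence of a sign is recorded here; the signs that matter later, those of
    commutation, reversal and squaring, are computed separately. *)
Lemma seqmon_perm s t : perm_eq s t ->
  exists b : bool, seqmon s = (-1) ^+ b *: seqmon t.
Proof.
elim: s t => [|i s IH] t.
  by rewrite perm_sym => /perm_nilP ->; exists false; rewrite scale1r.
move=> st; have it : i \in t by rewrite -(perm_mem st) mem_head.
case/splitPr: it st => t1 t2 st.
have /IH[b sE] : perm_eq s (t1 ++ t2).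
  by rewrite -(perm_cons i) (perm_trans st) // perm_catC /= perm_cons perm_catC.
exists (b (+) odd (size t1 + count_mem i t1)).
rewrite seqmon_cons sE !seqmon_cat seqmon_cons -scalerAr !mulrA gen_seqmonC.
by rewrite -scalerAl scalerA signr_addb signr_odd.
Qed.

Lemma gen_mon i S :
  exists b : bool, v i * mon S = (-1) ^+ b *: mon (symdiff [set i] S).
Proof.
have [iS|iS] := boolP (i \in S); last first.
  rewrite -seqmon_cons; apply: seqmon_perm; apply: uniq_perm.
  - by rewrite /= mem_enum iS enum_uniq.
  - exact: enum_uniq.
  move=> j; rewrite inE !mem_enum !inE; case: eqP => // -> /=.
  by rewrite (negPf iS).
have /seqmon_perm[b SE] : perm_eq (enum S) (i :: enum (symdiff [set i] S)).
  apply: uniq_perm; rewrite /= ?enum_uniq ?mem_enum ?inE ?eqxx ?iS //.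
  by move=> j; rewrite inE !mem_enum !inE; case: eqP => // ->.
exists b; rewrite {1}/mon SE seqmon_cons -scalerAr mulrA cliff_sq mul1r.
by [].
Qed.

Lemma seqmon_mon s S : uniq s ->
  exists b : bool, seqmon s * mon S = (-1) ^+ b *: mon (symdiff [set x in s] S).
Proof.
elim: s => [_|i s IH /= /andP[is_ /IH[b sE]]].
  exists false; rewrite /seqmon big_nil mul1r scale1r; congr mon.
  by apply/setP => x; rewrite !inE.
have [c cE] := gen_mon i (symdiff [set x in s] S).
exists (c (+) b); rewrite seqmon_cons -mulrA sE -scalerAr cE scalerA signr_addb.
rewrite mulrC; congr (_ *: mon _); apply/setP => x; rewrite !inE addbA.
by case: eqP => // -> /=; rewrite (negPf is_).
Qed.

Lemma mon_mul S T :
  exists b : bool, mon S * mon T = (-1) ^+ b *: mon (symdiff S T).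
Proof.
have [b bE] := seqmon_mon T (enum_uniq (mem S)); exists b.
rewrite bE; congr (_ *: mon _); apply/setP => x.
by rewrite !inE mem_enum.
Qed.

Lemma monC S T :
  mon S * mon T = (-1) ^+ (#|S| * #|T| + #|S :&: T|) *: (mon T * mon S).
Proof.
suff seqC s : uniq s -> seqmon s * mon T =
    (-1) ^+ (size s * #|T| + count (mem T) s) *: (mon T * seqmon s).
  rewrite seqC ?enum_uniq // -cardE; congr ((-1) ^+ (_ + _) *: _).
  rewrite -size_filter cardE; apply: perm_size; apply: uniq_perm.
  - by rewrite filter_uniq // enum_uniq.
  - exact: enum_uniq.
  by move=> x; rewrite mem_filter !mem_enum !inE andbC.
elim: s => [_|i s IH /= /andP[_ /IH sE]].
  by rewrite /seqmon big_nil mulr1 mul1r scale1r.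
have := gen_seqmonC i (enum T); rewrite -/(mon T) -cardE.
rewrite count_uniq_mem ?enum_uniq // mem_enum => iT.
rewrite seqmon_cons -mulrA sE -scalerAr (mulrA (v i)) iT -scalerAl scalerA -exprD mulrA.
by congr ((-1) ^+ _ *: _); rewrite mulSn /= addnACA (addnC (size s * _)) (addnC (count _ _)).
Qed.

(** Reversal makes each of the ['C(size s, 2)] pairs of distinct letters cross exactly once. *)
Lemma seqmon_rev s : uniq s ->
  seqmon (rev s) = (-1) ^+ 'C(size s, 2) *: seqmon s.
Proof.
elim: s => [_|i s IH /= /andP[is_ us]]; first by rewrite scale1r.
rewrite seqmon_rev_cons IH // seqmon_cons gen_seqmonC.
rewrite -scalerAl scalerA; congr (_ *: _); rewrite -exprD binS bin1.
apply: signr_eq_odd; rewrite (count_memPn is_) addn0.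
by rewrite !ssrnat.oddD; case: odd; case: odd.
Qed.

Lemma seqmon_revK s : seqmon (rev s) * seqmon s = 1.
Proof.
elim: s => [|i s IH]; first by rewrite /seqmon !big_nil mulr1.
by rewrite seqmon_rev_cons seqmon_cons -mulrA (mulrA (v i)) cliff_sq mul1r.
Qed.

Lemma mon_sqr S : mon S * mon S = (-1) ^+ 'C(#|S|, 2) *: 1.
Proof.
rewrite -(seqmon_revK (enum S)) seqmon_rev ?enum_uniq // -cardE -scalerAl.
by rewrite scalerA -exprD addnn -signr_odd odd_double scale1r.
Qed.

Lemma mon_neq0 S : mon S != 0.
Proof.
apply/eqP => S0; have := mon_sqr S; rewrite S0 mulr0 => /eqP.
by rewrite eq_sym scaler_eq0 signr_eq0 oner_eq0.
Qed.

End CliffordMonomials.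

Lemma symdiffK (T : finType) (A B : {set T}) : symdiff A (symdiff A B) = B.
Proof. by apply/setP => x; rewrite !inE addbA addbb. Qed.

(** * Linear independence of the monomials *)

Section MonomialIndependence.
Variables (R : realType) (n : nat) (A : algType R) (v : 'I_n -> A).
Hypothesis hv : clifford_relations v.

Let commutes (i : 'I_n) (S : {set 'I_n}) := ~~ odd (#|S| + (i \in S)).

Lemma mon_conj i S :
  v i * mon v S * v i = (-1) ^+ (#|S| + (i \in S)) *: mon v S.
Proof.
have := gen_seqmonC hv i (enum S); rewrite -/(mon v S) -cardE.
rewrite count_uniq_mem ?enum_uniq // mem_enum => ->.
by rewrite -scalerAl -mulrA cliff_sq // mulr1.
Qed.

(** Adding to the relation its conjugate by [v i] cancels the monomials that anticommute with [v i]
    and doubles the others. *)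
Lemma relation_average (c : {set 'I_n} -> R) (P : pred {set 'I_n}) i :
  \sum_(S | P S) c S *: mon v S = 0 ->
  \sum_(S | P S && commutes i S) c S *: mon v S = 0.
Proof.
move=> c0; have : \sum_(S | P S) c S *: mon v S
   + v i * (\sum_(S | P S) c S *: mon v S) * v i = 0.
  by rewrite c0 mulr0 mul0r addr0.
rewrite mulr_sumr mulr_suml -big_split /=.
rewrite (bigID (commutes i)) /= [X in _ + X]big1 ?addr0; last first.
  move=> S /andP[_]; rewrite /commutes negbK => So.
  rewrite -scalerAr -scalerAl mon_conj -signr_odd So.
  by rewrite scaleN1r scalerN subrr.
rewrite (eq_bigr (fun S => 2 *: (c S *: mon v S))).
  rewrite -scaler_sumr => /eqP; rewrite scaler_eq0 pnatr_eq0 /= => /eqP //.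
move=> S /andP[_ /negbTE So].
rewrite -scalerAr -scalerAl mon_conj -signr_odd So.
by rewrite scale1r scalerDl scale1r.
Qed.

Lemma relation_center (c : {set 'I_n} -> R) :
  \sum_S c S *: mon v S = 0 ->
  \sum_(S | [forall i, commutes i S]) c S *: mon v S = 0.
Proof.
move=> c0.
have avg s : \sum_(S | all (commutes^~ S) s) c S *: mon v S = 0.
  elim: s => [|i s IH] //=.
  by under eq_bigl => S do rewrite andbC; apply: relation_average.
rewrite -[RHS](avg (enum 'I_n)); apply: eq_bigl => S.
apply/forallP/allP => [SP i _|SP i]; first exact: SP.
by apply: SP; rewrite mem_enum.
Qed.

(** An index inside S forces #|S| to be odd and an index outside forces it to be even, so both kinds
    cannot occur. *)
Lemma commutes_all S : [forall i, commutes i S] ->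
  S = finset.set0 \/ (odd n /\ S = [set: 'I_n]).
Proof.
move/forallP => SP; have [->|[i iS]] := set_0Vmem S; first by left.
right; have oS : odd #|S|.
  by have := SP i; rewrite /commutes iS addn1 /= negbK.
suff ST : S = [set: 'I_n] by split=> //; move: oS; rewrite ST cardsT card_ord.
apply/setP => j; rewrite inE; apply: contraTT oS => jS.
by have := SP j; rewrite /commutes (negbTE jS) addn0.
Qed.

(** For odd n the volume element is central and the relations alone allow it to be a scalar, as with
    n = 1 and [v i] = 1; the monomials are then dependent. *)
Hypothesis full_nscalar : odd n -> forall r : R, mon v [set: 'I_n] <> r *: 1.

Lemma relation_coef0 (c : {set 'I_n} -> R) :
  \sum_S c S *: mon v S = 0 -> c finset.set0 = 0.
Proof.
move/relation_center.
rewrite (bigD1 finset.set0) /=; last first.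
  by apply/forallP => i; rewrite /commutes cards0 inE.
rewrite mon0; have [on|on] := boolP (odd n); last first.
  rewrite big1 ?addr0; last first.
    move=> S /andP[/commutes_all[->|[/(negP on)//]]].
    by rewrite eqxx.
  by move/eqP; rewrite scaler_eq0 oner_eq0 orbF => /eqP.
have [TN|TN] := eqVneq [set: 'I_n] (finset.set0).
  by have := cards0 'I_n; rewrite -TN cardsT card_ord => n0; rewrite n0 in on.
rewrite (bigD1 [set: 'I_n]) /=; last first.
  by rewrite TN andbT; apply/forallP => i; rewrite /commutes cardsT card_ord inE addn1 /= on.
rewrite big1 ?addr0; last first.
  move=> S /andP[/andP[/commutes_all[->|[_ ->]]]]; first by rewrite eqxx.
  by rewrite eqxx.
have [->|cT] := eqVneq (c [set: 'I_n]) 0.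
  by rewrite scale0r addr0 => /eqP; rewrite scaler_eq0 oner_eq0 orbF => /eqP.
move=> /(congr1 (fun x => (c [set: 'I_n])^-1 *: x)).
rewrite scaler0 scalerDr !scalerA mulVf // scale1r => /eqP.
by rewrite addrC addr_eq0 -scaleNr => /eqP /full_nscalar-/(_ on).
Qed.

(** Multiplication by [mon v S0] permutes the monomials up to sign and moves the coefficient of S0
    to that of the empty set. *)
Lemma mon_indep (c : {set 'I_n} -> R) :
  \sum_S c S *: mon v S = 0 -> forall S, c S = 0.
Proof.
move=> c0 S0.
have /choice[b bE] : forall S, exists b : bool,
    mon v S0 * mon v S = (-1) ^+ b *: mon v (symdiff S0 S).
  by move=> S; apply: mon_mul.
have : \sum_S ((-1) ^+ b (symdiff S0 S) * c (symdiff S0 S)) *: mon v S = 0.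
  transitivity (mon v S0 * \sum_S c S *: mon v S); last by rewrite c0 mulr0.
  rewrite mulr_sumr.
  rewrite (reindex_inj (can_inj (symdiffK S0))) /=; apply: eq_bigr => S _.
  by rewrite symdiffK -scalerAr bE scalerA mulrC.
move/relation_coef0.
have -> : symdiff S0 finset.set0 = S0 by apply/setP => x; rewrite !inE addbF.
by move/eqP; rewrite mulf_eq0 signr_eq0 /= => /eqP.
Qed.

End MonomialIndependence.

(** * The Clifford algebra: basis, trace and reversal *)

Section SubalgebraType.
Variables (R : nzRingType) (A : algType R) (P : A -> Prop).
Hypothesis P1 : P 1.
Hypothesis P_linear : forall a x y, P x -> P y -> P (a *: x + y).
Hypothesis P_mul : forall x y, P x -> P y -> P (x * y).

Definition alg_sub_pred : pred A := fun x => `[<P x>].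

Fact alg_sub_closed : subalg_closed alg_sub_pred.
Proof.
split=> [|a x y|x y]; rewrite ?unfold_in; first exact/asboolP.
  by move=> /asboolP Px /asboolP Py; apply/asboolP/P_linear.
by move=> /asboolP Px /asboolP Py; apply/asboolP/P_mul.
Qed.

HB.instance Definition _ := GRing.isSubalgClosed.Build R A alg_sub_pred alg_sub_closed.

Record alg_sub := AlgSub { alg_sub_val :> A; _ : alg_sub_pred alg_sub_val }.

HB.instance Definition _ := [isSub for alg_sub_val].
HB.instance Definition _ := [Choice of alg_sub by <:].
HB.instance Definition _ := [SubChoice_isSubAlgebra of alg_sub by <:].

Lemma alg_subP : exists (B : algType R) (i : {lrmorphism B -> A}),
  [/\ injective i, forall s, P (i s) & forall x, P x -> exists s, i s = x].
Proof.
have val_lin : linear (val : alg_sub -> A) by [].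
have val_mul : monoid_morphism (val : alg_sub -> A) by [].
pose i : {lrmorphism alg_sub -> A} := HB.pack (val : alg_sub -> A)
  (GRing.isLinear.Build R alg_sub A *:%R val val_lin)
  (GRing.isMonoidMorphism.Build alg_sub A val val_mul).
exists alg_sub, i; split; first exact: val_inj.
- by move=> s; apply/asboolP; apply: (valP s).
by move=> x /asboolP Px; exists (AlgSub Px).
Qed.

End SubalgebraType.

Section CliffordGeneration.
Variables (R : fieldType) (n : nat) (C : algType R) (v : 'I_n -> C).
Hypothesis hC : is_clifford v.

Lemma lrmorphism_id_ext (psi : {lrmorphism C -> C}) : psi \o v =1 v -> psi =1 id.
Proof.
have [rel univ] := hC; have [phi0 [_ uniq0]] := univ _ _ rel.
have id_lin : linear (fun y : C => y) by [].
have id_mul : monoid_morphism (fun y : C => y) by [].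
pose ident : {lrmorphism C -> C} := HB.pack (fun y : C => y)
  (GRing.isLinear.Build R C C *:%R (fun y => y) id_lin)
  (GRing.isMonoidMorphism.Build C C (fun y => y) id_mul).
by move=> psiv x; rewrite (uniq0 psi) // -(uniq0 ident).
Qed.

(** The universal property maps [C] into the subalgebra cut out by P. Followed by the inclusion this
    fixes every [v i], hence is the identity, so every element lies in that subalgebra. *)
Lemma clifford_ind (P : C -> Prop) :
  P 1 -> (forall a x y, P x -> P y -> P (a *: x + y)) ->
  (forall x y, P x -> P y -> P (x * y)) ->
  (forall i, P (v i)) -> forall x, P x.
Proof.
move=> P1 Plin Pmul Pv x.
have [B [i [i_inj iP Pi]]] := alg_subP P1 Plin Pmul.
have /choice[w wE] : forall j, exists s, i s = v j by move=> j; apply: Pi.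
have [[vsq vanti] univ] := hC.
have relw : clifford_relations w.
  split=> [j|j k jk]; apply: i_inj.
    by rewrite rmorphM /= wE vsq rmorph1.
  by rewrite rmorphN !rmorphM /= !wE vanti.
have [phi [phiv _]] := univ _ _ relw.
pose psi : {lrmorphism C -> C} := i \o phi.
have <- : psi x = x.
  by apply: lrmorphism_id_ext => j; apply: etrans (congr1 i (phiv j)) (wE j).
exact: iP.
Qed.

End CliffordGeneration.

Lemma clifford_mon_span (R : realType) n (C : algType R) (v : 'I_n -> C) x :
  is_clifford v -> exists c : {set 'I_n} -> R, x = \sum_S c S *: mon v S.
Proof.
move=> hC; have [hv _] := hC.
elim/(clifford_ind hC): x => [|a x y [c ->] [d ->]|x y [c ->] [d ->]|i].
- exists (fun S => (S == finset.set0)%:R); rewrite (bigD1 finset.set0) //= eqxx.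
  rewrite mon0 scale1r big1 ?addr0 // => S /negbTE ->; exact: scale0r.
- exists (fun S => a * c S + d S); rewrite scaler_sumr -big_split /=.
  by apply: eq_bigr => S _; rewrite scalerDl scalerA.
- have /choice[b bE] : forall ST : {set 'I_n} * {set 'I_n}, exists b : bool,
    mon v ST.1 * mon v ST.2 = (-1) ^+ b *: mon v (symdiff ST.1 ST.2).
    by move=> ST; apply: mon_mul.
  exists (fun U => \sum_S c S * d (symdiff S U) * (-1) ^+ b (S, symdiff S U)).
  rewrite mulr_suml; under [RHS]eq_bigr do rewrite scaler_suml.
  rewrite exchange_big /=; apply: eq_bigr => S _; rewrite mulr_sumr.
  rewrite (reindex_inj (can_inj (symdiffK S))) /=; apply: eq_bigr => T _.
  have := bE (S, symdiff S T) => /=.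
  by rewrite symdiffK -scalerAl -scalerAr => ->; rewrite !scalerA.
exists (fun S => (S == [set i])%:R); rewrite (bigD1 [set i]) //= eqxx.
rewrite mon1 scale1r big1 ?addr0 // => S /negbTE ->; exact: scale0r.
Qed.

Section CliffordTrace.
Variables (R : realType) (n : nat) (C : falgType R) (v : 'I_n -> C).
Hypothesis hC : is_clifford v.

Let hv : clifford_relations v := hC.1.

(** The endomorphism given by the generators [- v i] fixes scalars but negates a product of an odd
    number of generators. *)
Lemma full_mon_nscalar : odd n -> forall r : R, mon v [set: 'I_n] <> r *: 1.
Proof.
move=> on r Tr; have [_ univ] := hC.
have rel : clifford_relations (fun i => - v i).
  by split=> [i|i j ij]; rewrite mulrNN ?hv.1 // mulrNN hv.2.
have [phi [phiv _]] := univ _ _ rel.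
have phiT s : phi (seqmon v s) = (-1) ^+ size s *: seqmon v s.
  elim: s => [|i s IH]; first by rewrite /seqmon big_nil rmorph1 scale1r.
  have -> : phi (seqmon v (i :: s)) = - v i * phi (seqmon v s).
    by rewrite seqmon_cons rmorphM /= -[phi (v i)]/((phi \o v) i) phiv.
  by rewrite IH seqmon_cons -scalerAr mulNr scalerN exprS -scalerA scaleN1r.
have := phiT (enum [set: 'I_n]); rewrite -/(mon v _) -cardE cardsT card_ord.
rewrite -signr_odd on scaleN1r {1}Tr linearZ /= rmorph1 -Tr.
move/eqP; rewrite -addr_eq0 -mulr2n -scaler_nat scaler_eq0 pnatr_eq0 /=.
by rewrite (negbTE (mon_neq0 hv _)).
Qed.

(** The coefficients are merely chosen at this point; [cf_uniq] shows that they do not depend on the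
    choice. *)
Definition cf (S : {set 'I_n}) (x : C) : R := projT1 (cid (clifford_mon_span x hC)) S.

Lemma cf_sum x : x = \sum_S cf S x *: mon v S.
Proof. by rewrite /cf; case: cid. Qed.

Lemma cf_uniq (c : {set 'I_n} -> R) S : cf S (\sum_T c T *: mon v T) = c S.
Proof.
set x := \sum_T _; apply/eqP; rewrite -subr_eq0; apply/eqP.
apply: (mon_indep hv full_mon_nscalar (c := fun T => cf T x - c T)).
under eq_bigr do rewrite scalerBl; rewrite sumrB -cf_sum; exact: subrr.
Qed.

Fact cf_linear S : linear (cf S : C -> R^o).
Proof.
move=> a x y; rewrite {1}(cf_sum x) {1}(cf_sum y) scaler_sumr -big_split /=.
under eq_bigr do rewrite scalerA -scalerDl.
exact: cf_uniq.
Qed.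

HB.instance Definition _ S :=
  GRing.isLinear.Build R C R^o *:%R (cf S : C -> R^o) (cf_linear S).

Lemma cf_mon S T : cf S (mon v T) = (S == T)%:R.
Proof.
rewrite -[mon v T](_ : \sum_U (U == T)%:R *: mon v U = _) ?cf_uniq //.
rewrite (bigD1 T) //= eqxx scale1r big1 ?addr0 // => U /negbTE ->.
exact: scale0r.
Qed.

Lemma cf_eq0 x : (forall S, cf S x = 0) -> x = 0.
Proof. by move=> x0; rewrite (cf_sum x) big1 // => S _; rewrite x0 scale0r. Qed.

Definition tr (x : C) : R^o := cf finset.set0 x.

HB.instance Definition _ :=
  GRing.isLinear.Build R C R^o *:%R tr (cf_linear finset.set0).

Lemma tr_mon S T : S != T -> tr (mon v S * mon v T) = 0.
Proof.
move=> ST; have [b ->] := mon_mul hv S T.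
rewrite linearZ /= /tr cf_mon [_ == symdiff _ _]eq_sym symdiff_eq0 (negbTE ST).
exact: mulr0.
Qed.

Lemma tr1 : tr 1 = 1.
Proof. by rewrite -(mon0 v) /tr cf_mon eqxx. Qed.

Lemma trC x y : tr (x * y) = tr (y * x).
Proof.
rewrite (cf_sum x) (cf_sum y) !mulr_suml !linear_sum /=.
under eq_bigr do rewrite mulr_sumr linear_sum /=.
under [RHS]eq_bigr do rewrite mulr_sumr linear_sum /=.
rewrite [RHS]exchange_big /=; apply: eq_bigr => S _; apply: eq_bigr => T _.
rewrite -!scalerAl -!scalerAr !linearZ /= scalerA [in RHS]scalerA mulrC.
have [->//|ST] := eqVneq S T; by rewrite !tr_mon // eq_sym.
Qed.

Lemma tr_mon_mul S x : tr (mon v S * x) = (-1) ^+ 'C(#|S|, 2) * cf S x.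
Proof.
rewrite {1}(cf_sum x) mulr_sumr linear_sum (bigD1 S) //= big1 ?addr0.
  by rewrite -scalerAr linearZ /= mon_sqr // linearZ /= tr1 mulrC -[_ *: 1]/(_ * 1) mulr1.
by move=> T TS; rewrite -scalerAr linearZ /= tr_mon ?scaler0 // eq_sym.
Qed.

(** The reversal is an assumption throughout the abstract part; [model_iso] provides it from a
    matrix model. *)
Variable tau : {linear C -> C}.
Hypothesis tauM : forall x y, tau (x * y) = tau y * tau x.
Hypothesis tau1 : tau 1 = 1.
Hypothesis tau_gen : forall i, tau (v i) = v i.

Lemma tau_seqmon s : tau (seqmon v s) = seqmon v (rev s).
Proof.
elim: s => [|i s IH]; first by rewrite /seqmon big_nil tau1.
by rewrite seqmon_rev_cons seqmon_cons tauM IH tau_gen.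
Qed.

Lemma tau_mon S : tau (mon v S) = (-1) ^+ 'C(#|S|, 2) *: mon v S.
Proof. by rewrite tau_seqmon seqmon_rev ?enum_uniq // -cardE. Qed.

Lemma cf_tau S x : cf S (tau x) = (-1) ^+ 'C(#|S|, 2) * cf S x.
Proof.
rewrite {1}(cf_sum x) linear_sum /=.
under eq_bigr do rewrite linearZ /= tau_mon scalerA mulrC.
exact: cf_uniq.
Qed.

Lemma tauK x : tau (tau x) = x.
Proof.
apply/eqP; rewrite -subr_eq0; apply/eqP/cf_eq0 => S.
rewrite linearB /= !cf_tau mulrA -exprD addnn -signr_odd odd_double.
by rewrite mul1r subrr.
Qed.

(** The monomials are orthonormal for this form: the reversal sign of [mon v S] cancels the sign of
    its square. *)
Lemma tr_tau x : tr (tau x * x) = \sum_S cf S x ^+ 2.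
Proof.
rewrite {1}(cf_sum x) linear_sum mulr_suml linear_sum /=.
apply: eq_bigr => S _; rewrite linearZ /= tau_mon scalerA -scalerAl linearZ /=.
rewrite tr_mon_mul -[_ *: _]/(_ * _) -mulrA [X in _ * X]mulrA -exprD.
by rewrite addnn -signr_odd odd_double mul1r -expr2.
Qed.

Lemma tr_tau_ge0 x : 0 <= tr (tau x * x).
Proof. by rewrite tr_tau; apply: sumr_ge0 => S _; apply: sqr_ge0. Qed.

Lemma tr_tau_eq0 x : tr (tau x * x) = 0 -> x = 0.
Proof.
rewrite tr_tau => /eqP; rewrite psumr_eq0 => [/allP x0|S _]; last exact: sqr_ge0.
apply: cf_eq0 => S; apply/eqP; rewrite -(sqrf_eq0 (cf S x)).
by apply: x0; rewrite mem_index_enum.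
Qed.

(* The index sets of the monomials that tau negates, except that of the volume
   element when it is central. *)
Definition spinset (S : {set 'I_n}) :=
  (2 <= #|S| %% 4)%N && ~~ ((S == [set: 'I_n]) && (n %% 4 == 3)%N).

Lemma odd_bin2 m : odd 'C(m, 2) = (2 <= m %% 4)%N.
Proof.
elim: m => // m IH; rewrite binS bin1 ssrnat.oddD {}IH.
have -> : odd m = odd (m %% 4) by lia.
rewrite -(addn1 m) -modnDml; have := ltn_pmod m (isT : 0 < 4)%N.
by case: (m %% 4)%N => [|[|[|[|]]]].
Qed.

Definition spin_image : {vspace C} := (\sum_(S | spinset S) <[mon v S]>)%VS.

Lemma spin_imageP x :
  reflect (forall S, ~~ spinset S -> cf S x = 0) (x \in spin_image).
Proof.
apply: (iffP memv_sumP) => [[w wP ->] S SP|x0].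
  rewrite linear_sum big1 //= => T TP.
  have /vlineP[k ->] := wP T TP; rewrite linearZ /= cf_mon.
  by case: eqP TP SP => [->->//|_ _ _]; apply: mulr0.
exists (fun S => cf S x *: mon v S) => [S _|]; first exact/memvZ/memv_line.
rewrite {1}(cf_sum x) (bigID spinset) /= [X in _ + X]big1 ?addr0 // => S SP.
by rewrite x0 // scale0r.
Qed.

Lemma tau_skewP x :
  tau x = - x <-> (forall S : {set 'I_n}, ~~ odd 'C(#|S|, 2) -> cf S x = 0).
Proof.
split=> [xN S /negbTE oS|x0].
  have := cf_tau S x; rewrite xN linearN /= -signr_odd oS mul1r => /eqP.
  by rewrite -subr_eq0 -opprD oppr_eq0 -mulr2n mulrn_eq0 => /eqP.
apply/eqP; rewrite -addr_eq0; apply/eqP/cf_eq0 => S; rewrite linearD /= cf_tau.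
have [oS|/x0 ->] := boolP (odd 'C(#|S|, 2)); last by rewrite mulr0 addr0.
by rewrite -signr_odd oS mulN1r addNr.
Qed.

Lemma spin_imageE x :
  x \in spin_image <-> tau x = - x /\ ((n %% 4 = 3)%N -> cf [set: 'I_n] x = 0).
Proof.
split=> [/spin_imageP x0|[/tau_skewP x0 xT]].
  split=> [|n3]; last by apply: x0; rewrite /spinset n3 !eqxx andbF.
  apply/tau_skewP => S; rewrite odd_bin2 => oS; apply: x0.
  by rewrite /spinset negb_and oS.
apply/spin_imageP => S; rewrite /spinset negb_and negbK -odd_bin2.
by case/orP => [/x0//|/andP[/eqP-> /eqP]].
Qed.

Lemma full_mon_central x : odd n -> mon v [set: 'I_n] * x = x * mon v [set: 'I_n].
Proof.
move=> on; rewrite (cf_sum x) mulr_suml mulr_sumr; apply: eq_bigr => S _.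
rewrite -scalerAr -scalerAl monC // finset.setTI cardsT card_ord.
by rewrite -signr_odd ssrnat.oddD oddM on addbb scale1r.
Qed.

Lemma odd_mod4 : (n %% 4 = 3)%N -> odd n.
Proof. by lia. Qed.

(** Skewness is preserved because tau is an antiautomorphism. The volume coefficient of a commutator
    is, up to sign, its trace against a central element, which vanishes by [trC]. *)
Lemma spin_image_lie x y : x \in spin_image -> y \in spin_image ->
  commutator x y \in spin_image.
Proof.
move=> /spin_imageE[xN _] /spin_imageE[yN _]; apply/spin_imageE; split.
  by rewrite /commutator linearB /= !tauM xN yN !mulrNN opprB.
move=> n3; have := tr_mon_mul [set: 'I_n] (commutator x y).
rewrite /commutator mulrBr linearB /= !mulrA [tr (_ * y * x)]trC mulrA.
rewrite -(full_mon_central x (odd_mod4 n3)) subrr => /esym/eqP.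
by rewrite mulf_eq0 signr_eq0 => /eqP.
Qed.

End CliffordTrace.

(** * Generation of the fixed subalgebra by the Berman generators *)

Section LieTheory.
Variables (R : pzRingType) (L : lieAlgType R).
Implicit Types x y z : L.

Lemma lieDl x y z : lie (x + y) z = lie x z + lie y z.
Proof. by have := lie_linearl z 1 x y; rewrite !scale1r. Qed.

Lemma lieDr x y z : lie z (x + y) = lie z x + lie z y.
Proof. by have := lie_linearr z 1 x y; rewrite !scale1r. Qed.

Lemma lie0l z : lie 0 z = 0.
Proof. by apply: (addrI (lie 0 z)); rewrite -lieDl !addr0. Qed.

Lemma lie0r z : lie z 0 = 0.
Proof. by apply: (addrI (lie z 0)); rewrite -lieDr !addr0. Qed.

Lemma lieZl a x z : lie (a *: x) z = a *: lie x z.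
Proof. by have := lie_linearl z a x 0; rewrite !addr0 lie0l addr0. Qed.

Lemma lieZr a x z : lie z (a *: x) = a *: lie z x.
Proof. by have := lie_linearr z a x 0; rewrite !addr0 lie0r addr0. Qed.

Lemma lieNl x z : lie (- x) z = - lie x z.
Proof. by rewrite -scaleN1r lieZl scaleN1r. Qed.

Lemma lieNr x z : lie z (- x) = - lie z x.
Proof. by rewrite -scaleN1r lieZr scaleN1r. Qed.

Lemma lieC x y : lie x y = - lie y x.
Proof.
apply/eqP; rewrite -addr_eq0; apply/eqP.
by have := liexx (x + y); rewrite lieDl !lieDr !liexx add0r addr0.
Qed.

Lemma lie_leibniz x y z : lie x (lie y z) = lie (lie x y) z + lie y (lie x z).
Proof.
have := lie_jacobi x y z; rewrite [lie z (lie x y)]lieC [lie z x]lieC lieNr.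
by move/eqP; rewrite -addrA addr_eq0 opprD !opprK addrC => /eqP.
Qed.

End LieTheory.

Section LieSubtype.
Variables (R : pzRingType) (L : lieAlgType R) (P : L -> Prop).
Hypothesis P0 : P 0.
Hypothesis P_linear : forall a x y, P x -> P y -> P (a *: x + y).
Hypothesis P_lie : forall x y, P x -> P y -> P (lie x y).

Definition lie_sub_pred : pred L := fun x => `[<P x>].
Arguments lie_sub_pred _ /.

Lemma lie_sub_submod_closed : submod_closed lie_sub_pred.
Proof.
split=> [|a x y]; first exact/asboolP.
by rewrite !unfold_in /= => /asboolP Px /asboolP Py; apply/asboolP/P_linear.
Qed.

HB.instance Definition _ :=
  GRing.isSubmodClosed.Build R L lie_sub_pred lie_sub_submod_closed.

Record lie_sub := LieSub { lie_sub_val :> L; _ : lie_sub_pred lie_sub_val }.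

HB.instance Definition _ := [isSub for lie_sub_val].
HB.instance Definition _ := [Choice of lie_sub by <:].
HB.instance Definition _ := [SubChoice_isSubLmodule of lie_sub by <:].

Fact lie_sub_subproof (x y : lie_sub) : lie_sub_pred (lie (val x) (val y)).
Proof. by apply/asboolP/P_lie; apply/asboolP; [exact: (valP x)|exact: (valP y)]. Qed.

Definition lie_sub_lie (x y : lie_sub) := LieSub (lie_sub_subproof x y).

Fact lie_sub_linearl z : linear (lie_sub_lie^~ z).
Proof. by move=> a x y; apply: val_inj; rewrite linearP /= lie_linearl. Qed.

Fact lie_sub_linearr z : linear (lie_sub_lie z).
Proof. by move=> a x y; apply: val_inj; rewrite linearP /= lie_linearr. Qed.

Fact lie_sub_xx x : lie_sub_lie x x = 0.
Proof. by apply: val_inj; rewrite /= liexx. Qed.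

Fact lie_sub_jacobi x y z :
  lie_sub_lie x (lie_sub_lie y z) + lie_sub_lie y (lie_sub_lie z x)
    + lie_sub_lie z (lie_sub_lie x y) = 0.
Proof. by apply: val_inj; rewrite !raddfD /= lie_jacobi. Qed.

HB.instance Definition _ := Lmodule_isLieAlgebra.Build R lie_sub
  lie_sub_linearl lie_sub_linearr lie_sub_xx lie_sub_jacobi.

Lemma lie_sub_alg : exists (S : lieAlgType R) (i : {lie S -> L}),
  [/\ injective i, forall s, P (i s) & forall x, P x -> exists s, i s = x].
Proof.
have val_lin : linear (val : lie_sub -> L) by [].
pose i : {lie lie_sub -> L} := HB.pack (val : lie_sub -> L)
  (GRing.isLinear.Build R lie_sub L *:%R val val_lin)
  (isLieMorphism.Build R lie_sub L val (fun _ _ => erefl)).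
exists lie_sub, i; split; first exact: val_inj.
- by move=> s; apply/asboolP; apply: (valP s).
by move=> x /asboolP Px; exists (LieSub Px).
Qed.

End LieSubtype.

Section KacMoodyGeneration.
Variables (R : fieldType) (n : nat) (A : 'M[int]_n).
Variables (H : vectType R) (root : 'I_n -> 'Hom(H, R^o)) (coroot : 'I_n -> H).
Variables (g : lieAlgType R) (h : {linear H -> g}) (e f : 'I_n -> g).
Hypothesis hg : is_kac_moody A root coroot h e f.

(** The argument of [clifford_ind] for Lie algebras: the elements satisfying P form a Lie algebra in
    which the Chevalley-Serre relations still hold, since its inclusion into [g] is injective. *)
Lemma kac_moody_ind (P : g -> Prop) :
  (forall a x y, P x -> P y -> P (a *: x + y)) ->
  (forall x y, P x -> P y -> P (lie x y)) ->
  (forall x, P (h x)) -> (forall i, P (e i)) -> (forall i, P (f i)) ->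
  forall x, P x.
Proof.
move=> Plin Plie Ph Pe Pf x.
have P0 : P 0 by rewrite -(linear0 h).
have [S [i [i_inj iP Pi]]] := lie_sub_alg P0 Plin Plie.
have /choice[h0 h0E] : forall y, exists s, i s = h y by move=> y; apply: Pi.
have /choice[e0 e0E] : forall y, exists s, i s = e y by move=> y; apply: Pi.
have /choice[f0 f0E] : forall y, exists s, i s = f y by move=> y; apply: Pi.
have h0lin : linear h0.
  by move=> a y z; apply: i_inj; rewrite linearP /= !h0E linearP.
pose h' : {linear H -> S} := HB.pack h0 (GRing.isLinear.Build _ _ _ _ h0 h0lin).
have [_ rel univ] := hg.
have iter_i k y z : i (iter k (lie y) z) = iter k (lie (i y)) (i z).
  by elim: k => //= k IH; rewrite lie_morph IH.
have rel' : kac_moody_relations A root coroot h' e0 f0.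
  split=> [y z|y j|y j|j k|j k jk|j k jk]; apply: i_inj.
  - by rewrite lie_morph !h0E (km_hh rel) linear0.
  - by rewrite lie_morph linearZ /= h0E e0E (km_he rel).
  - by rewrite lie_morph linearN linearZ /= h0E f0E (km_hf rel).
  - rewrite lie_morph e0E f0E (km_ef rel).
    by case: eqP; rewrite ?h0E ?linear0.
  - by rewrite iter_i !e0E (km_serre_e rel) // linear0.
  - by rewrite iter_i !f0E (km_serre_f rel) // linear0.
have [phi [phih phie phif _]] := univ _ _ _ _ rel'.
have [phi0 [_ _ _ uniq0]] := univ _ _ _ _ rel.
pose psi : {lie g -> g} := HB.pack (i \o phi)
  (isLieMorphism.Build R g g (i \o phi)
     (fun y z => etrans (congr1 i (lie_morph y z)) (lie_morph _ _))).
have id_lin : linear (fun y : g => y) by [].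
pose ident : {lie g -> g} := HB.pack (fun y : g => y)
  (GRing.isLinear.Build R g g *:%R (fun y => y) id_lin)
  (isLieMorphism.Build R g g (fun y => y) (fun _ _ => erefl)).
have -> : x = i (phi x).
  transitivity (phi0 x); first by rewrite -(uniq0 ident).
  rewrite -(uniq0 psi) // => y /=.
  - exact: (etrans (congr1 i (phih y)) (h0E y)).
  - exact: (etrans (congr1 i (phie y)) (e0E y)).
  - exact: (etrans (congr1 i (phif y)) (f0E y)).
exact: iP.
Qed.

Variable (omega : {lie g -> g}).
Hypothesis homega : is_chevalley_involution h e f omega.

Lemma chevalley_invol x : omega (omega x) = x.
Proof.
have [oe of_ oh] := homega.
elim/kac_moody_ind: x => [a x y|x y|x|i|i].
- by rewrite !linearP /= => -> ->.
- by rewrite !lie_morph => -> ->.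
- by rewrite oh linearN /= oh opprK.
- by rewrite oe linearN /= of_ opprK.
- by rewrite of_ linearN /= oe opprK.
Qed.

(** A right-nested bracket ending in [e i], with [size s] + 1 letters. *)
Let word i s := foldr (fun j => lie (e j)) (e i) s.

(** The span of the words of at most m letters, as an inductive predicate because [g] may be
    infinite-dimensional. *)
Inductive short_span m : g -> Prop :=
| short_span0 : short_span m 0
| short_span_lin a x y : short_span m x -> short_span m y ->
    short_span m (a *: x + y)
| short_span_word i s : (size s < m)%N -> short_span m (word i s).

Lemma short_span_e m i x : short_span m x -> short_span m.+1 (lie (e i) x).
Proof.
elim=> [|a y z _ Sy _ Sz|j s sm]; first by rewrite lie0r; apply: short_span0.
  by rewrite lie_linearr; apply: short_span_lin.
exact: (@short_span_word _ j (i :: s)).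
Qed.

Lemma short_spanZ m a x : short_span m x -> short_span m (a *: x).
Proof.
by move=> Sx; rewrite -[_ *: _]addr0; apply: short_span_lin => //; apply: short_span0.
Qed.

Lemma short_spanD m x y : short_span m x -> short_span m y -> short_span m (x + y).
Proof. by rewrite -{2}[x]scale1r; apply: short_span_lin. Qed.

Lemma lie_h_word x i s : exists a, lie (h x) (word i s) = a *: word i s.
Proof.
have [_ rel _] := hg.
elim: s => [|j s [a IH]] /=; first by exists (root i x); rewrite (km_he rel).
exists (root j x + a); rewrite lie_leibniz IH (km_he rel) lieZl lieZr.
by rewrite scalerDl.
Qed.

Lemma lie_f_letter j i : exists y, lie (f j) (e i) = h y.
Proof.
have [_ rel _] := hg; rewrite lieC (km_ef rel).
by case: eqP => _; [exists (- coroot i)|exists 0]; rewrite ?linearN ?oppr0 ?linear0.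
Qed.

(** By the Leibniz rule [f j] meets one letter at a time and turns it into an element of the Cartan
    subalgebra, which scales the word after it. A word of at least two letters thus loses one; a
    single letter would land in [h], whence the shape [k :: s]. *)
Lemma lie_f_word j i s k : short_span (size s).+1 (lie (f j) (word i (k :: s))).
Proof.
elim: s k => [|l s IH] k /=.
  rewrite lie_leibniz; have [y ->] := lie_f_letter j k; have [z ->] := lie_f_letter j i.
  have [a /= ->] := lie_h_word y i [::].
  have [b /=] := lie_h_word z k [::]; rewrite lieC => /eqP.
  rewrite eqr_oppLR => /eqP ->; apply: short_spanD; last rewrite -scaleNr.
    by apply: short_spanZ; apply: (@short_span_word _ i [::]).
  by apply: short_spanZ; apply: (@short_span_word _ k [::]).
rewrite lie_leibniz; apply: short_spanD; last exact/short_span_e/IH.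
have [y ->] := lie_f_letter j k; have [a /= ->] := lie_h_word y i (l :: s).
exact/short_spanZ/(@short_span_word _ i (l :: s)).
Qed.

(** The sum of the three parts of the triangular decomposition, with no claim that it is direct.
    Writing the negative part as the image of words under [omega] reduces statements about [f i] to
    statements about [e i]. *)
Inductive tri_span : g -> Prop :=
| tri_span0 : tri_span 0
| tri_span_lin a x y : tri_span x -> tri_span y -> tri_span (a *: x + y)
| tri_span_h x : tri_span (h x)
| tri_span_pos i s : tri_span (word i s)
| tri_span_neg i s : tri_span (omega (word i s)).

Lemma tri_spanZ a x : tri_span x -> tri_span (a *: x).
Proof.
by move=> Sx; rewrite -[_ *: _]addr0; apply: tri_span_lin => //; apply: tri_span0.
Qed.

Lemma tri_spanN x : tri_span x -> tri_span (- x).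
Proof. by rewrite -scaleN1r; apply: tri_spanZ. Qed.

Lemma tri_spanD x y : tri_span x -> tri_span y -> tri_span (x + y).
Proof. by rewrite -{2}[x]scale1r; apply: tri_span_lin. Qed.

Lemma tri_span_short m x : short_span m x -> tri_span x.
Proof.
elim=> [|a y z _ Sy _ Sz|i s sm]; first exact: tri_span0.
  exact: tri_span_lin.
exact: tri_span_pos.
Qed.

Lemma tri_span_omega x : tri_span x -> tri_span (omega x).
Proof.
have [oe of_ oh] := homega.
elim=> [|a y z _ Sy _ Sz|y|i s|i s].
- by rewrite linear0; apply: tri_span0.
- by rewrite linearP; apply: tri_span_lin.
- by rewrite oh -linearN; apply: tri_span_h.
- exact: tri_span_neg.
- by rewrite chevalley_invol; apply: tri_span_pos.
Qed.

Lemma tri_span_e i x : tri_span x -> tri_span (lie (e i) x).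
Proof.
have [oe of_ oh] := homega; have [_ rel _] := hg.
elim=> [|a y z _ Sy _ Sz|y|j s|j s].
- by rewrite lie0r; apply: tri_span0.
- by rewrite lie_linearr; apply: tri_span_lin.
- rewrite lieC (km_he rel); apply/tri_spanN/tri_spanZ.
  exact: (@tri_span_pos i [::]).
- exact: (@tri_span_pos j (i :: s)).
(* As [e i] is [- omega (f i)], the bracket is minus the image under [omega] of the bracket of [f i]
   with a positive word. *)
rewrite -[e i]opprK -of_ lieNl -lie_morph; apply/tri_spanN/tri_span_omega.
case: s => [|k s]; last exact/tri_span_short/lie_f_word.
by have [y /= ->] := lie_f_letter i j; apply: tri_span_h.
Qed.

Lemma tri_span_f i x : tri_span x -> tri_span (lie (f i) x).
Proof.
have [oe of_ oh] := homega.
move=> Sx; rewrite -(chevalley_invol x) -[f i]opprK -oe lieNl -lie_morph.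
by apply/tri_spanN/tri_span_omega/tri_span_e/tri_span_omega.
Qed.

Lemma tri_span_lieh y x : tri_span x -> tri_span (lie (h y) x).
Proof.
have [oe of_ oh] := homega; have [_ rel _] := hg.
elim=> [|a z t _ Sy _ Sz|z|j s|j s].
- by rewrite lie0r; apply: tri_span0.
- by rewrite lie_linearr; apply: tri_span_lin.
- by rewrite (km_hh rel); apply: tri_span0.
- by have [a ->] := lie_h_word y j s; apply/tri_spanZ/tri_span_pos.
rewrite -[h y]opprK -oh lieNl -lie_morph; apply/tri_spanN/tri_span_omega.
by have [a ->] := lie_h_word y j s; apply/tri_spanZ/tri_span_pos.
Qed.

(** The adjoint action of each generator preserves the span, hence so does that of every element; as
    the span contains the generators, it is everything. *)
Lemma tri_span_all x : tri_span x.
Proof.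
have tri_ad y : forall z, tri_span z -> tri_span (lie y z).
  elim/kac_moody_ind: y => [a x1 x2 H1 H2 z Sz|x1 x2 H1 H2 z Sz|y|i|i].
  - by rewrite lie_linearl; apply: tri_span_lin; [apply: H1|apply: H2].
  - have := lie_leibniz x1 x2 z => /eqP; rewrite -subr_eq => /eqP <-.
    by apply: tri_spanD; [apply/H1/H2|apply/tri_spanN/H2/H1].
  - exact: tri_span_lieh.
  - exact: tri_span_e.
  - exact: tri_span_f.
elim/kac_moody_ind: x => [a x y|x y _|x|i|i].
- exact: tri_span_lin.
- exact: tri_ad.
- exact: tri_span_h.
- exact: (@tri_span_pos i [::]).
have [oe of_ oh] := homega; rewrite -[f i]opprK -oe.
by apply/tri_spanN; exact: (@tri_span_neg i [::]).
Qed.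

Fact symmetrize_subproof x : fixed_pred omega (x + omega x).
Proof. by rewrite /fixed_pred linearD /= chevalley_invol addrC. Qed.

Definition symmetrize x : fixed_subalg omega := FixedSubalg (symmetrize_subproof x).

(** A fixed point is the symmetrization of its half. Symmetrization is linear, kills the Cartan
    subalgebra and does not distinguish x from [omega x], so by [tri_span_all] only positive words
    remain; these are handled by induction on their length. *)
Lemma berman_generation (two_neq0 : 2%:R != 0 :> R)
    (K : fixed_subalg omega -> Prop) :
  (forall a x y, K x -> K y -> K (a *: x + y)) ->
  (forall x y, K x -> K y -> K (lie x y)) ->
  K 0 -> (forall i X, val X = e i - f i -> K X) ->
  forall x, K x.
Proof.
move=> Klin Klie K0 Kgen.
have [oe of_ oh] := homega.
pose Q x := K (symmetrize x).
have Qlin a x y : Q x -> Q y -> Q (a *: x + y).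
  move=> Qx Qy; rewrite /Q.
  have -> : symmetrize (a *: x + y) = a *: symmetrize x + symmetrize y.
    by apply: val_inj; rewrite /= linearP /= scalerDr addrACA.
  exact: Klin.
have Qh x : Q (h x).
  rewrite /Q; suff -> : symmetrize (h x) = 0 by [].
  by apply: val_inj; rewrite /= oh subrr.
have Q0 : Q 0 by rewrite -(linear0 h).
have Qword m : forall i s, (size s < m)%N -> Q (word i s).
  elim: m => // m IH i [_|j s].
    apply: (Kgen i); by rewrite /= oe.
  rewrite ltnS => sm.
  have Qf : Q (lie (f j) (word i s)).
    case: s sm => [_|k s sm].
      by have [y /= ->] := lie_f_letter j i.
    elim: (lie_f_word j i s k) => [|a y z _ Qy _ Qz|l t ts] //.
      exact: Qlin.
    by apply: IH; apply: leq_trans ts _; apply: ltnW.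
  have fX : fixed_pred omega (e j - f j).
    by rewrite /fixed_pred linearB /= oe of_ opprK addrC.
  (* With X the j-th Berman generator and w a word, the symmetrization of
     [e_j, w] is [X, symmetrize w] plus that of [f_j, w], which is shorter. *)
  rewrite /Q -[word i _]/(lie (e j) (word i s)).
  have -> : symmetrize (lie (e j) (word i s)) =
      1 *: lie (FixedSubalg fX) (symmetrize (word i s))
        + symmetrize (lie (f j) (word i s)).
    apply: val_inj; rewrite /= scale1r !lie_morph oe of_.
    rewrite lieDl !lieDr !lieNl.
    set a := lie (e j) _; set b := lie (e j) _; set c := lie (f j) _.
    set d := lie (f j) _.
    by rewrite [RHS]addrAC [a + b + _]addrACA subrr addr0 addrA addrK.
  apply: Klin => //; apply: Klie; first exact: (Kgen j).
  exact: IH.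
have Qomega x : Q x -> Q (omega x).
  rewrite /Q; suff -> : symmetrize (omega x) = symmetrize x by [].
  by apply: val_inj; rewrite /= chevalley_invol addrC.
have Qall x : Q x.
  elim: (tri_span_all x) => [|a y z _ Qy _ Qz|y|i s|i s] //.
  - exact: Qlin.
  - exact: (Qword (size s).+1).
  - exact/Qomega/(Qword (size s).+1).
move=> x; have -> : x = symmetrize (2^-1 *: val x); last exact: Qall.
apply: val_inj; rewrite /= linearZ /= (eqP (valP x)) -scalerDl.
by rewrite -mulr2n -[_ *+ 2]mulr_natl divff ?scale1r.
Qed.
End KacMoodyGeneration.

(** * The image of the spin representation *)

Lemma subset_card_ex (T : finType) (S : {set T}) k : (k <= #|S|)%N ->
  exists2 U : {set T}, U \subset S & #|U| = k.
Proof.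
move=> kS; exists [set x in take k (enum S)].
  by apply/fintype.subsetP => x; rewrite inE => /mem_take; rewrite mem_enum.
by rewrite cardsE (card_uniqP _) ?take_uniq ?enum_uniq // size_takel -?cardE.
Qed.

Lemma symdiff_disjoint (T : finType) (A B : {set T}) : A :&: B = finset.set0 ->
  symdiff A B = A :|: B.
Proof.
move=> AB; apply/setP => x; have := congr1 (fun E : {set T} => x \in E) AB.
by rewrite !inE; case: (x \in A); case: (x \in B).
Qed.

Section SpinGeneration.
Variables (R : realType) (n : nat) (C : falgType R) (v : 'I_n -> C).
Hypothesis hn : (4 <= n)%N.
Hypothesis hv : clifford_relations v.

Lemma spin_generator_mon (i : 'I_n) :
  spin_generator v i = 2^-1 *: mon v [set j : 'I_n | spin_support i.+1 j.+1].
Proof.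
congr (_ *: _); rewrite /mon /seqmon -[LHS]big_filter; congr bigop.
by apply: eq_filter => j; rewrite -[RHS]/(j \in _) inE.
Qed.

(** An arbitrary Lie subalgebra containing the spin generators; it is later taken to be the set of
    values of [rho]. *)
Variable K : C -> Prop.
Hypothesis K0 : K 0.
Hypothesis K_linear : forall a x y, K x -> K y -> K (a *: x + y).
Hypothesis K_lie : forall x y, K x -> K y -> K (commutator x y).
Hypothesis K_gen : forall i, K (spin_generator v i).

Lemma K_scale a x : K x -> K (a *: x).
Proof. by move=> Kx; rewrite -[_ *: _]addr0; apply: K_linear. Qed.

(** The parity condition says that the two monomials anticommute, so their commutator is twice their
    product, a nonzero multiple of the monomial of the symmetric difference. *)
Lemma K_bracket (S T : {set 'I_n}) : odd (#|S| * #|T| + #|S :&: T|) ->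
  K (mon v S) -> K (mon v T) -> K (mon v (symdiff S T)).
Proof.
move=> oST KS KT; have := K_lie KS KT; rewrite /commutator (monC hv T S).
rewrite finset.setIC mulnC -signr_odd oST scaleN1r opprK.
have [b ->] := mon_mul hv S T; rewrite -mulr2n -scaler_nat scalerA => KST.
have := K_scale (2 * (-1) ^+ b)^-1 KST; rewrite scalerA mulVf ?scale1r //.
by rewrite mulf_neq0 ?signr_eq0 ?pnatr_eq0.
Qed.

Lemma K_gen_mon (i : 'I_n) : K (mon v [set j : 'I_n | spin_support i.+1 j.+1]).
Proof.
have := K_scale 2 (K_gen i); rewrite spin_generator_mon scalerA divff ?scale1r //.
by rewrite pnatr_eq0.
Qed.

Lemma K_pair_near (i j : 'I_n) : j = i.+1 :> nat -> K (mon v [set i; j]).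
Proof.
(* The pair of ordinals 0 and 1 comes from the node of ordinal 0; any other consecutive pair comes
   from the node of its larger element. The node of ordinal 1 gives the triple. *)
move=> ij; have [i0|i0] := eqVneq (i : nat) 0%N.
  suff -> : [set i; j] = [set k : 'I_n | spin_support i.+1 k.+1] by exact: K_gen_mon.
  apply/setP => k; rewrite !inE /spin_support -!val_eqE /= i0 /=; lia.
suff -> : [set i; j] = [set k : 'I_n | spin_support j.+1 k.+1] by exact: K_gen_mon.
apply/setP => k; rewrite !inE /spin_support -!val_eqE /= ij /= !eqSS.
by rewrite (negbTE i0).
Qed.

Lemma K_pair_lt d (i j : 'I_n) : (j = i + d.+1 :> nat)%N -> K (mon v [set i; j]).
Proof.
elim: d j => [|d IH] j ij; first by apply: K_pair_near; rewrite ij addn1.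
have kn : (i + d.+1 < n)%N by have := ltn_ord j; lia.
pose k := Ordinal kn.
have ik : i != k by rewrite -val_eqE /=; lia.
have kj : k != j by rewrite -val_eqE /=; lia.
have ij' : i != j by rewrite -val_eqE /=; lia.
have -> : [set i; j] = symdiff [set i; k] [set k; j].
  apply/setP => l; rewrite !inE.
  case: (eqVneq l i) => [->|_]; first by rewrite (negbTE ik) (negbTE ij').
  by case: (eqVneq l k) => [->|_]; rewrite ?(negbTE kj).
apply: K_bracket; last 2 first.
- exact: IH.
- by apply: K_pair_near; rewrite /=; lia.
rewrite !cards2 ik kj.
have -> : [set i; k] :&: [set k; j] = [set k].
  apply/setP => l; rewrite !inE; case: (eqVneq l k) => [->|lk].
    by rewrite (negbTE kj) orbT.
  by rewrite orbF /=; case: eqVneq => // ->; rewrite (negbTE ij').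
by rewrite cards1.
Qed.

Lemma K_pair (i j : 'I_n) : i != j -> K (mon v [set i; j]).
Proof.
rewrite -val_eqE neq_ltn => /orP[/= ij|/= ij].
  by apply: (@K_pair_lt (j - i).-1); lia.
by rewrite finset.setUC; apply: (@K_pair_lt (i - j).-1); lia.
Qed.

(* Bracketing with v_i v_j replaces i by j in S. *)
Lemma K_exchange (S : {set 'I_n}) i j : i \in S -> j \notin S ->
  K (mon v S) -> K (mon v (j |: S :\ i)).
Proof.
move=> iS jS KS; have ij : i != j by apply: contraNneq jS => <-.
have -> : j |: S :\ i = symdiff [set i; j] S.
  apply/setP => l; rewrite !inE; case: (eqVneq l j) => [->|_].
    by rewrite orbT (negbTE jS).
  by rewrite orbF; case: eqVneq => // ->; rewrite iS.
apply: K_bracket => //; last exact: K_pair.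
rewrite cards2 ij; have -> : [set i; j] :&: S = [set i].
  apply/setP => l; rewrite !inE; case: (eqVneq l i) => [->|_]; first by rewrite iS.
  by case: eqVneq => // ->; rewrite (negbTE jS).
by rewrite cards1 ssrnat.oddD oddM.
Qed.

Lemma K_same_card (S T : {set 'I_n}) : #|S| = #|T| -> K (mon v S) -> K (mon v T).
Proof.
have [m] := ubnP #|T :\: S|; elim: m S => // m IH S Tm ST KS.
have [TS0|[j]] := set_0Vmem (T :\: S).
  suff <- : S = T by [].
  apply/esym/eqP; rewrite eqEcard ST leqnn andbT -finset.setD_eq0.
  by rewrite TS0.
rewrite inE => /andP[jS jT].
have : (0 < #|S :\: T|)%N.
  have := cardsID S T; have := cardsID T S; rewrite ST finset.setIC => <-.
  move/addnI => <-; apply/card_gt0P; exists j; by rewrite inE jS.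
case/card_gt0P => i; rewrite inE => /andP[iT iS].
apply: (IH (j |: S :\ i)); last exact: K_exchange.
  apply: leq_trans (Tm : (#|T :\: S| <= m)%N); apply: proper_card.
  apply/properP; split.
    apply/fintype.subsetP => l; rewrite !inE => /andP[lS lT]; rewrite lT andbT.
    apply: contra lS => lS; rewrite lS andbT orbC.
    by case: eqVneq => // li; rewrite -li lT in iT.
  by exists j; rewrite !inE ?jS ?jT ?eqxx.
by rewrite cardsU1 !inE (negbTE jS) andbF /= -ST (cardsD1 i S) iS.
Qed.

Lemma K_triple (S : {set 'I_n}) : #|S| = 3 -> K (mon v S).
Proof.
move=> S3.
have n1 : (1 < n)%N by lia.
have := K_gen_mon (Ordinal n1); set T := [set j : 'I_n | _] => KT.
apply: K_same_card KT; rewrite S3.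
have n0 : (0 < n)%N by lia.
have n2 : (2 < n)%N by lia.
have -> : T = [set Ordinal n0; Ordinal n1; Ordinal n2].
  apply/setP => j; rewrite !inE -!val_eqE /= /spin_support /=.
  by case: j => -[|[|[|m]]].
by rewrite -finset.setUA !cardsU1 cards1 !inE -!val_eqE.
Qed.

(** Induction on #|S|. If #|S| is 2 modulo 4 and exceeds 2, S is a triple and a disjoint set of size
    3 modulo 4. If #|S| is 3 modulo 4 and exceeds 3, S is the symmetric difference of a triple and a
    set of size #|S| - 1 sharing one index outside S. *)
Lemma K_spinset (S : {set 'I_n}) : spinset S -> K (mon v S).
Proof.
have [m] := ubnP #|S|; elim: m S => // m IH S Sm /andP[S23 ST].
have /orP[/eqP S2|/eqP S3] : (#|S| %% 4 == 2)%N || (#|S| %% 4 == 3)%N.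
- by have := ltn_pmod #|S| (isT : 0 < 4)%N; move: S23; lia.
- have [/cards2P[i [j [ij ->]]]|/eqP Sn2] := boolP (#|S| == 2); first exact: K_pair.
  have [|T TS T3] := @subset_card_ex _ S 3; first by move: S2 Sn2; lia.
  have := cardsID T S; rewrite (finset.setIidPr TS) T3 => SD.
  have TD : (S :\: T) :&: T = finset.set0.
    by apply/setP => x; rewrite !inE; case: (x \in T) => //; rewrite andbF.
  have -> : S = symdiff (S :\: T) T.
    rewrite symdiff_disjoint //; apply/setP => x; rewrite !inE.
    by have /implyP := fintype.subsetP TS x; case: (x \in T); case: (x \in S).
  apply: K_bracket; last 2 first.
  + apply: IH; first by move: Sm SD; lia.
    apply/andP; split; first by move: S2 SD; lia.
    apply/negP => /andP[/eqP DT _].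
    have := subset_leq_card (finset.subsetT S); rewrite -DT; move: SD; lia.
  + exact: K_triple.
  rewrite TD cards0 T3 addn0; move: S2 SD; lia.
have [S3'|Sn3] := eqVneq #|S| 3; first exact: K_triple.
(* A set of size 3 modulo 4 with no index outside it would be the full set with n mod 4 = 3, which
   [spinset] excludes. *)
have [j jS] : exists j, j \notin S.
  apply/existsP; apply: contraNT ST; rewrite negb_exists => /forallP jS.
  have SE : S = [set: 'I_n].
    by apply/setP => j; rewrite inE; have := jS j; rewrite negbK.
  by move: S3; rewrite SE cardsT card_ord eqxx => ->.
have [|U US U2] := @subset_card_ex _ S 2; first by move: S3 Sn3; lia.
have := cardsID U S; rewrite (finset.setIidPr US) U2 => SD.
have jU : j \notin U by apply: contra jS; apply: (fintype.subsetP US).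
have jSU : j \notin S :\: U by rewrite inE (negbTE jS) andbF.
have -> : S = symdiff (j |: S :\: U) (j |: U).
  apply/setP => x; rewrite !inE; case: (eqVneq x j) => [->|_] /=.
    by rewrite (negbTE jS).
  by have /implyP := fintype.subsetP US x; case: (x \in U); case: (x \in S).
have D4 : #|j |: S :\: U| = (#|S| - 1)%N.
  by rewrite cardsU1 jSU; move: SD; lia.
apply: K_bracket; last 2 first.
- apply: IH; first by rewrite D4; move: Sm S3; lia.
  apply/andP; split; first by rewrite D4; move: S3; lia.
  apply/negP => /andP[/eqP DT]; rewrite -(card_ord n) -cardsT -DT D4.
  by move: S3; lia.
- by apply: K_triple; rewrite cardsU1 jU U2.
have -> : (j |: S :\: U) :&: (j |: U) = [set j].
  by apply/setP => x; rewrite !inE; case: (x == j) => //=; case: (x \in U); rewrite ?andbF.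
by rewrite cards1 D4 cardsU1 jU U2; move: S3; lia.
Qed.

Lemma spin_image_sub x : x \in spin_image v -> K x.
Proof.
case/memv_sumP => w wP ->; elim/big_ind: _ => // [y z Ky Kz|S SP].
  by rewrite -[y]scale1r; apply: K_linear.
by have /vlineP[k ->] := wP S SP; apply/K_scale/K_spinset.
Qed.

End SpinGeneration.

Section SpinGeneratorsIn.
Variables (R : realType) (n : nat) (C : falgType R) (v : 'I_n -> C).
Hypothesis hn : (4 <= n)%N.

(** The supports have two or three elements; 4 <= n prevents a triple from being the volume element,
    as it would be for n = 3. *)
Lemma spin_generator_image i : spin_generator v i \in spin_image v.
Proof.
rewrite spin_generator_mon; set S := finset _.
have Sm : mon v S \in <[mon v S]>%VS by apply: memv_line.
have SP : spinset S.
  have S23 : (#|S| == 2) || (#|S| == 3).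
    have n0 : (0 < n)%N by lia.
    have n1 : (1 < n)%N by lia.
    have n2 : (2 < n)%N by lia.
    have [i0|i0] := eqVneq (i : nat) 0%N.
      have -> : S = [set Ordinal n0; Ordinal n1].
        apply/setP => j; rewrite !inE -!val_eqE /= i0 /spin_support /=.
        by case: j => -[|[|m]].
      by rewrite cards2.
    have [i1|i1] := eqVneq (i : nat) 1%N.
      have -> : S = [set Ordinal n0; Ordinal n1; Ordinal n2].
        apply/setP => j; rewrite !inE -!val_eqE /= i1 /spin_support /=.
        by case: j => -[|[|[|m]]].
      by rewrite -finset.setUA !cardsU1 cards1 !inE -!val_eqE.
    have ip : (i.-1 < n)%N by have := ltn_ord i; lia.
    have -> : S = [set Ordinal ip; i].
      apply/setP => j; rewrite !inE -!val_eqE /= /spin_support !eqSS.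
      by rewrite (negbTE i0) (negbTE i1) /=; move: i0; lia.
    by rewrite cards2 -val_eqE /=; move: i0; lia.
  apply/andP; split; first by case/orP: S23 => /eqP ->.
  apply/negP => /andP[/eqP ST n3]; move: S23; rewrite ST cardsT card_ord.
  by move: hn n3; lia.
apply: memvZ; apply: subvP Sm; exact: (sumv_sup S).
Qed.

End SpinGeneratorsIn.

(** * Ideals, abelian ideals and semisimplicity *)

Section LieProducts.
Variables (R : realType) (C : falgType R).
Implicit Types (U V W I : {vspace C}) (x y z : C).

HB.instance Definition _ x :=
  GRing.isLinear.Build R C C *:%R (commutator x) (commutator_linearr x).

Lemma commutatorC x y : commutator x y = - commutator y x.
Proof. by rewrite opprB. Qed.

Lemma commutatorZl a x z : commutator (a *: x) z = a *: commutator x z.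
Proof. by rewrite commutatorC linearZ -scalerN -commutatorC. Qed.

Lemma commutator_leibniz x y z :
  commutator x (commutator y z)
    = commutator (commutator x y) z + commutator y (commutator x z).
Proof. exact: (@lie_leibniz _ (lie_of C)). Qed.

Lemma lie_prod_mem U V x y : x \in U -> y \in V -> commutator x y \in lie_prod U V.
Proof.
move=> xU yV; rewrite (coord_vbasis xU) (coord_vbasis yV).
rewrite linear_sum rpred_sum // => j _; rewrite linearZ rpredZ //=.
rewrite commutatorC linear_sum rpredN rpred_sum // => i _; rewrite linearZ rpredZ //=.
rewrite commutatorC rpredN; apply/memv_span/allpairsP.
by exists ((vbasis U)`_i, (vbasis V)`_j); rewrite !mem_nth ?size_tuple.
Qed.

Lemma lie_prod_sub U V W :
  (forall x y, x \in U -> y \in V -> commutator x y \in W) -> (lie_prod U V <= W)%VS.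
Proof.
move=> UVW; apply/span_subvP => _ /allpairsP[[x y] /= [xU yV ->]].
by apply: UVW; apply: vbasis_mem.
Qed.

Lemma lie_idealP I V : is_lie_ideal I V <->
  (I <= V)%VS /\ forall x y, x \in V -> y \in I -> commutator x y \in I.
Proof.
split=> -[IV VI]; split=> //; last exact: lie_prod_sub.
by move=> x y xV yI; apply: (subvP VI); apply: lie_prod_mem.
Qed.

Lemma lie_prod_ideal I V : is_lie_subalgebra V -> is_lie_ideal I V ->
  is_lie_ideal (lie_prod I I) V.
Proof.
move=> Vsub /lie_idealP[IV VI]; apply/lie_idealP; split.
  by apply: lie_prod_sub => x y /(subvP IV) xV /(subvP IV) yV; apply: Vsub.
move=> x y xV yII.
(* The preimage under [commutator x] is a subspace, so it suffices to check commutators, where the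
   Leibniz rule applies. *)
suff: (lie_prod I I <= linfun (commutator x) @^-1: lie_prod I I)%VS.
  by move/subvP/(_ y yII); rewrite -memv_preim lfunE.
apply: lie_prod_sub => a b aI bI; rewrite -memv_preim lfunE /= commutator_leibniz.
by rewrite rpredD // lie_prod_mem // VI.
Qed.

(** The derived algebras of an ideal are again ideals, so the last nonzero one of a solvable ideal
    would be an abelian ideal. *)
Lemma lie_semisimple_criterion V : is_lie_subalgebra V ->
  (forall I, is_lie_ideal I V -> lie_prod I I = 0%VS -> I = 0%VS) ->
  is_lie_semisimple V.
Proof.
move=> Vsub ab0; split=> // I idI [k]; elim: k I idI => // k IH I idI.
rewrite iterSr => /IH III; apply: ab0 => //.
by apply: III; apply: lie_prod_ideal.
Qed.

Lemma semisimple_center V x : is_lie_semisimple V -> x \in V ->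
  (forall y, y \in V -> commutator y x = 0) -> x = 0.
Proof.
move=> [_ Vss] xV xC.
suff x0 : <[x]>%VS = 0%VS by apply/eqP; rewrite -memv0 -x0 memv_line.
apply: Vss.
  apply/lie_idealP; split; first by rewrite -memvE.
  by move=> y _ yV /vlineP[k ->]; rewrite linearZ /= xC // scaler0 mem0v.
exists 1%N; apply/eqP; rewrite /= -subv0; apply: lie_prod_sub.
move=> _ _ /vlineP[a ->] /vlineP[b ->]; rewrite linearZ /= commutatorZl.
by rewrite /commutator subrr !scaler0 mem0v.
Qed.

End LieProducts.

Section SpinSemisimple.
Variables (R : realType) (n : nat) (C : falgType R) (v : 'I_n -> C).
Hypothesis hn : (4 <= n)%N.
Hypothesis hC : is_clifford v.
Let hv : clifford_relations v := hC.1.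

Lemma spinset23 (S : {set 'I_n}) : (2 <= #|S| <= 3)%N -> spinset S.
Proof.
move=> S23; apply/andP; split.
  by case/andP: S23; case: #|S| => [|[|[|[|]]]].
by apply/negP => /andP[/eqP SE]; move: S23; rewrite SE cardsT card_ord; lia.
Qed.

Lemma mon_spin_image (S : {set 'I_n}) : spinset S -> mon v S \in spin_image v.
Proof.
by move=> SP; apply: subvP (memv_line _); apply: (sumv_sup S).
Qed.

(** Choosing a pair U that avoids i writes [v i] as plus or minus a triple monomial times a pair
    monomial, both in the image. An element commuting with the image therefore commutes with the
    generators of [C]. *)
Lemma spin_image_centralizer x :
  (forall y, y \in spin_image v -> commutator y x = 0) ->
  forall y, y * x = x * y.
Proof.
move=> xC.
have comm y : y \in spin_image v -> y * x = x * y.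
  by move/xC/eqP; rewrite subr_eq0 => /eqP.
have cgen i : v i * x = x * v i.
  have [|U US U2] := @subset_card_ex _ [set~ i] 2.
    by have := cardsC1 i; rewrite card_ord => ->; lia.
  have iU : i \notin U.
    by apply/negP => /(fintype.subsetP US); rewrite !inE eqxx.
  have [b bE] := mon_mul hv (i |: U) U.
  have SE : symdiff (i |: U) U = [set i].
    apply/setP => j; rewrite !inE; case: (eqVneq j i) => [->|_] /=.
      by rewrite (negbTE iU).
    exact: addbb.
  have -> : v i = (-1) ^+ b *: (mon v (i |: U) * mon v U).
    by rewrite bE SE mon1 scalerA -exprD addnn -signr_odd odd_double scale1r.
  rewrite -scalerAl -scalerAr -mulrA comm; last first.
    by apply/mon_spin_image/spinset23; rewrite U2.
  rewrite !mulrA comm //.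
  by apply/mon_spin_image/spinset23; rewrite cardsU1 iU U2.
elim/(clifford_ind hC) => [|a y z yx zx|y z yx zx|i]; last exact: cgen.
- by rewrite mul1r mulr1.
- by rewrite mulrDl mulrDr -scalerAl -scalerAr yx zx.
- by rewrite -mulrA zx mulrA yx mulrA.
Qed.

Lemma central_cf x (S : {set 'I_n}) : (forall y, y * x = x * y) ->
  S != finset.set0 -> ~~ (odd n && (S == [set: 'I_n])) -> cf hC S x = 0.
Proof.
move=> xC S0 ST; have [|] := boolP [forall i, ~~ odd (#|S| + (i \in S))].
  by case/commutes_all => [SE|[on SE]]; move: S0 ST; rewrite SE ?eqxx ?on.
case/forallPn => i; rewrite negbK => oS.
have xE : x = v i * x * v i by rewrite xC -mulrA cliff_sq // mulr1.
have : cf hC S x = - cf hC S x.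
  rewrite {1}xE {1}(cf_sum hC x) mulr_sumr mulr_suml.
  under eq_bigr do rewrite -scalerAr -scalerAl mon_conj // scalerA.
  by rewrite cf_uniq -signr_odd oS mulrN1.
by move/eqP; rewrite -addr_eq0 -mulr2n mulrn_eq0 => /eqP.
Qed.

(** A central element of [C] is a combination of 1 and, for odd n, of the volume element; [spinset]
    contains neither index set. *)
Lemma spin_image_center x : x \in spin_image v ->
  (forall y, y \in spin_image v -> commutator y x = 0) -> x = 0.
Proof.
move=> /(spin_imageP hC) x0 /spin_image_centralizer xC.
apply: (cf_eq0 (hC := hC)) => S; have [SP|/x0//] := boolP (spinset S).
apply: central_cf => //.
  by apply: contraTneq SP => ->; rewrite /spinset cards0.
apply: contraTN SP => /andP[on /eqP SE].
rewrite /spinset SE cardsT card_ord eqxx /=; move: on; lia.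
Qed.

Variable tau : {linear C -> C}.
Hypothesis tauM : forall x y, tau (x * y) = tau y * tau x.
Hypothesis tau1 : tau 1 = 1.
Hypothesis tau_gen : forall i, tau (v i) = v i.

(* Skew elements act by skew endomorphisms for the form tr (tau x * y). *)
Lemma tr_commutator z x y : tau z = - z ->
  tr hC (tau (commutator z x) * y) = - tr hC (tau x * commutator z y).
Proof.
move=> zN; rewrite /commutator linearB /= !tauM zN mulrBl mulrBr !mulrN !mulNr.
rewrite opprK linearD linearN linearB /= !mulrA -(mulrA z) [tr hC (z * _)]trC.
by rewrite opprB addrC.
Qed.

(** For x in an abelian ideal and y in the image, the square norm of [x, y] is minus the form
    evaluated at y and [x, [x, y]], which is 0. Hence x is central in the image, so x = 0. *)
Lemma spin_image_semisimple : is_lie_semisimple (spin_image v).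
Proof.
apply: lie_semisimple_criterion.
  by move=> x y xV yV; apply: (spin_image_lie hC tauM tau1 tau_gen).
move=> I /lie_idealP[IV VI] II0.
have IIC x y : x \in I -> y \in I -> commutator x y = 0.
  by move=> xI yI; apply/eqP; rewrite -memv0 -II0 lie_prod_mem.
apply/eqP; rewrite -subv0; apply/subvP => x xI; rewrite memv0; apply/eqP.
apply: spin_image_center; first exact: (subvP IV).
move=> y yV; apply: (tr_tau_eq0 (hC := hC) tauM tau1 tau_gen).
have xN : tau x = - x.
  by have /(spin_imageE hC tauM tau1 tau_gen)[] := subvP IV _ xI.
rewrite commutatorC linearN /= mulNr mulrN opprK tr_commutator //.
rewrite IIC ?mulr0 ?linear0 ?oppr0 //.
by rewrite commutatorC rpredN VI.
Qed.

End SpinSemisimple.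

(** * Matrix models *)

Section StarAlgebras.
Variable R : realType.

Record star_axioms (T : algType R) (star : T -> T) : Prop := {
  star_linear : linear star;
  starM : forall x y, star (x * y) = star y * star x;
  star1 : star 1 = 1
}.

Lemma starN (T : algType R) (star : T -> T) : star_axioms star -> forall x, star (- x) = - star x.
Proof.
move=> hs x.
have s0 : star 0 = 0.
  apply: (addIr (star 0)); rewrite add0r.
  by have := star_linear hs 1 0 0; rewrite !scale1r addr0 => <-.
by have := star_linear hs (-1) x 0; rewrite !scaleN1r addr0 s0 addr0.
Qed.

Definition anti (T : algType R) : rel T := fun x y => x * y == - (y * x).

Lemma antiC (T : algType R) : symmetric (@anti T).
Proof. by move=> x y; rewrite /anti eq_sym eqr_oppLR. Qed.

Lemma antiP (T : algType R) (x y : T) : reflect (x * y = - (y * x)) (anti x y).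
Proof. exact: eqP. Qed.

Definition herm (T : algType R) (star : T -> T) : pred T :=
  fun x => (x * x == 1) && (star x == x).
Definition antiherm (T : algType R) (star : T -> T) : pred T :=
  fun x => (x * x == -1) && (star x == - x).

(** Generators of a Clifford algebra of signature (p, q) adapted to [star]. The goal is q = 0; skew
    generators arise on the way and are converted into hermitian ones or dropped. *)
Definition has_clifford (T : algType R) (star : T -> T) (p q : nat) : Prop :=
  exists P Q : seq T, [/\ size P = p, size Q = q, all (herm star) P,
    all (antiherm star) Q & pairwise (@anti T) (P ++ Q)].

Section Steps.
Variables (T : algType R) (star : T -> T).
Hypothesis hs : star_axioms star.

Lemma has_clifford_weaken p q p' q' : (p' <= p)%N -> (q' <= q)%N ->
  has_clifford star p q -> has_clifford star p' q'.
Proof.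
move=> pp qq [P [Q [sP sQ hP hQ PQ]]]; exists (take p' P), (take q' Q); split.
- by rewrite size_takel // sP.
- by rewrite size_takel // sQ.
- by apply/allP => x /mem_take; apply: (allP hP).
- by apply/allP => x /mem_take; apply: (allP hQ).
by apply: subseq_pairwise PQ; apply: cat_subseq; apply: take_subseq.
Qed.

Lemma anti_mul2 (x a b : T) : anti x a -> anti x b -> x * (a * b) = a * b * x.
Proof.
move=> /antiP xa /antiP xb.
by rewrite mulrA xa mulNr -(mulrA a x b) xb mulrN opprK mulrA.
Qed.

Lemma anti_quad (x a b c d : T) : anti x a -> anti x b -> anti x c -> anti x d ->
  x * (a * b * (c * d)) = a * b * (c * d) * x.
Proof.
move=> xa xb xc xd.
by rewrite mulrA (anti_mul2 xa xb) -mulrA (anti_mul2 xc xd) !mulrA.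
Qed.

Lemma anti_quad_mem (a b c d : T) : anti a b -> anti a c -> anti a d ->
  a * (a * b * (c * d)) = - (a * b * (c * d) * a).
Proof.
move=> ab ac ad; have /antiP ba : anti b a by rewrite antiC.
rewrite -(mulrA (a * b) (c * d) a) -(anti_mul2 ac ad) (mulrA (a * b) a) -(mulrA a b a).
by rewrite ba mulrN mulNr opprK !mulrA.
Qed.

Lemma anti_pairC (a b c d : T) : anti a c -> anti a d -> anti b c -> anti b d ->
  c * d * (a * b) = a * b * (c * d).
Proof.
move=> ac ad bc bd.
have H (z : T) : anti a z -> anti b z -> z * (a * b) = a * b * z.
  by move=> az bz; apply: anti_mul2; rewrite antiC.
by rewrite -mulrA H // mulrA H // mulrA.
Qed.

Lemma quad_sqr (a b c d : T) :
  a * a = -1 -> b * b = -1 -> c * c = -1 -> d * d = -1 ->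
  anti a b -> anti a c -> anti a d -> anti b c -> anti b d -> anti c d ->
  (a * b * (c * d)) * (a * b * (c * d)) = 1.
Proof.
move=> aa bb cc dd ab ac ad bc bd cd.
have sq2 (x y : T) : x * x = -1 -> y * y = -1 -> anti x y -> x * y * (x * y) = -1.
  move=> xx yy /antiP xy.
  by rewrite {1}xy mulNr mulrA -(mulrA y) xx mulrN1 mulNr yy opprK.
rewrite -(mulrA (a * b) (c * d)) (mulrA (c * d) (a * b) (c * d)) (@anti_pairC a b c d) //.
by rewrite -(mulrA (a * b) (c * d)) (sq2 c d) // mulrN1 mulrN sq2 // opprK.
Qed.

(* Multiplying four skew generators by their product turns them into hermitian
   ones. *)
Lemma has_clifford_swap4 p q : has_clifford star p (4 + q) ->
  has_clifford star (4 + p) q.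
Proof.
case=> P [Q [sP sQ hP hQ PQ]]; case: Q sQ hQ PQ => [|a [|b [|c [|d Q]]]] //= [sQ].
move=> /and5P[/andP[/eqP aa /eqP sa] /andP[/eqP bb /eqP sb] /andP[/eqP cc /eqP sc]
  /andP[/eqP dd /eqP sd] hQ].
rewrite pairwise_cat => /and3P[PQ PP] /=.
move=> /and5P[/and4P[ab ac ad aQ] /and3P[bc bd bQ] /andP[cd cQ] dQ QQ].
pose e := a * b * (c * d).
have ba : anti b a by rewrite antiC.
have ca : anti c a by rewrite antiC.
have cb : anti c b by rewrite antiC.
have da : anti d a by rewrite antiC.
have db : anti d b by rewrite antiC.
have dc : anti d c by rewrite antiC.
have e2 : e * e = 1 by exact: quad_sqr.
have eb : e = - (b * a * (c * d)) by rewrite /e (antiP _ _ ab) mulNr.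
have ec : e = c * d * (a * b) by rewrite anti_pairC.
have ed : e = - (d * c * (a * b)) by rewrite ec (antiP _ _ cd) mulNr.
have ae : a * e = - (e * a) by exact: anti_quad_mem.
have be : b * e = - (e * b) by rewrite eb mulrN anti_quad_mem // mulNr.
have ce : c * e = - (e * c) by rewrite ec anti_quad_mem.
have de : d * e = - (e * d) by rewrite ed mulrN anti_quad_mem // mulNr.
have se : star e = e.
  rewrite /e !(starM hs) sa sb sc sd !mulrNN.
  by rewrite (antiP _ _ ba) (antiP _ _ dc) mulrNN anti_pairC.
have xxe (x : T) : x * e = - (e * x) -> x * x = -1 -> star x = - x -> herm star (x * e).
  move=> xe xx sx; apply/andP; split; apply/eqP.
    by rewrite {2}xe mulrN mulrA -(mulrA x) e2 mulr1 xx opprK.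
  by rewrite (starM hs) se sx mulrN xe.
have xye (x y : T) : x * e = - (e * x) -> y * e = - (e * y) -> anti x y ->
    anti (x * e) (y * e).
  move=> xe ye /antiP xy; apply/antiP.
  have H (u z : T) : z * e = - (e * z) -> u * e * (z * e) = - (u * z).
    move=> ze; have ez : e * z = - (z * e) by rewrite ze opprK.
    by rewrite -(mulrA u e) (mulrA e z) ez mulNr -(mulrA z e) e2 mulr1 mulrN.
  by rewrite !H // xy.
have gxe (g x : T) : g * e = e * g -> anti g x -> anti (x * e) g.
  move=> ge /antiP gx; apply/antiP.
  by rewrite -(mulrA x e g) -ge (mulrA x g e) (mulrA g x e) gx mulNr opprK.
have ge g : g \in P ++ Q -> [/\ anti (a * e) g, anti (b * e) g, anti (c * e) g & anti (d * e) g].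
  move=> gPQ; suff [ga gb gc gd] : [/\ anti g a, anti g b, anti g c & anti g d].
    by have gE := anti_quad ga gb gc gd; split; apply: gxe.
  move: gPQ; rewrite mem_cat => /orP[gP|gQ].
    have gf f : f \in [:: a, b, c, d & Q] -> anti g f by exact: (allrelP PQ).
    by split; apply: gf; rewrite !inE eqxx ?orbT.
  by split; rewrite antiC; [exact: (allP aQ)|exact: (allP bQ)|exact: (allP cQ)|exact: (allP dQ)].
exists [:: a * e, b * e, c * e, d * e & P], Q; split=> //=.
- by rewrite sP.
- by rewrite !xxe.
rewrite !xye //=; apply/and5P; split.
- by apply/allP => g /ge[].
- by apply/allP => g /ge[].
- by apply/allP => g /ge[].
- by apply/allP => g /ge[].
rewrite pairwise_cat PP QQ !andbT; apply/allrelP => x y xP yQ.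
by apply: (allrelP PQ) => //; rewrite !inE yQ !orbT.
Qed.

(** A central skew J with square -1 turns a skew generator a into the hermitian generator J a
    without affecting anticommutation. It will be the imaginary unit of complex matrices. *)
Lemma has_clifford_imaginary (J : T) p q : (forall x, J * x = x * J) ->
  J * J = -1 -> star J = - J -> has_clifford star p q.+1 -> has_clifford star p.+1 q.
Proof.
move=> JC JJ sJ [P [Q [sP sQ hP hQ PQ]]]; case: Q sQ hQ PQ => [|a Q] //= [sQ].
move=> /andP[/andP[/eqP aa /eqP sa] hQ].
rewrite pairwise_cat => /and3P[PQ PP /= /andP[aQ QQ]].
exists (J * a :: P), Q; split=> //=.
- by rewrite sP.
- rewrite hP andbT; apply/andP; split; apply/eqP.
    by rewrite mulrA -(mulrA J) -JC mulrA JJ mulN1r mulNr aa opprK.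
  by rewrite (starM hs) sa sJ mulrNN JC.
have Jg g : anti a g -> anti (J * a) g.
  by move=> /antiP ag; apply/antiP; rewrite -(mulrA J a g) ag mulrN (mulrA J g a) (JC g) mulrA.
rewrite pairwise_cat PP QQ !andbT all_cat; apply/andP; split; last first.
  by apply/allrelP => x y xP yQ; apply: (allrelP PQ) => //; rewrite inE yQ orbT.
apply/andP; split; apply/allP => g gP; apply: Jg; last exact: (allP aQ).
by rewrite antiC; apply: (allrelP PQ) => //; rewrite mem_head.
Qed.

Lemma has_clifford_family n : has_clifford star n 0 ->
  exists w : 'I_n -> T, clifford_relations w /\ forall i, star (w i) = w i.
Proof.
case=> P [Q [sP /size0nil -> hP _]]; rewrite cats0 => PP.
exists (fun i => nth 0 P i); split; [split=> [i|]|move=> i].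
- have iP : (i < size P)%N by rewrite sP.
  by have /andP[/eqP] := all_nthP 0 hP i iP.
- have lt i j : (i < j)%N -> (j < n)%N -> P`_i * P`_j = - (P`_j * P`_i).
    move=> ij jn; apply/antiP; apply: (pairwiseP 0 PP) => //.
      by rewrite inE sP (ltn_trans ij).
    by rewrite inE sP.
  move=> i j; rewrite -val_eqE neq_ltn => /orP[ij|ij]; first exact: lt.
  by apply/eqP; rewrite eq_sym eqr_oppLR; apply/eqP; apply: lt.
- have iP : (i < size P)%N by rewrite sP.
  by have /andP[_ /eqP] := all_nthP 0 hP i iP.
Qed.

End Steps.
End StarAlgebras.

Section MatrixStar.
Variables (R : realType) (D : algType R) (conj : D -> D).
Hypothesis hconj : star_axioms conj.

Lemma conjD x y : conj (x + y) = conj x + conj y.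
Proof. by have := star_linear hconj 1 x y; rewrite !scale1r. Qed.

Lemma conj0 : conj 0 = 0.
Proof. by apply: (addrI (conj 0)); rewrite -conjD !addr0. Qed.

Lemma conjZ a x : conj (a *: x) = a *: conj x.
Proof. by have := star_linear hconj a x 0; rewrite conj0 !addr0. Qed.

Lemma conj_sum (I : Type) (r : seq I) (P : pred I) (F : I -> D) :
  conj (\sum_(i <- r | P i) F i) = \sum_(i <- r | P i) conj (F i).
Proof. exact: (big_morph conj conjD conj0). Qed.

(** For noncommutative D the transpose alone does not reverse products; the reversal of factors by
    [conj] makes up for it. *)
Lemma star_matrix m : star_axioms (@conj_transpose R D conj m).
Proof.
split=> [a x y|x y|]; apply/matrixP => i j; rewrite !mxE.
- exact: (star_linear hconj).
- rewrite conj_sum; apply: eq_bigr => k _; rewrite !mxE.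
  exact: (starM hconj).
- by rewrite eq_sym; case: eqP; rewrite ?(star1 hconj) ?conj0.
Qed.

End MatrixStar.

Lemma star_prod (R : realType) (A B : algType R) sA sB :
  @star_axioms R A sA -> @star_axioms R B sB ->
  @star_axioms R (A * B)%type (fun x => (sA x.1, sB x.2)).
Proof.
move=> hA hB; split=> [a [x x'] [y y']|[x x'] [y y']|].
- by congr pair; [apply: (star_linear hA)|apply: (star_linear hB)].
- by congr pair; [apply: (starM hA)|apply: (starM hB)].
- by congr pair; [apply: (star1 hA)|apply: (star1 hB)].
Qed.

Lemma mul_index_bij (a b m : nat) : (0 < a)%N -> (0 < b)%N -> m = (a * b)%N ->
  exists f : 'I_(m.-1.+1) -> 'I_(a.-1.+1) * 'I_(b.-1.+1), bijective f.
Proof.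
move=> a0 b0 mE.
have cE : m.-1.+1 = #|{: 'I_(a.-1.+1) * 'I_(b.-1.+1)}|.
  by rewrite card_prod !card_ord !prednK // mE muln_gt0 a0.
exists (fun i => enum_val (cast_ord cE i)).
apply: (bij_comp (enum_val_bij _)).
by exists (cast_ord (esym cE)) => i; rewrite ?cast_ordK ?cast_ordKV.
Qed.

(** * Kronecker products, Pauli matrices and doubling *)

Section Kronecker.
Variables (R : realType) (D : algType R) (a b m : nat).
Variable f : 'I_(m.-1.+1) -> 'I_(a.-1.+1) * 'I_(b.-1.+1).
Hypothesis f_bij : bijective f.

(** The second factor has real entries, which act as scalars, so the product rule holds for
    noncommutative D. Of the enumeration f only bijectivity matters. *)
Definition kron (M : matrix_algebra D a) (B : matrix_algebra R^o b) :
    matrix_algebra D m :=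
  \matrix_(i, j) ((B (f i).2 (f j).2 : R) *: M (f i).1 (f j).1).

Lemma kronM M N B B' : kron M B * kron N B' = kron (M * N) (B * B').
Proof.
apply/matrixP => i j; rewrite !mxE scaler_suml.
have [g fK gK] := f_bij.
rewrite (reindex g) /=; last by exists f => x _; rewrite ?fK ?gK.
under [RHS]eq_bigr do rewrite scaler_sumr.
rewrite [RHS]exchange_big pair_bigA /=; apply: eq_bigr => -[k l] _.
by rewrite !mxE gK /= -scalerAl -scalerAr scalerA.
Qed.

Lemma kron1 : kron 1 1 = 1.
Proof.
apply/matrixP => i j; rewrite !mxE -(inj_eq (bij_inj f_bij)).
rewrite -pair_eqE /=; case: ((f i).1 == _); case: ((f i).2 == _);
  by rewrite ?scaler0 ?scale0r ?scale1r.
Qed.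

Lemma kron_linearl B : linear (kron^~ B).
Proof.
move=> c M N; apply/matrixP => i j; rewrite !mxE scalerDr !scalerA.
by congr (_ *: _ + _); rewrite mulrC.
Qed.

Lemma kron_linearr M : linear (kron M).
Proof.
move=> c B B'; apply/matrixP => i j; rewrite !mxE scalerDl scalerA.
by [].
Qed.

Lemma kronNl M B : kron (- M) B = - kron M B.
Proof. by apply/matrixP => i j; rewrite !mxE scalerN. Qed.

Lemma kronNr M B : kron M (- B) = - kron M B.
Proof. by apply/matrixP => i j; rewrite !mxE scaleNr. Qed.

Lemma kron_star (conj : D -> D) M B : star_axioms conj ->
  conj_transpose conj (kron M B) = kron (conj_transpose conj M) (trmx B).
Proof. by move=> hconj; apply/matrixP => i j; rewrite !mxE (conjZ hconj). Qed.

End Kronecker.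

Section Pauli.
Variable R : realType.

Definition sigma_x : matrix_algebra R^o 2 := \matrix_(i, j) ((i != j)%:R : R).
Definition sigma_z : matrix_algebra R^o 2 :=
  \matrix_(i, j) ((i == j)%:R * (-1) ^+ (i : nat) : R).
(** Equal to [sigma_z * sigma_x], that is, i times the Pauli matrix sigma_y, which makes it real and
    skew. *)
Definition sigma_e : matrix_algebra R^o 2 :=
  \matrix_(i, j) ((i != j)%:R * (-1) ^+ (i : nat) : R).

Ltac pauli := apply/matrixP => -[[|[|//]] i] -[[|[|//]] j];
  rewrite ?mxE /= ?big_ord_recl ?big_ord0 ?mxE /= ?expr0 ?expr1;
  rewrite ?(mul0r, mulr0, mulr1, mul1r, mulrN1, addr0, add0r, oppr0, opprK).

Lemma sigma_xx : sigma_x * sigma_x = 1. Proof. by pauli. Qed.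
Lemma sigma_zz : sigma_z * sigma_z = 1. Proof. by pauli. Qed.
Lemma sigma_ee : sigma_e * sigma_e = -1. Proof. by pauli. Qed.
Lemma sigma_zx : sigma_z * sigma_x = - (sigma_x * sigma_z). Proof. by pauli. Qed.
Lemma sigma_ex : sigma_e * sigma_x = - (sigma_x * sigma_e). Proof. by pauli. Qed.
Lemma sigma_ze : sigma_z * sigma_e = - (sigma_e * sigma_z). Proof. by pauli. Qed.
Lemma sigma_xT : trmx sigma_x = sigma_x. Proof. by pauli. Qed.
Lemma sigma_zT : trmx sigma_z = sigma_z. Proof. by pauli. Qed.
Lemma sigma_eT : trmx sigma_e = - sigma_e. Proof. by pauli. Qed.

End Pauli.

Section Doubling.
Variables (R : realType) (D : algType R) (conj : D -> D).
Hypothesis hconj : star_axioms conj.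
Local Notation star m := (@conj_transpose R D conj m).

(** The old generators are tensored with [sigma_x]; 1 tensored with [sigma_z] and with [sigma_e]
    adds a hermitian and a skew one. This is the periodicity relating signatures (p, q) and (p + 1,
    q + 1). *)
Lemma has_clifford_double m m' p q : (0 < m)%N -> m' = (m * 2)%N ->
  has_clifford (star m) p q -> has_clifford (star m') p.+1 q.+1.
Proof.
move=> m0 mE [P [Q [sP sQ hP hQ PQ]]].
have [f f_bij] := mul_index_bij m0 (isT : 0 < 2)%N mE.
pose X (x : matrix_algebra D m) := kron f x (sigma_x R).
pose Z := kron f (1 : matrix_algebra D m) (sigma_z R).
pose E := kron f (1 : matrix_algebra D m) (sigma_e R).
have starK M B : star m' (kron f M B) = kron f (star m M) (trmx B).
  exact: kron_star.
have antiX x y : anti x y -> anti (X x) (X y).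
  move=> /antiP xy; apply/antiP.
  by rewrite /X !kronM // xy kronNl.
have ZX x : anti Z (X x).
  by apply/antiP; rewrite /Z /X !kronM // sigma_zx mul1r mulr1 kronNr.
have EX x : anti E (X x).
  by apply/antiP; rewrite /E /X !kronM // sigma_ex mul1r mulr1 kronNr.
have ZE : anti Z E.
  by apply/antiP; rewrite /Z /E !kronM // sigma_ze kronNr.
exists (Z :: map X P), (E :: map X Q); split.
- by rewrite /= size_map sP.
- by rewrite /= size_map sQ.
- apply/andP; split.
    apply/andP; split; apply/eqP; first by rewrite /Z kronM // sigma_zz mulr1 kron1.
    by rewrite starK sigma_zT (star1 (star_matrix hconj m)).
  apply/allP => _ /mapP[x xP ->]; have /andP[/eqP xx /eqP sx] := allP hP _ xP.
  apply/andP; split; apply/eqP; first by rewrite /X kronM // sigma_xx xx kron1.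
  by rewrite starK sigma_xT sx.
- apply/andP; split.
    apply/andP; split; apply/eqP.
      by rewrite /E kronM // sigma_ee mulr1 kronNr kron1.
    by rewrite starK sigma_eT (star1 (star_matrix hconj m)) kronNr.
  apply/allP => _ /mapP[x xP ->]; have /andP[/eqP xx /eqP sx] := allP hQ _ xP.
  apply/andP; split; apply/eqP; first by rewrite /X kronM // sigma_xx xx kronNl kron1.
  by rewrite starK sigma_xT sx kronNl.
have pw : pairwise (@anti R _) (map X (P ++ Q)).
  by rewrite pairwise_map; apply: sub_pairwise PQ => x y; apply: antiX.
move: pw; rewrite map_cat !pairwise_cat /= => /and3P[PQX PX QX].
rewrite PX QX !andbT; apply/and3P; split.
- apply/allrelP => x y; rewrite !inE => /orP[/eqP->|xP] /orP[/eqP->|yQ] //.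
  + by move/mapP: yQ => [z _ ->].
  + by move/mapP: xP => [z _ ->]; rewrite antiC.
  + exact: (allrelP PQX).
- by apply/allP => _ /mapP[x _ ->].
- by apply/allP => _ /mapP[x _ ->].
Qed.

(* Four doublings, then turning the four new skew generators into hermitian
   ones. *)
Lemma has_clifford_period m m' p : (0 < m)%N -> m' = (m * 16)%N ->
  has_clifford (star m) p 0 -> has_clifford (star m') (8 + p) 0.
Proof.
move=> m0 mE H; apply: (has_clifford_swap4 (star_matrix hconj _) (p := 4 + p) (q := 0)).
apply: (@has_clifford_double (m * 8)); rewrite ?muln_gt0 ?m0 ?mE -?mulnA //.
apply: (@has_clifford_double (m * 4)); rewrite ?muln_gt0 ?m0 -?mulnA //.
apply: (@has_clifford_double (m * 2)); rewrite ?muln_gt0 ?m0 -?mulnA //.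
exact: (@has_clifford_double m).
Qed.

Lemma has_clifford_periods m p k : (0 < m)%N ->
  has_clifford (star m) p 0 -> has_clifford (star (m * 2 ^ (4 * k))) (8 * k + p) 0.
Proof.
move=> m0 H; elim: k => [|k IH]; first by rewrite muln0 muln1.
rewrite (_ : 8 * k.+1 + p = 8 + (8 * k + p))%N; last by lia.
apply: has_clifford_period IH; first by rewrite muln_gt0 m0 expn_gt0.
by rewrite mulnS expnD -mulnA; congr muln; rewrite mulnC.
Qed.

Lemma has_clifford_one m : has_clifford (star m) 1 0.
Proof.
exists [:: 1], [::]; split=> //=.
by rewrite /herm mulr1 (star1 (star_matrix hconj m)) eqxx.
Qed.

End Doubling.

(** * Tensor product decompositions *)

Section TensorProducts.
Variable R : realType.

(* B has a finite basis E, with coordinates b, and T is a free A-module on the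
   images of E, with coordinates c. *)
Definition tensor_basis (A B T : algType R) : Prop :=
  exists (i : {lrmorphism A -> T}) (j : {lrmorphism B -> T}) (X : finType)
    (E : X -> B) (b : X -> B -> R) (c : X -> T -> A),
  [/\ forall x y, i x * j y = j y * i x,
      forall y, y = \sum_k b k y *: E k,
      forall k, linear (c k),
      forall t, t = \sum_k i (c k t) * j (E k)
    & forall k x y, c k (i x * j y) = b k y *: x].

Lemma tensor_basisP (A B T : algType R) : tensor_basis A B T -> is_tensor_product A B T.
Proof.
move=> [i [j [X [E [b [c [ij bE clin tE cE]]]]]]]; exists i, j; split=> //.
move=> W beta beta_r beta_l.
pose h0 (t : T) : W := \sum_k beta (c k t) (E k).
have h0lin : linear h0.
  move=> a s t; rewrite /h0 scaler_sumr -big_split /=; apply: eq_bigr => k _.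
  by rewrite clin beta_l.
pose h : {linear T -> W} := HB.pack h0 (GRing.isLinear.Build R T W *:%R h0 h0lin).
exists h; split=> [x y|h' h'E t].
  pose B1 : {linear B -> W} := HB.pack (beta x)
    (GRing.isLinear.Build R B W *:%R (beta x) (beta_r x)).
  rewrite /= /h0 {2}(bE y) -[beta x _]/(B1 _) linear_sum /=.
  apply: eq_bigr => k _; rewrite cE.
  pose B2 : {linear A -> W} := HB.pack (beta^~ (E k))
    (GRing.isLinear.Build R A W *:%R (beta^~ (E k)) (beta_l (E k))).
  rewrite -[beta (_ *: _) _]/(B2 _) linearZ /=.
  by rewrite -[beta x (_ *: _)]/(B1 _) linearZ.
rewrite {1}(tE t) linear_sum; apply: eq_bigr => k _; exact: h'E.
Qed.

Lemma tensor_basis_square (A B T : algType R) :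
  tensor_basis A B T -> tensor_basis (A * A)%type B (T * T)%type.
Proof.
move=> [i [j [X [E [b [c [ij bE clin tE cE]]]]]]].
pose i0 (x : (A * A)%type) : (T * T)%type := (i x.1, i x.2).
pose j0 (y : B) : (T * T)%type := (j y, j y).
have i0lin : linear i0 by move=> a x y; congr pair; rewrite linearP.
have i0mul : monoid_morphism i0.
  by split=> [|x y]; congr pair; rewrite ?rmorph1 ?rmorphM.
have j0lin : linear j0 by move=> a x y; congr pair; rewrite linearP.
have j0mul : monoid_morphism j0.
  by split=> [|x y]; congr pair; rewrite ?rmorph1 ?rmorphM.
pose i' : {lrmorphism (A * A)%type -> (T * T)%type} := HB.pack i0
  (GRing.isLinear.Build R _ _ *:%R i0 i0lin)
  (GRing.isMonoidMorphism.Build _ _ i0 i0mul).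
pose j' : {lrmorphism B -> (T * T)%type} := HB.pack j0
  (GRing.isLinear.Build R _ _ *:%R j0 j0lin)
  (GRing.isMonoidMorphism.Build _ _ j0 j0mul).
exists i', j', X, E, b, (fun k t => (c k t.1, c k t.2)); split=> //.
- by move=> x y; congr pair; rewrite /= ij.
- by move=> k a x y; congr pair; rewrite clin.
- move=> t; rewrite [LHS]surjective_pairing [in LHS](tE t.1) [in LHS](tE t.2).
  rewrite [RHS]surjective_pairing; congr pair.
    by rewrite (raddf_sum fst).
  by rewrite (raddf_sum snd).
- by move=> k x y; congr pair; rewrite /= cE.
Qed.

Lemma matrix_delta_sum (m : nat) (y : matrix_algebra R^o m) :
  y = \sum_(k : 'I_(m.-1.+1) * 'I_(m.-1.+1))
     (y k.1 k.2 : R) *: (delta_mx k.1 k.2 : matrix_algebra R^o m).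
Proof.
apply/matrixP => i j; rewrite summxE (bigD1 (i, j)) //= big1 ?addr0.
  by rewrite !mxE !eqxx -[_ *: _]/(_ * _) mulr1.
move=> [k l] /= ; rewrite xpair_eqE negb_and => kl; rewrite !mxE.
rewrite [i == k]eq_sym [j == l]eq_sym.
by case/orP: kl => /negbTE ->; rewrite ?andbF scaler0.
Qed.

Lemma tensor_basis_kron (D : algType R) a b m : (0 < a)%N -> (0 < b)%N ->
  m = (a * b)%N ->
  tensor_basis (matrix_algebra D a) (matrix_algebra R^o b) (matrix_algebra D m).
Proof.
move=> a0 b0 mE; have [f f_bij] := mul_index_bij a0 b0 mE.
have [g fK gK] := f_bij.
pose i0 (x : matrix_algebra D a) := kron f x (1 : matrix_algebra R^o b).
pose j0 (y : matrix_algebra R^o b) := kron f (1 : matrix_algebra D a) y.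
have i0mul : monoid_morphism i0.
  by split=> [|x y]; rewrite /i0 ?kronM ?kron1 // mulr1.
have j0mul : monoid_morphism j0.
  by split=> [|x y]; rewrite /j0 ?kronM ?kron1 // mulr1.
pose i : {lrmorphism matrix_algebra D a -> matrix_algebra D m} := HB.pack i0
  (GRing.isLinear.Build R _ _ *:%R i0 (kron_linearl f 1))
  (GRing.isMonoidMorphism.Build _ _ i0 i0mul).
pose j : {lrmorphism matrix_algebra R^o b -> matrix_algebra D m} := HB.pack j0
  (GRing.isLinear.Build R _ _ *:%R j0 (kron_linearr f 1))
  (GRing.isMonoidMorphism.Build _ _ j0 j0mul).
(* The block of t in position k, when t is viewed as a b by b matrix of blocks of size a. *)
pose c (k : 'I_(b.-1.+1) * 'I_(b.-1.+1)) (t : matrix_algebra D m) :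
  matrix_algebra D a := \matrix_(p, q) t (g (p, k.1)) (g (q, k.2)).
have ijE x y : i x * j y = kron f x y by rewrite /= /i0 /j0 kronM // mulr1 mul1r.
exists i, j, _, (fun k => delta_mx k.1 k.2 : matrix_algebra R^o b),
  (fun k (y : matrix_algebra R^o b) => y k.1 k.2), c; split.
- by move=> x y; rewrite ijE /= /i0 /j0 kronM // mulr1 mul1r.
- exact: matrix_delta_sum.
- by move=> k r x y; apply/matrixP => p q; rewrite !mxE.
- move=> t; apply/matrixP => p q; under eq_bigr do rewrite ijE.
  rewrite summxE (bigD1 ((f p).2, (f q).2)) //= big1 ?addr0.
    by rewrite !mxE !eqxx scale1r -!surjective_pairing !fK.
  move=> [k l] /=; rewrite xpair_eqE negb_and => kl; rewrite !mxE /=.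
  rewrite [_ == k]eq_sym [_ == l]eq_sym.
  by case/orP: kl => /negbTE ->; rewrite ?andbF scale0r.
- by move=> k x y; rewrite ijE; apply/matrixP => p q; rewrite !mxE !gK.
Qed.

Lemma tensor_basis_scalar m : tensor_basis R^o (matrix_algebra R^o m) (matrix_algebra R^o m).
Proof.
pose T := matrix_algebra R^o m.
pose i0 (x : R^o) : T := (x : R) *: 1.
have i0lin : linear i0 by move=> a x y; rewrite /i0 scalerDl scalerA.
have i0mul : monoid_morphism i0.
  split=> [|x y]; rewrite /i0 ?scale1r //.
  by rewrite -scalerAl mul1r scalerA.
pose i : {lrmorphism R^o -> T} := HB.pack i0
  (GRing.isLinear.Build R _ _ *:%R i0 i0lin)
  (GRing.isMonoidMorphism.Build _ _ i0 i0mul).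
have id_lin : linear (fun y : T => y) by [].
have id_mul : monoid_morphism (fun y : T => y) by [].
pose j : {lrmorphism T -> T} := HB.pack (fun y : T => y)
  (GRing.isLinear.Build R T T *:%R (fun y => y) id_lin)
  (GRing.isMonoidMorphism.Build T T (fun y => y) id_mul).
have ijE x y : i x * j y = (x : R) *: y by rewrite /= /i0 -scalerAl mul1r.
exists i, j, _, (fun k => delta_mx k.1 k.2 : T), (fun k (y : T) => y k.1 k.2),
  (fun k (y : T) => y k.1 k.2); split.
- by move=> x y; rewrite ijE /= /i0 -scalerAr mulr1.
- exact: matrix_delta_sum.
- by move=> k r x y; rewrite !mxE.
- by move=> t; under eq_bigr do rewrite ijE; apply: matrix_delta_sum.
- by move=> k x y; rewrite ijE !mxE -[_ *: _]/(_ * _) mulrC.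
Qed.

End TensorProducts.

(** * Dimension counts *)

Section Coordinates.
Variable R : realType.

(** N linear forms that separate points, so the dimension is at most N; this bound suffices to make
    an independent family of N vectors span. *)
Definition has_coordinates (T : lmodType R) (N : nat) : Prop :=
  exists (X : finType) (psi : X -> T -> R),
  [/\ #|X| = N, forall x a s t, psi x (a *: s + t) = a * psi x s + psi x t
    & forall t, (forall x, psi x t = 0) -> t = 0].

Lemma coordinates_real : has_coordinates R^o 1.
Proof.
exists unit, (fun _ t => t); split; first exact: card_unit.
- by [].
- by move=> t /(_ tt).
Qed.

Lemma coordinates_complex : has_coordinates (Rcomplex R) 2.
Proof.
exists bool, (fun x (t : Rcomplex R) => if x then complex.Re t else complex.Im t).
split; first exact: card_bool.
- by move=> [] a [s1 s2] [t1 t2].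
- by move=> [t1 t2] t0; have /= -> := t0 true; have /= -> := t0 false.
Qed.

Lemma coordinates_quaternion : has_coordinates (quaternion R) 4.
Proof.
exists (bool * bool)%type, (fun x (t : quaternion R) => if x.1
  then (if x.2 then q1 t else qi t) else (if x.2 then qj t else qk t)).
split; first by rewrite card_prod card_bool.
- by move=> [[] []] a s t.
- move=> t t0; apply: quaternionP.
  + exact: (t0 (true, true)).
  + exact: (t0 (true, false)).
  + exact: (t0 (false, true)).
  + exact: (t0 (false, false)).
Qed.

Lemma coordinates_matrix (D : algType R) m d : (0 < m)%N ->
  has_coordinates D d -> has_coordinates (matrix_algebra D m) (m * m * d).
Proof.
move=> m0 [X [psi [<- psilin psi0]]].
exists ('I_(m.-1.+1) * 'I_(m.-1.+1) * X)%type, (fun k (t : matrix_algebra D m) => psi k.2 (t k.1.1 k.1.2)).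
split; first by rewrite !card_prod card_ord prednK.
- by move=> k a s t; rewrite !mxE psilin.
- move=> t t0; apply/matrixP => i j; rewrite !mxE; apply: psi0 => x.
  exact: (t0 ((i, j), x)).
Qed.

Lemma coordinates_square (T : algType R) d : has_coordinates T d ->
  has_coordinates (T * T)%type (d + d).
Proof.
move=> [X [psi [<- psilin psi0]]].
exists (X + X)%type, (fun k t => match k with inl x => psi x t.1 | inr x => psi x t.2 end).
split; first exact: card_sum.
- by move=> [x|x] a s t; rewrite psilin.
- move=> [s t] t0; congr pair; apply: psi0 => x.
    exact: (t0 (inl x)).
  exact: (t0 (inr x)).
Qed.

(** The values of the separating forms on the family e make up a square matrix with independent
    rows, hence of full rank, so the values at t are a combination of its rows. *)
Lemma coordinates_surjective (I : finType) (T : lmodType R) (e : I -> T) :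
  has_coordinates T #|I| ->
  (forall c : I -> R, \sum_k c k *: e k = 0 -> forall k, c k = 0) ->
  forall t, exists c : I -> R, t = \sum_k c k *: e k.
Proof.
move=> [X [psi [cX psilin psi0]]] eI t.
have psi_0 x : psi x 0 = 0.
  by apply: (addrI (psi x 0)); have := psilin x 1 0 0; rewrite scale1r mul1r !addr0.
have psi_sum x (c : I -> R) : psi x (\sum_k c k *: e k) = \sum_k c k * psi x (e k).
  elim/big_rec2: _ => // k u y _ <-; exact: psilin.
pose M : 'M[R]_(#|I|, #|X|) := \matrix_(k, x) psi (enum_val x) (e (enum_val k)).
have row_psi (c : I -> R) x :
    ((\row_k c (enum_val k)) *m M) 0 (enum_rank x) = psi x (\sum_k c k *: e k).
  rewrite psi_sum mxE (reindex_onto (@enum_rank I) (@enum_val I predT)) /=; last first.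
    by move=> k _; rewrite enum_valK.
  under eq_bigl do rewrite enum_rankK eqxx.
  by apply: eq_bigr => k _; rewrite !mxE !enum_rankK.
have free : row_free M.
  apply: inj_row_free => u uM; apply/rowP => k; rewrite mxE.
  rewrite -(enum_valK k); apply: (eI (fun k => u 0 (enum_rank k))).
  apply: psi0 => x; rewrite -(row_psi (fun k => u 0 (enum_rank k))).
  rewrite (_ : \row_k _ = u) ?uM ?mxE //.
  by apply/rowP => l; rewrite mxE enum_valK.
have full : row_full M by rewrite /row_full (eqP free) cX.
have /submxP[u uE] := submx_full (\row_x psi (enum_val x) t) full.
exists (fun k => u 0 (enum_rank k)); apply/eqP; rewrite -subr_eq0; apply/eqP.
apply: psi0 => x; rewrite addrC -scaleN1r psilin mulN1r; apply/eqP.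
rewrite addrC subr_eq0 -(row_psi (fun k => u 0 (enum_rank k))).
rewrite (_ : (\row_k _) = u); last by apply/rowP => l; rewrite mxE enum_valK.
by rewrite -uE mxE enum_rankK.
Qed.

End Coordinates.

(** * Compactness and maximality *)

Local Open Scope classical_set_scope.
Local Open Scope ring_scope.

Section CoordinateContinuity.
Variables (R : realType) (C : falgType R).
Implicit Types (f g : C -> R) (x y : C).

(** Continuity for the topology that [coords] transports from row vectors to [C]. *)
Definition vcont f : Prop := continuous (f \o passmx.vecof (vbasis {:C})).

HB.instance Definition _ := GRing.isLinear.Build R C 'rV[R]_(\dim {:C}) *:%R
  (@coords R C) (passmx.rVof_linear (vbasis {:C})).

Lemma coordsK : cancel (@coords R C) (passmx.vecof (vbasis {:C})).
Proof. exact/passmx.rVofK/vbasisP. Qed.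

Lemma vecofK : cancel (passmx.vecof (vbasis {:C})) (@coords R C).
Proof. exact/passmx.vecofK/vbasisP. Qed.

Lemma vcont_cvg f (u : nat -> C) x : vcont f ->
  (fun N => coords (u N)) @ \oo --> coords x -> (f (u N) @[N --> \oo] --> f x).
Proof.
move=> fc ux; rewrite -[f x]/(f x) -(coordsK x).
have -> : (fun N => f (u N)) = (f \o passmx.vecof (vbasis {:C})) \o (fun N => coords (u N)).
  by apply/funext => N /=; rewrite coordsK.
apply: (cvg_comp _ _ ux); exact: fc.
Qed.

Lemma vcont_cst c : vcont (fun=> c).
Proof. exact: cst_continuous. Qed.

Lemma vcontD f g : vcont f -> vcont g -> vcont (fun x => f x + g x).
Proof. by move=> fc gc r; exact: (cvgD (fc r) (gc r)). Qed.

Lemma vcontM f g : vcont f -> vcont g -> vcont (fun x => f x * g x).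
Proof. by move=> fc gc r; exact: (cvgM (fc r) (gc r)). Qed.

Lemma vcont_sum (I : Type) (r : seq I) (P : pred I) (f : I -> C -> R) :
  (forall i, vcont (f i)) -> vcont (fun x => \sum_(i <- r | P i) f i x).
Proof.
move=> fc; elim: r => [|i r IH].
  have -> : (fun x => \sum_(i <- [::] | P i) f i x) = fun=> 0.
    by apply/funext => x; rewrite big_nil.
  exact: vcont_cst.
have [Pi|nPi] := boolP (P i).
  have -> : (fun x => \sum_(j <- i :: r | P j) f j x) =
      (fun x => f i x + \sum_(j <- r | P j) f j x).
    by apply/funext => x; rewrite big_cons Pi.
  exact: vcontD.
have -> : (fun x => \sum_(j <- i :: r | P j) f j x) =
      (fun x => \sum_(j <- r | P j) f j x) => //.
by apply/funext => x; rewrite big_cons (negbTE nPi).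
Qed.

Lemma vcont_linear (f : C -> R) :
  (forall a x y, f (a *: x + y) = a * f x + f y) -> vcont f.
Proof.
move=> flin; pose F : {linear C -> R^o} :=
  HB.pack f (GRing.isLinear.Build R C R^o *:%R f flin).
have -> : f = fun x => \sum_i coords x 0 i * f (vbasis {:C})`_i.
  apply/funext => x; rewrite -{1}(coordsK x) -[LHS]/(F _) linear_sum /=.
  by apply: eq_bigr => i _; rewrite -[f _]/(F _) linearZ.
apply: vcont_sum => i; apply: vcontM; last exact: vcont_cst.
rewrite /vcont; have -> : (fun x => coords x 0 i) \o passmx.vecof (vbasis {:C}) =
    (fun r : 'rV[R]_(\dim {:C}) => r 0 i).
  by apply/funext => r /=; rewrite vecofK.
exact: coord_continuous.
Qed.

Lemma closed_vcont_eq f c : vcont f ->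
  closed [set r | f (passmx.vecof (vbasis {:C}) r) = c].
Proof.
move=> fc; rewrite -[X in closed X]/((f \o passmx.vecof (vbasis {:C})) @^-1` [set y | y = c]).
by apply: preimage_closed; [move=> r _; exact: fc|exact: closed_eq].
Qed.

Lemma coords_image (G : set C) :
  @coords R C @` G = [set r | G (passmx.vecof (vbasis {:C}) r)].
Proof.
apply/seteqP; split=> [_ [x Gx <-]|r Gr] /=; first by rewrite coordsK.
by exists (passmx.vecof (vbasis {:C}) r) => //; rewrite vecofK.
Qed.

Lemma compact_vcont_bounded (G : set C) f : compact (@coords R C @` G) -> vcont f ->
  exists B, forall x, G x -> `|f x| <= B.
Proof.
move=> cG fc.
have : compact ((f \o passmx.vecof (vbasis {:C})) @` (@coords R C @` G)).
  by apply: continuous_compact => //; apply: continuous_subspaceT.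
move=> /compact_bounded[M [_ MP]]; exists (M + 1) => x Gx.
apply: (MP (M + 1)); first by rewrite ltrDl.
by exists (coords x); [exists x|rewrite /= coordsK].
Qed.

Lemma rV_cvg m (u : nat -> 'rV[R]_m) (l : 'rV[R]_m) :
  (forall j, (fun N => u N 0 j) @ \oo --> l 0 j) -> u @ \oo --> l.
Proof.
move=> ul A [P Pl PA].
have : \forall N \near \oo, forall j, P 0 j (u N 0 j).
  by apply: filter_forall => j; apply: ul; apply: Pl.
by apply: filterS => N PN; apply: PA => i j; rewrite (ord1 i).
Qed.

End CoordinateContinuity.

(** * Partial sums of the exponential series *)

Section ExpSeries.
Variables (R : realType).

Definition exps (A : algType R) (x : A) (N : nat) : A :=
  \sum_(k < N) (k`!%:R)^-1 *: x ^+ k.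

(** The remainder, made of the terms of total degree at least N, is kept explicit: its norm is
    bounded termwise by the same remainder for real numbers. *)
Lemma exps_mul (A : algType R) (x y : A) N : GRing.comm x y ->
  exps x N * exps y N = exps (x + y) N +
    \sum_(j < N) \sum_(k < N | (N <= j + k)%N)
      ((j`!%:R)^-1 * (k`!%:R)^-1) *: (x ^+ j * y ^+ k).
Proof.
move=> xy; rewrite /exps mulr_suml.
under eq_bigr => j _.
  rewrite mulr_sumr (bigID (fun k : 'I_N => (N <= j + k)%N)) /= addrC.
  over.
rewrite big_split /=; congr (_ + _); last first.
  apply: eq_bigr => j _; apply: eq_bigr => k _.
  by rewrite -scalerAl -scalerAr scalerA.
pose F j k := ((j`!%:R)^-1 * (k`!%:R)^-1 : R) *: (x ^+ j * y ^+ k).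
(* Reindexing by the total degree m = j + k turns the inner sums into binomial expansions. *)
transitivity (\sum_(j < N) \sum_(m < N | (j <= m)%N) F j (m - j)%N).
  apply: eq_bigr => j _.
  rewrite (eq_bigr (fun k : 'I_N => F j k)) => [|k _]; last first.
    by rewrite -scalerAl -scalerAr scalerA.
  rewrite -(big_mkord (fun k => ~~ (N <= j + k)%N) (F j)).
  rewrite -(big_mkord (fun m => (j <= m)%N) (fun m => F j (m - j)%N)).
  rewrite (big_cat_nat (n := (N - j)%N)) ?leq_subr //= [X in _ + X]big_nat_cond.
  rewrite [X in _ + X]big1 ?addr0; last by move=> k; lia.
  rewrite [RHS](big_cat_nat (n := j)) ?(ltnW (ltn_ord j)) //=.
  rewrite [X in _ = X + _]big_nat_cond [X in _ = X + _]big1 ?add0r; last by move=> k; lia.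
  rewrite -[X in \sum_(X <= i < N | _) _]add0n big_addn big_nat_cond [RHS]big_nat_cond.
  apply: eq_big => k; first by lia.
  by rewrite addnK.
rewrite (exchange_big_dep xpredT) //=; apply: eq_bigr => m _.
transitivity (\sum_(j < m.+1) F j (m - j)%N).
  by rewrite (big_ord_widen N (fun j => F j (m - j)%N)).
rewrite addrC exprDn_comm; last exact: commr_sym.
rewrite scaler_sumr; apply: eq_bigr => j _.
have xyE : GRing.comm (x ^+ j) (y ^+ (m - j)).
  by apply/commrX/commr_sym/commrX/commr_sym.
rewrite /F -xyE -[_ *+ 'C(m, j)]scaler_nat scalerA.
congr (_ *: _); have jm : (j <= m)%N by rewrite -ltnS.
rewrite -(bin_fact jm) !natrM !invfM.
have f0 k : (k`!%:R : R) != 0 by rewrite pnatr_eq0 -lt0n fact_gt0.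
have b0 : ('C(m, j)%:R : R) != 0 by rewrite pnatr_eq0 -lt0n bin_gt0.
by rewrite mulrAC mulVf // mul1r.
Qed.

Lemma exps0 (A : algType R) N : (0 < N)%N -> exps (0 : A) N = 1.
Proof.
case: N => // N _; rewrite /exps big_ord_recl /= invr1 scale1r big1 ?addr0 //.
by move=> k _; rewrite expr0n /= scaler0.
Qed.

Lemma exps_split (A : algType R) (x : A) N : (2 <= N)%N ->
  exps x N = 1 + x + \sum_(k < N - 2) (k.+2`!%:R)^-1 *: x ^+ k.+2.
Proof.
case: N => [|[|N]] // _; rewrite /exps 2!big_ord_recl /= subn2 /=.
by rewrite !invr1 !scale1r expr0 expr1 addrA.
Qed.

Lemma exps_real (c : R) N : exps (c : R^o) N = series (exp_coeff c) N.
Proof.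
rewrite /exps /series /= big_mkord; apply: eq_bigr => k _.
by rewrite /exp_coeff /= mulrC.
Qed.

Lemma exps_real_cvg (c : R) : exps (c : R^o) N @[N --> \oo] --> expR c.
Proof.
have -> : exps (c : R^o) = series (exp_coeff c) by apply/funext => N; exact: exps_real.
exact: is_cvg_series_exp_coeff.
Qed.

Lemma exps_real_le (c : R) N : 0 <= c -> exps (c : R^o) N <= expR c.
Proof.
move=> c0; rewrite exps_real.
apply: nondecreasing_cvgn_le; last exact: is_cvg_series_exp_coeff.
apply/nondecreasing_seqP => m; rewrite /series /= big_nat_recr //= lerDl.
exact: exp_coeff_ge0.
Qed.

(** By [exps_mul] this difference is the remainder for x = y = c, the majorant used for Clifford
    elements. *)
Lemma exps_real_tail (c : R) :
  (exps (c : R^o) N * exps (c : R^o) N - exps (c + c : R^o) N) @[N --> \oo] --> (0 : R).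
Proof.
rewrite -(subrr (expR (c + c))) {1}expRD.
by apply: cvgB; [apply: cvgM|]; exact: exps_real_cvg.
Qed.

End ExpSeries.

(** * A submultiplicative norm and the exponential on the Clifford algebra *)

Section CliffordNorm.
Variables (R : realType) (n : nat) (C : falgType R) (v : 'I_n -> C).
Hypothesis hC : is_clifford v.
Let hv : clifford_relations v := hC.1.
Implicit Types x y z : C.

(** The l1 norm is submultiplicative with constant 1, because a product of monomials is a monomial
    up to sign. *)
Definition nrm x : R := \sum_S `|cf hC S x|.

Lemma nrm_ge0 x : 0 <= nrm x.
Proof. by apply: sumr_ge0. Qed.

Lemma cf_le_nrm S x : `|cf hC S x| <= nrm x.
Proof. by rewrite /nrm (bigD1 S) //= lerDl; apply: sumr_ge0. Qed.

Lemma nrmD x y : nrm (x + y) <= nrm x + nrm y.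
Proof.
rewrite /nrm -big_split /=; apply: ler_sum => S _.
by rewrite linearD /=; apply: ler_normD.
Qed.

Lemma nrmZ a x : nrm (a *: x) = `|a| * nrm x.
Proof. by rewrite /nrm mulr_sumr; apply: eq_bigr => S _; rewrite linearZ normrM. Qed.

Lemma nrmN x : nrm (- x) = nrm x.
Proof. by rewrite -scaleN1r nrmZ normrN1 mul1r. Qed.

Lemma nrm_sum (I : Type) (r : seq I) (P : pred I) (F : I -> C) :
  nrm (\sum_(i <- r | P i) F i) <= \sum_(i <- r | P i) nrm (F i).
Proof.
elim/big_rec2: _ => [|i a x _ xa].
  by rewrite /nrm big1 // => S _; rewrite linear0 normr0.
by apply: le_trans (nrmD _ _) _; rewrite lerD2l.
Qed.

Lemma nrm_mon S : nrm (mon v S) = 1.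
Proof.
rewrite /nrm (bigD1 S) //= cf_mon eqxx normr1 big1 ?addr0 // => T /negbTE TS.
by rewrite cf_mon TS normr0.
Qed.

Lemma nrm1 : nrm 1 = 1.
Proof. by rewrite -(mon0 v) nrm_mon. Qed.

Lemma nrmM x y : nrm (x * y) <= nrm x * nrm y.
Proof.
rewrite {1}(cf_sum hC x) mulr_suml; apply: le_trans (nrm_sum _ _ _) _.
rewrite {2}/nrm mulr_suml; apply: ler_sum => S _; rewrite -scalerAl nrmZ.
rewrite ler_wpM2l // {1}(cf_sum hC y) mulr_sumr; apply: le_trans (nrm_sum _ _ _) _.
rewrite [leRHS]/nrm; apply: ler_sum => T _; rewrite -scalerAr nrmZ.
by have [b ->] := mon_mul hv S T; rewrite nrmZ normr_sign nrm_mon !mulr1.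
Qed.

Lemma nrmX x k : nrm (x ^+ k) <= nrm x ^+ k.
Proof.
elim: k => [|k IH]; first by rewrite nrm1.
by rewrite !exprS; apply: le_trans (nrmM _ _) _; rewrite ler_wpM2l ?nrm_ge0.
Qed.

Lemma vcont_cf S : vcont (cf hC S).
Proof. by apply: vcont_linear => a x y; rewrite linearP. Qed.

Lemma coords_cvg (u : nat -> C) y :
  (forall S, cf hC S (u N) @[N --> \oo] --> cf hC S y) ->
  (fun N => coords (u N)) @ \oo --> coords y.
Proof.
move=> ucf; apply: rV_cvg => j.
have coordE x : coords x 0 j = \sum_S cf hC S x * coords (mon v S) 0 j.
  rewrite mxE {1}(cf_sum hC x) linear_sum; apply: eq_bigr => S _.
  by rewrite linearZ mxE.
have -> : (fun N => coords (u N) 0 j) =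
    fun N => \sum_S cf hC S (u N) * coords (mon v S) 0 j.
  by apply/funext => N; exact: coordE.
rewrite coordE; apply: cvg_big => [|S _]; first exact: add_continuous.
by apply: cvgMl; apply: ucf.
Qed.

Lemma is_exp_cf x y S : is_exp x y -> cf hC S (exps x N) @[N --> \oo] --> cf hC S y.
Proof. by apply: vcont_cvg; apply: vcont_cf. Qed.

(** Each coefficient of the series is dominated by the real exponential series at [nrm x]. *)
Lemma exp_ex x : exists y, is_exp x y.
Proof.
have cvgS S : cvgn (fun N => cf hC S (exps x N)).
  have -> : (fun N => cf hC S (exps x N)) = series (fun k => k`!%:R^-1 * cf hC S (x ^+ k)).
    apply/funext => N; rewrite /exps linear_sum /series /= big_mkord.
    by apply: eq_bigr => k _; rewrite linearZ.
  apply: normed_cvg; apply: series_le_cvg (is_cvg_series_exp_coeff (nrm x)).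
  - by move=> k /=.
  - by move=> k; apply/exp_coeff_ge0/nrm_ge0.
  move=> k /=; rewrite /exp_coeff /= normrM ger0_norm ?invr_ge0 // mulrC.
  by rewrite ler_wpM2r ?invr_ge0 // (le_trans (cf_le_nrm _ _)) // nrmX.
exists (\sum_S lim (cf hC S (exps x N) @[N --> \oo]) *: mon v S).
by apply: coords_cvg => S; rewrite cf_uniq; apply: cvgS.
Qed.

Variable tau : {linear C -> C}.
Hypothesis tauM : forall x y, tau (x * y) = tau y * tau x.
Hypothesis tau1 : tau 1 = 1.
Hypothesis tau_gen : forall i, tau (v i) = v i.

Lemma nrm_tau x : nrm (tau x) = nrm x.
Proof.
apply: eq_bigr => S _.
by rewrite (cf_tau hC tauM tau1 tau_gen) normrM normrX normrN1 expr1n mul1r.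
Qed.

Lemma tauX x k : tau (x ^+ k) = tau x ^+ k.
Proof. by elim: k => [|k IH]; rewrite ?tau1 // exprS tauM IH exprSr. Qed.

Lemma tau_exps x N : tau (exps x N) = exps (tau x) N.
Proof.
by rewrite linear_sum; apply: eq_bigr => k _; rewrite linearZ /= tauX.
Qed.

Lemma vcont_mul (f g : {linear C -> C}) S : vcont (fun x => cf hC S (f x * g x)).
Proof.
have -> : (fun x => cf hC S (f x * g x)) = fun x =>
   \sum_T \sum_U (cf hC T (f x) * cf hC U (g x)) * cf hC S (mon v T * mon v U).
  apply/funext => x; rewrite {1}(cf_sum hC (f x)) mulr_suml linear_sum.
  apply: eq_bigr => T _; rewrite {1}(cf_sum hC (g x)) mulr_sumr linear_sum.
  by apply: eq_bigr => U _; rewrite -scalerAr -scalerAl scalerA linearZ /= [cf hC T _ * _]mulrC.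
apply: vcont_sum => T; apply: vcont_sum => U; apply: vcontM; last exact: vcont_cst.
by apply: vcontM; apply: vcont_linear => a x y; rewrite !linearP.
Qed.

Lemma exps_opp_cvg x S :
  cf hC S (exps (- x) N * exps x N - 1) @[N --> \oo] --> (0 : R).
Proof.
apply/norm_cvg0P; apply: (squeeze_cvgr _ (@cvg_cst _ (0 : R) _ _ _) (exps_real_tail (nrm x))).
near=> N; rewrite normr_ge0 /=; apply: le_trans (cf_le_nrm _ _) _.
have N0 : (0 < N)%N by near: N; exact: nbhs_infty_gt.
(* [exps (- x + x) N] is 1 and cancels, leaving the remainder; expanding the real majorant by
   [exps_mul] lets the two be compared term by term. *)
rewrite exps_mul; last by rewrite /GRing.comm mulrN mulNr.
rewrite addNr exps0 // addrC addKr exps_mul // addrC addKr.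
apply: le_trans (nrm_sum _ _ _) _; apply: ler_sum => j _.
apply: le_trans (nrm_sum _ _ _) _; apply: ler_sum => k _.
rewrite nrmZ ger0_norm ?mulr_ge0 ?invr_ge0 // ler_wpM2l ?mulr_ge0 ?invr_ge0 //.
apply: le_trans (nrmM _ _) _; apply: ler_pM; rewrite ?nrm_ge0 ?nrmX //.
by rewrite -(nrmN x) nrmX.
Unshelve. all: end_near.
Qed.

(** On partial sums tau exchanges the exponentials of x and - x, and their product tends to 1
    coefficientwise. *)
Lemma skew_exp_unitary x y : tau x = - x -> is_exp x y -> tau y * y = 1 /\ y * tau y = 1.
Proof.
move=> xN xy.
have idL : {linear C -> C} by exact: (idfun : {linear C -> C}).
split; apply/eqP; rewrite -subr_eq0; apply/eqP/(cf_eq0 (hC := hC)) => S.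
  have fc : vcont (fun z => cf hC S (tau z * z - 1)).
    have -> : (fun z => cf hC S (tau z * z - 1)) =
        fun z => cf hC S (tau z * (idfun : {linear C -> C}) z) + - cf hC S 1.
      by apply/funext => z; rewrite linearB.
    by apply: vcontD; [exact: vcont_mul|exact: vcont_cst].
  have := vcont_cvg fc xy; under eq_fun do rewrite -/(exps x _) tau_exps xN.
  by move=> /cvg_lim <- //; apply: cvg_lim => //; apply: exps_opp_cvg.
have fc : vcont (fun z => cf hC S (z * tau z - 1)).
  have -> : (fun z => cf hC S (z * tau z - 1)) =
      fun z => cf hC S ((idfun : {linear C -> C}) z * tau z) + - cf hC S 1.
    by apply/funext => z; rewrite linearB.
  by apply: vcontD; [exact: vcont_mul|exact: vcont_cst].
have := vcont_cvg fc xy; under eq_fun do rewrite -/(exps x _) tau_exps xN.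
move=> /cvg_lim <- //; apply: cvg_lim => //.
by have := @exps_opp_cvg (- x) S; rewrite opprK.
Qed.

(* If exp (t x) is unitary for all t, differentiating tau y * y = 1 at t = 0
   gives tau x + x = 0; the estimate below is the second-order remainder. *)
Lemma unitary_exp_bound x (c := nrm x) (M := expR c)
    (K := c * c + (1 + c) * M + M * (1 + c) + M * M) t N S :
  0 < t <= 1 -> (2 <= N)%N ->
  `|cf hC S (tau (exps (t *: x) N) * exps (t *: x) N - 1 - t *: (tau x + x))|
    <= t ^+ 2 * K.
Proof.
move=> /andP[t0 t1] N2; apply: le_trans (cf_le_nrm _ _) _.
have c0 : 0 <= c by exact: nrm_ge0.
have M0 : 0 <= M by exact: expR_ge0.
(* The part of order at least two; as t <= 1, each of its powers of t is at most t ^+ 2. *)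
set X := t *: x; pose r := \sum_(k < N - 2) (k.+2`!%:R)^-1 *: X ^+ k.+2.
have rle : nrm r <= t ^+ 2 * M.
  apply: le_trans (nrm_sum _ _ _) _.
  apply: le_trans (_ : t ^+ 2 * \sum_(k < N - 2) (k.+2`!%:R)^-1 * c ^+ k.+2 <= _).
    rewrite mulr_sumr; apply: ler_sum => k _; rewrite nrmZ ger0_norm ?invr_ge0 //.
    rewrite mulrCA ler_wpM2l ?invr_ge0 // exprZn nrmZ.
    rewrite ger0_norm ?(exprn_ge0 _ (ltW t0)) //.
    apply: ler_pM; rewrite ?nrm_ge0 ?nrmX ?(exprn_ge0 _ (ltW t0)) //.
    by rewrite -addn2 exprD ler_piMl ?sqr_ge0 // exprn_ile1 // ltW.
  rewrite ler_wpM2l ?sqr_ge0 //; apply: le_trans (exps_real_le N c0).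
  by rewrite exps_split // lerDr addr_ge0.
(* The four terms are bounded in this order by t ^+ 2 times the four summands of K. *)
have -> : tau (exps X N) * exps X N - 1 - t *: (tau x + x) =
    t ^+ 2 *: (tau x * x) + tau (1 + X) * r + tau r * (1 + X) + tau r * r.
  rewrite exps_split // -/r.
  have -> : tau (1 + X + r) = 1 + tau X + tau r by rewrite !linearD tau1.
  have -> : tau (1 + X) = 1 + tau X by rewrite linearD tau1.
  have -> : t *: (tau x + x) = tau X + X by rewrite scalerDr linearZ.
  have -> : t ^+ 2 *: (tau x * x) = tau X * X.
    by rewrite linearZ -scalerAl -scalerAr scalerA.
  have E : (1 + tau X) * (1 + X) = tau X * X + (tau X + X) + 1.
    rewrite mulrDl mul1r mulrDr mulr1.
    by rewrite [LHS](AC (2*2)%AC (4*(3*2)*1)%AC).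
  apply/eqP; rewrite !subr_eq mulrDl !(mulrDr _ (1 + X)) E; apply/eqP.
  by rewrite [LHS](AC (4*2)%AC (1*4*5*6*2*3)%AC).
have px : nrm (1 + t *: x) <= 1 + c.
  apply: le_trans (nrmD _ _) _; rewrite nrm1 lerD2l nrmZ ger0_norm ?(ltW t0) //.
  by rewrite ler_piMl.
have t2 : t ^+ 2 <= 1 by rewrite exprn_ile1 // ltW.
rewrite /K 3!(mulrDr (t ^+ 2)); apply: le_trans (nrmD _ _) _; apply: lerD.
  apply: le_trans (nrmD _ _) _; apply: lerD.
    apply: le_trans (nrmD _ _) _; apply: lerD.
      rewrite nrmZ ger0_norm ?sqr_ge0 // ler_wpM2l ?sqr_ge0 //.
      by apply: le_trans (nrmM _ _) _; rewrite nrm_tau.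
    apply: le_trans (nrmM _ _) _; rewrite nrm_tau [leRHS]mulrCA.
    by apply: ler_pM; rewrite ?nrm_ge0.
  apply: le_trans (nrmM _ _) _; rewrite nrm_tau mulrA.
  by apply: ler_pM; rewrite ?nrm_ge0.
apply: le_trans (nrmM _ _) _; rewrite nrm_tau mulrA.
apply: ler_pM; rewrite ?nrm_ge0 //; apply: le_trans rle _.
by rewrite ler_piMl.
Qed.

(** The bound does not depend on N, so it passes to the limit; dividing by t gives a bound t K on
    each coefficient of tau x + x, and t tends to 0. *)
Lemma unitary_exp_skew x :
  (forall t : R, exists2 y, is_exp (t *: x) y & tau y * y = 1) -> tau x = - x.
Proof.
move=> xU; apply/eqP; rewrite -addr_eq0; apply/eqP/(cf_eq0 (hC := hC)) => S.
have [K KP] : exists K : R, forall t N, 0 < t <= 1 -> (2 <= N)%N ->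
  `|cf hC S (tau (exps (t *: x) N) * exps (t *: x) N - 1 - t *: (tau x + x))|
    <= t ^+ 2 * K by eexists => t N; exact: unitary_exp_bound.
have tK t : 0 < t <= 1 -> `|cf hC S (tau x + x)| <= t * K.
  move=> t01; have t0 : 0 < t by case/andP: t01.
  have [y ty yU] := xU t.
  have fc : vcont (fun z => cf hC S (tau z * z - 1 - t *: (tau x + x))).
    have -> : (fun z => cf hC S (tau z * z - 1 - t *: (tau x + x))) =
       fun z => cf hC S (tau z * (idfun : {linear C -> C}) z)
                + - cf hC S (1 + t *: (tau x + x)).
      by apply/funext => z; rewrite -addrA -opprD linearB.
    by apply: vcontD; [exact: vcont_mul|exact: vcont_cst].
  have lim0 := vcont_cvg fc ty.
  have : `|cf hC S (tau y * y - 1 - t *: (tau x + x))| <= t ^+ 2 * K.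
    apply: (ler_cvg_to (cvg_norm lim0) (@cvg_cst _ (t ^+ 2 * K) _ _ _)).
    by near=> N; apply: KP => //; near: N; exact: nbhs_infty_ge.
  rewrite yU subrr sub0r linearN linearZ /= normrN normrM gtr0_norm //.
  by rewrite expr2 -mulrA ler_pM2l.
apply/eqP; rewrite -normr_eq0 eq_le normr_ge0 andbT.
apply/ler_addgt0Pr => e e0; rewrite add0r.
(* The maximum keeps the denominator of the chosen t positive. *)
pose K' := Num.max K 1; have K'1 : 1 <= K' by rewrite le_max lexx orbT.
pose t := Num.min 1 (e / K').
have t0 : 0 < t by rewrite lt_min ltr01 divr_gt0 // (lt_le_trans ltr01).
have t1 : t <= 1 by rewrite ge_min lexx.
apply: le_trans (tK t _) _; first by rewrite t0.
apply: le_trans (_ : t * K' <= _); first by apply: ler_wpM2l; [exact: ltW|rewrite le_max lexx].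
by rewrite -ler_pdivlMr ?(lt_le_trans ltr01) // ge_min lexx orbT.
Unshelve. all: end_near.
Qed.

End CliffordNorm.

(** * Compactness and maximality of the image *)

Section SpinCompact.
Variables (R : realType) (n : nat) (C : falgType R) (v : 'I_n -> C).
Hypothesis hn : (4 <= n)%N.
Hypothesis hC : is_clifford v.
Let hv : clifford_relations v := hC.1.
Variable tau : {linear C -> C}.
Hypothesis tauM : forall x y, tau (x * y) = tau y * tau x.
Hypothesis tau1 : tau 1 = 1.
Hypothesis tau_gen : forall i, tau (v i) = v i.
Implicit Types x y z : C.

Lemma tr_hermitian_even a k : tau a = a -> ~~ odd k -> 0 <= tr hC (a ^+ k).
Proof.
move=> ah /negbTE ek; rewrite -(odd_double_half k) ek add0n -addnn exprD.
rewrite -{1}ah -(tauX tauM tau1); exact: (tr_tau_ge0 hC tauM tau1 tau_gen).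
Qed.

(* In the sum of the two series the odd powers cancel, and the even ones have
   nonnegative trace. *)
Lemma tr_exp_hermitian_ge a y z : tau a = a -> is_exp a y -> is_exp (- a) z ->
  tr hC (a ^+ 2) <= tr hC y + tr hC z.
Proof.
move=> ah ay az.
have yz : (cf hC finset.set0 (exps a N) + cf hC finset.set0 (exps (- a) N))
    @[N --> \oo] --> cf hC finset.set0 y + cf hC finset.set0 z.
  by apply: cvgD; apply: is_exp_cf.
apply: (ler_cvg_to (@cvg_cst _ (tr hC (a ^+ 2)) _ _ _) yz).
near=> N; have N3 : (2 < N)%N by near: N; exact: nbhs_infty_ge.
rewrite -linearD /= /exps -big_split /= linear_sum (bigD1 (Ordinal N3)) //=.
have term k : cf hC finset.set0 (k`!%:R^-1 *: a ^+ k + k`!%:R^-1 *: (- a) ^+ k) =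
    k`!%:R^-1 * ((1 + (-1) ^+ k) * tr hC (a ^+ k)).
  have -> : (- a) ^+ k = (-1) ^+ k *: a ^+ k by rewrite -scaleN1r exprZn.
  by rewrite -scalerDr -{1}[a ^+ k]scale1r -scalerDl scalerA linearZ /= mulrA.
rewrite term /= sqrrN expr1n -[(1 + 1 : R)]/(2 : R) mulrA mulVf ?mul1r ?pnatr_eq0 //.
rewrite lerDl; apply: sumr_ge0 => k _; rewrite term.
apply: mulr_ge0; first by rewrite invr_ge0.
have [ok|ek] := boolP (odd k); first by rewrite -signr_odd ok subrr mul0r.
rewrite -signr_odd (negbTE ek) mulr_ge0 ?tr_hermitian_even //.
by rewrite addr_ge0.
Unshelve. all: end_near.
Qed.

(** The bound on the traces at t a and - t a gives t ^+ 2 * tr (a ^+ 2) <= 2 B for every t, so the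
    form vanishes at a. *)
Lemma hermitian_bounded a B : tau a = a ->
  (forall t : R, exists2 y, is_exp (t *: a) y & `|tr hC y| <= B) -> a = 0.
Proof.
move=> ah aB; apply: (tr_tau_eq0 (hC := hC) tauM tau1 tau_gen).
rewrite ah -expr2; set q := tr hC _.
have q0 : 0 <= q by exact: tr_hermitian_even.
have B0 : 0 <= B by have [y _] := aB 0; apply: le_trans.
have tq t : t ^+ 2 * q <= B + B.
  have [y ty yB] := aB t; have [z tz zB] := aB (- t).
  rewrite scaleNr in tz.
  have tah : tau (t *: a) = t *: a by rewrite linearZ /= ah.
  have := tr_exp_hermitian_ge tah ty tz; rewrite exprZn linearZ => /le_trans; apply.
  by apply: lerD; apply: le_trans (ler_norm _) _.
apply/eqP; rewrite eq_le q0 andbT leNgt; apply/negP => q_gt0.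
(* As t >= 1, t ^+ 2 * q is at least t * q = q + 2 B, which exceeds 2 B. *)
pose t := 1 + (B + B) / q.
have t1 : 1 <= t by rewrite lerDl divr_ge0 // addr_ge0.
have := tq t; rewrite leNgt => /negP; apply.
apply: lt_le_trans (_ : t * q <= _).
  by rewrite mulrDl mul1r divfK ?gt_eqF // ltrDr.
by rewrite ler_wpM2r // expr2 ler_peMl // (le_trans ler01).
Qed.

(** The hermitian part xh of x in W need not lie in W. Its brackets with the image do, because they
    agree with the brackets of x - s, where s is in the image; being hermitian they vanish, so x - s
    is central in [C]. *)
Lemma spin_image_maximal (W : {vspace C}) : is_lie_semisimple W ->
  is_lie_compact W -> (spin_image v <= W)%VS -> W = spin_image v.
Proof.
move=> Wss [G [_ _ _ _ cG] WG] imW; have [Wsub _] := Wss.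
have [B BP] := compact_vcont_bounded cG (@vcont_cf _ _ _ _ hC finset.set0).
have herm0 a : a \in W -> tau a = a -> a = 0.
  move=> /WG aW ah; apply: (hermitian_bounded (B := B) ah) => t.
  by have [y ty Gy] := aW t; exists y => //; apply: BP.
have tKK := tauK hC tauM tau1 tau_gen.
apply/eqP; rewrite eqEsubv imW andbT; apply/subvP => x xW.
pose xh := 2^-1 *: (x + tau x); pose xs := 2^-1 *: (x - tau x).
have xE : x = xs + xh.
  by rewrite -scalerDr addrACA addNr addr0 -mulr2n -[x *+ 2]scaler_nat scalerA mulVf ?scale1r ?pnatr_eq0.
have xhh : tau xh = xh by rewrite linearZ linearD /= tKK addrC.
have xss : tau xs = - xs by rewrite linearZ linearB /= tKK -scalerN opprB.
clearbody xs xh.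
(* [x - s] commutes with the image since [y, xh] is hermitian and lies in W. *)
have [s sim sE] : exists2 s, s \in spin_image v &
    forall y, commutator y (x - s) = commutator y xh.
  have [n3|n3] := eqVneq (n %% 4)%N 3; last first.
    exists xs => [|y]; last by rewrite xE addrC addKr.
    by apply/(spin_imageE hC tauM tau1 tau_gen); split=> // /eqP; rewrite (negbTE n3).
  (* When n mod 4 = 3 the skew part may have a volume component outside the image. Removing this
     central term changes no commutator. *)
  have on := odd_mod4 n3; set w := mon v [set: 'I_n].
  exists (xs - cf hC [set: 'I_n] xs *: w) => [|y].
    apply/(spin_imageE hC tauM tau1 tau_gen); split.
      rewrite linearB linearZ /= xss (tau_mon hC tauM tau1 tau_gen) // cardsT card_ord.
      by rewrite -signr_odd odd_bin2 n3 scaleN1r scalerN opprB opprK addrC.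
    by move=> _; rewrite linearB linearZ /= cf_mon eqxx -[_ *: _]/(_ * _) mulr1 subrr.
  rewrite {1}xE opprB addrCA [in X in _ + X]addrC addKr addrC linearD linearZ /=.
  by rewrite {2}/commutator (full_mon_central hC y on) subrr scaler0 addr0.
have zW : x - s \in W by rewrite rpredB // (subvP imW).
have zC y : y \in spin_image v -> commutator y (x - s) = 0.
  move=> yim; have yW := subvP imW _ yim.
  apply: herm0; first exact: Wsub.
  have /(spin_imageE hC tauM tau1 tau_gen)[yN _] := yim.
  by rewrite sE /commutator linearB /= !tauM yN xhh mulrN mulNr opprK addrC.
have zcent := spin_image_centralizer hn hC zC.
have z0 : x - s = 0.
  apply: (semisimple_center Wss zW) => y _.
  by rewrite /commutator zcent subrr.
by move/eqP: z0; rewrite subr_eq0 => /eqP ->.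
Qed.

Section UnitaryGroup.
(** An additional closed condition on unitary elements: trivial unless n mod 4 = 3, when it is
    determinant 1 in the matrix model. *)
Variable Q : C -> Prop.
Hypothesis Q1 : Q 1.
Hypothesis QM : forall x y, Q x -> Q y -> Q (x * y).
Hypothesis QV : forall x, tau x * x = 1 -> Q x -> Q (tau x).
Hypothesis Qclosed : closed [set r | Q (passmx.vecof (vbasis {:C}) r)].
Hypothesis Qexp : forall x, tau x = - x -> (x \in spin_image v <->
  forall t : R, exists2 y, is_exp (t *: x) y & Q y).

Let G : set C := fun x => [/\ tau x * x = 1, x * tau x = 1 & Q x].

(** Unitarity is a system of equations between continuous functions, one for each coefficient. *)
Lemma unitary_closed : closed (@coords R C @` G).
Proof.
rewrite coords_image.
have -> : [set r | G (passmx.vecof (vbasis {:C}) r)] =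
  (\bigcap_(S in [set: {set 'I_n}])
     [set r | cf hC S (tau (passmx.vecof (vbasis {:C}) r) *
       (idfun : {linear C -> C}) (passmx.vecof (vbasis {:C}) r)) = cf hC S 1]) `&`
  (\bigcap_(S in [set: {set 'I_n}])
     [set r | cf hC S ((idfun : {linear C -> C}) (passmx.vecof (vbasis {:C}) r) *
       tau (passmx.vecof (vbasis {:C}) r)) = cf hC S 1]) `&`
  [set r | Q (passmx.vecof (vbasis {:C}) r)].
  apply/seteqP; split=> r /=.
    by move=> [xl xr Qx]; split=> //; split=> S _ /=; rewrite ?xl ?xr.
  move=> [[xl xr] Qx]; split=> //; apply/eqP; rewrite -subr_eq0; apply/eqP;
    apply: (cf_eq0 (hC := hC)) => S; rewrite linearB /=.
    by rewrite (xl S I) subrr.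
  by rewrite (xr S I) subrr.
apply: closedI => //; apply: closedI; apply: closed_bigI => S _.
  exact: (closed_vcont_eq (@vcont_mul R n C v hC tau (idfun : {linear C -> C}) S)).
exact: (closed_vcont_eq (@vcont_mul R n C v hC (idfun : {linear C -> C}) tau S)).
Qed.

(** The squares of the coefficients of a unitary element sum to tr 1 = 1, so each coefficient has
    absolute value at most 1. *)
Lemma unitary_bounded : bounded_set (@coords R C @` G).
Proof.
exists (\sum_S `|coords (mon v S)|); split; first exact: num_real.
move=> M SM _ [x [xU _ _] <-]; apply: le_trans (ltW SM).
rewrite {1}(cf_sum hC x) linear_sum; apply: le_trans (ler_norm_sum _ _ _) _.
apply: ler_sum => S _; rewrite linearZ /= normrZ ler_piMl //.
rewrite -(@expr_le1 _ 2) // real_normK ?num_real //.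
rewrite -(tr1 hC) -xU (tr_tau hC tauM tau1 tau_gen) (bigD1 S) //= lerDl.
by apply: sumr_ge0 => T _; apply: sqr_ge0.
Qed.

Lemma spin_image_compact : is_lie_compact (spin_image v).
Proof.
have tKK := tauK hC tauM tau1 tau_gen.
exists G; last first.
  move=> x; split=> [xim t|xG].
    have /(spin_imageE hC tauM tau1 tau_gen)[xN _] := xim.
    have /(Qexp xN)/(_ t)[y ty Qy] := xim.
    have txN : tau (t *: x) = - (t *: x) by rewrite linearZ /= xN scalerN.
    have [yl yr] := skew_exp_unitary hC tauM tau1 txN ty.
    by exists y.
  have xN : tau x = - x.
    apply: (unitary_exp_skew hC tauM tau1 tau_gen) => t.
    by have [y ty [yl _ _]] := xG t; exists y.
  by apply/(Qexp xN) => t; have [y ty [_ _ Qy]] := xG t; exists y.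
split.
- by move=> x [xl xr _]; apply/unitrP; exists (tau x).
- by split; rewrite ?tau1 ?mulr1.
- move=> x y [xl xr Qx] [yl yr Qy]; split; last exact: QM.
    by rewrite tauM mulrA -(mulrA (tau y)) xl mulr1.
  by rewrite tauM mulrA -(mulrA x) yr mulr1.
- move=> x [xl xr Qx]; have xu : x \is a GRing.unit by apply/unitrP; exists (tau x).
  have -> : x^-1 = tau x by rewrite -[LHS]mul1r -xl mulrK.
  by split; rewrite ?tKK //; apply: QV.
- exact: (bounded_closed_compact unitary_bounded unitary_closed).
Qed.

End UnitaryGroup.

End SpinCompact.

(** * Identification with the classical compact algebras *)

Section CliffordIso.
Variables (R : realType) (n : nat) (C : falgType R) (v : 'I_n -> C).
Hypothesis hC : is_clifford v.

(** The last two fields make the induced morphism from [C] injective and surjective,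
    respectively. *)
Record spin_model (T : algType R) (star : T -> T) (w : 'I_n -> T) : Prop := {
  model_star : star_axioms star;
  model_clifford : clifford_relations w;
  model_herm : forall i, star (w i) = w i;
  model_nscalar : odd n -> forall r : R, mon w [set: 'I_n] <> r *: 1;
  model_dim : has_coordinates T (2 ^ n)
}.

Lemma morph_mon (T : algType R) (w : 'I_n -> T) (phi : {lrmorphism C -> T}) S :
  phi \o v =1 w -> phi (mon v S) = mon w S.
Proof.
by move=> phiv; rewrite /mon /seqmon rmorph_prod; apply: eq_bigr => i _; apply: phiv.
Qed.

(** The monomials in w are 2 ^ n independent elements of a space of dimension at most 2 ^ n, so the
    induced morphism is bijective and [star] can be pulled back to [C]. *)
Lemma model_iso (T : algType R) (star : T -> T) (w : 'I_n -> T) :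
  spin_model star w ->
  exists (phi : {lrmorphism C -> T}) (tau : {linear C -> C}),
    [/\ bijective phi, phi \o v =1 w,
        forall x y, tau (x * y) = tau y * tau x, tau 1 = 1
      & (forall i, tau (v i) = v i) /\ forall x, phi (tau x) = star (phi x)].
Proof.
move=> [hs hw ws wT wdim]; have [phi [phiv _]] := hC.2 T w hw.
have wI := mon_indep hw wT.
have phi_ker x : phi x = 0 -> x = 0.
  rewrite {1}(cf_sum hC x) linear_sum => phi0.
  apply: (cf_eq0 (hC := hC)) => S; apply: (wI (fun S => cf hC S x)).
  rewrite -[RHS]phi0; apply: eq_bigr => U _.
  by rewrite linearZ /= (morph_mon _ phiv).
have phi_inj : injective phi by apply: raddf_inj => x /phi_ker.
have phi_surj t : exists x, phi x = t.
  have cN : has_coordinates T #|{set 'I_n}|.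
    by rewrite -cardsT -powersetT card_powerset cardsT card_ord.
  have [c ->] := coordinates_surjective cN wI t.
  exists (\sum_S c S *: mon v S); rewrite linear_sum; apply: eq_bigr => S _.
  by rewrite linearZ /= (morph_mon _ phiv).
have /choice[psi psiE] := phi_surj.
have psiK x : psi (phi x) = x by apply: phi_inj; rewrite psiE.
pose tau0 x := psi (star (phi x)).
have tau0E x : phi (tau0 x) = star (phi x) by exact: psiE.
have tau0lin : linear tau0.
  move=> a x y; apply: phi_inj.
  by rewrite [RHS]linearP /= !tau0E linearP /= (star_linear hs).
pose tau : {linear C -> C} := HB.pack tau0 (GRing.isLinear.Build R C C *:%R tau0 tau0lin).
exists phi, tau; split=> //.
- by exists psi.
- by move=> x y; apply: phi_inj; rewrite rmorphM /= !tau0E rmorphM (starM hs).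
- by apply: phi_inj; rewrite /= tau0E rmorph1 (star1 hs).
split=> // i; apply: phi_inj.
by rewrite /= tau0E -[phi (v i)]/((phi \o v) i) phiv ws.
Qed.

Lemma lie_isom_restrict (T : algType R) (phi : {lrmorphism C -> T}) (V : {vspace C})
    (X : set T) : bijective phi -> (forall x, X (phi x) <-> x \in V) ->
  @lie_isom R (lie_of C) (lie_of T) [set` V] X.
Proof.
move=> phi_bij XP; have [psi phiK psiK] := phi_bij; exists phi; split.
- split=> [x /= xV|x y _ _ /(bij_inj phi_bij)//|t Xt]; first exact/XP.
  by exists (psi t); rewrite ?psiK //=; apply/XP; rewrite psiK.
- by move=> a x y _ _; rewrite linearP.
- move=> x y _ _; rewrite /lie /= /commutator.
  by rewrite rmorphB !rmorphM.
Qed.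

Lemma isomorphic_within_model (T : algType R) (A : algType R) k (X : set T)
    (phi : {lrmorphism C -> T}) : bijective phi ->
  (forall x, X (phi x) <-> x \in spin_image v) ->
  tensor_basis A (matrix_algebra R^o k) T ->
  isomorphic_within (spin_image v) A k X.
Proof.
move=> phi_bij XP AT; split; [exact: lie_isom_restrict XP|by exists phi|].
exact: tensor_basisP.
Qed.

Lemma model_spin_imageE (T : algType R) (star : T -> T) (phi : {lrmorphism C -> T})
    (tau : {linear C -> C}) : bijective phi ->
  (forall x y, tau (x * y) = tau y * tau x) -> tau 1 = 1 ->
  (forall i, tau (v i) = v i) -> (forall x, phi (tau x) = star (phi x)) ->
  (n %% 4)%N != 3 -> forall x, star (phi x) = - phi x <-> x \in spin_image v.
Proof.
move=> phi_bij tauM tau1 tau_gen phit n3 x; rewrite -phit -raddfN; split.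
  move/(bij_inj phi_bij) => xN; apply/(spin_imageE hC tauM tau1 tau_gen).
  by split=> // /eqP; rewrite (negbTE n3).
by move/(spin_imageE hC tauM tau1 tau_gen) => [->].
Qed.

End CliffordIso.

Section ModelConstruction.
Variables (R : realType) (n : nat).

(** The volume element has square -1, unlike any real scalar. *)
Lemma nscalar_mod3 (T : algType R) (w : 'I_n -> T) : clifford_relations w ->
  (n %% 4 = 3)%N -> forall r : R, mon w [set: 'I_n] <> r *: 1.
Proof.
move=> hw n3 r wr; have := mon_sqr hw [set: 'I_n]; rewrite cardsT card_ord.
rewrite -signr_odd odd_bin2 n3 scaleN1r wr -scalerAl mul1r scalerA => /eqP.
rewrite -addr_eq0 -{2}[1 : T]scale1r -scalerDl scaler_eq0 oner_eq0 orbF.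
by rewrite gt_eqF // ltr_wpDl // -expr2 sqr_ge0.
Qed.

Lemma nscalar_even (T : algType R) (w : 'I_n -> T) : ~~ odd n ->
  odd n -> forall r : R, mon w [set: 'I_n] <> r *: 1.
Proof. by move/negbTE ->. Qed.

(** In T itself the volume element may be a scalar. For odd n the generators [- w i] negate it, so
    in the product its components are opposite and nonzero. *)
Lemma pair_model (T : algType R) (star : T -> T) (w : 'I_n -> T) d :
  star_axioms star -> clifford_relations w -> (forall i, star (w i) = w i) ->
  odd n -> has_coordinates T d -> (d + d = 2 ^ n)%N ->
  spin_model (fun x : (T * T)%type => (star x.1, star x.2)) (fun i => (w i, - w i)).
Proof.
move=> hs hw ws on dT dE; split.
- exact: star_prod.
- split=> [i|i j ij].
    by congr pair; rewrite ?mulrNN (cliff_sq hw).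
  by congr pair; rewrite /= ?mulrNN hw.2 // ?mulrNN.
- by move=> i; congr pair; rewrite /= ?(starN hs) ws.
- move=> _ r.
  have monE s : seqmon (fun i => (w i, - w i) : (T * T)%type) s =
      (seqmon w s, (-1) ^+ size s *: seqmon w s).
    elim: s => [|i s IH]; first by rewrite /seqmon !big_nil scale1r.
    rewrite !seqmon_cons IH; congr pair.
    by rewrite /= mulNr -scalerAr exprS -scalerA scaleN1r.
  rewrite /mon monE -cardE cardsT card_ord -signr_odd on scaleN1r.
  case=> Ar Anr; have : mon w [set: 'I_n] = - mon w [set: 'I_n].
    exact: etrans Ar (esym Anr).
  move/eqP; rewrite -addr_eq0 -mulr2n -scaler_nat scaler_eq0 pnatr_eq0 /=.
  by rewrite (negbTE (mon_neq0 hw _)).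
- by rewrite -dE; apply: coordinates_square.
Qed.

End ModelConstruction.

(** * Complex limits and determinants of exponentials *)

Section ComplexLimits.
Variable R : realType.
Implicit Types (u w : nat -> R[i]) (z : R[i]) (x : R).

Definition ccvg u z : Prop :=
  (complex.Re (u N) @[N --> \oo] --> complex.Re z) /\
  (complex.Im (u N) @[N --> \oo] --> complex.Im z).

Lemma ReM z z' : complex.Re (z * z') =
  complex.Re z * complex.Re z' + - (complex.Im z * complex.Im z').
Proof. by case: z z' => a b [c d]. Qed.

Lemma ImM z z' : complex.Im (z * z') =
  complex.Re z * complex.Im z' + complex.Im z * complex.Re z'.
Proof. by case: z z' => a b [c d]. Qed.

Lemma ccvgM u w z z' : ccvg u z -> ccvg w z' -> ccvg (fun N => u N * w N) (z * z').
Proof.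
move=> [uR uI] [wR wI]; split.
  rewrite ReM; under eq_fun do rewrite ReM.
  by apply: cvgD; [apply: cvgM|apply: cvgN; apply: cvgM].
rewrite ImM; under eq_fun do rewrite ImM.
by apply: cvgD; apply: cvgM.
Qed.

Lemma ccvg_prod (I : Type) (r : seq I) (u : I -> nat -> R[i]) (z : I -> R[i]) :
  (forall i, ccvg (u i) (z i)) -> ccvg (fun N => \prod_(i <- r) u i N) (\prod_(i <- r) z i).
Proof.
move=> uz; elim: r => [|i r IH].
  by rewrite big_nil; split; under eq_fun do rewrite big_nil; apply: cvg_cst.
have -> : (fun N => \prod_(j <- i :: r) u j N) =
    fun N => u i N * \prod_(j <- r) u j N by apply/funext => N; rewrite big_cons.
by rewrite big_cons; apply: ccvgM.
Qed.

Lemma ccvg_uniq u z z' : ccvg u z -> ccvg u z' -> z = z'.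
Proof.
move=> [uR uI] [uR' uI'].
have := norm_cvg_unique uR uR'; have := norm_cvg_unique uI uI'.
by case: z z' {uR uI uR' uI'} => a b [c d] /= -> ->.
Qed.

Definition cis x : R[i] := (cos x +i* sin x)%C.

Lemma cisD x y : cis (x + y) = cis x * cis y.
Proof.
rewrite /cis cosD sinD.
by apply/eqP; rewrite eq_complex /= eqxx /= addrC.
Qed.

Lemma cis0 : cis 0 = 1.
Proof. by rewrite /cis cos0 sin0. Qed.

Lemma cis_prod (I : finType) (th : I -> R) : \prod_i cis (th i) = cis (\sum_i th i).
Proof. by rewrite (big_morph cis cisD cis0). Qed.

(** Written in the shape of [cos_coeff] and [sin_coeff]. The truncated [k.-1] is harmless at k = 0,
    where the factor [(odd k)%:R] vanishes. *)
Lemma imag_expr x k : ((0 +i* x)%C : R[i]) ^+ k =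
  ((~~ odd k)%:R * (-1) ^ k./2 * x ^+ k +i* ((odd k)%:R * (-1) ^+ k.-1./2 * x ^+ k))%C.
Proof.
elim: k => [|k IH]; first by rewrite !expr0 /= !mul0r !mulr1.
rewrite exprSr IH; apply/eqP; rewrite eq_complex /=.
rewrite !mulr0 addr0 sub0r !exprSr !mulrA uphalf_half.
have [ok|ek] := boolP (odd k); rewrite /= ?mul0r ?oppr0 ?eqxx ?andbT ?mul1r //=.
case: k ok {IH} => // k /= ok; rewrite uphalf_half.
have ek : odd k = false by apply: negbTE.
by rewrite ek add0n add1n -exprnP [(-1) ^+ _.+1]exprS mulN1r !mulNr.
Qed.

Definition cexps (z : R[i]) N : R[i] := \sum_(k < N) ((k`!%:R)^-1 : R)%:C%C * z ^+ k.

Lemma cexps_cis x : ccvg (cexps (0 +i* x)%C) (cis x).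
Proof.
have term k : ((k`!%:R)^-1 : R)%:C%C * (0 +i* x)%C ^+ k =
    (cos_coeff x k +i* sin_coeff x k)%C.
  rewrite imag_expr /cos_coeff /sin_coeff /=; apply/eqP; rewrite eq_complex /=.
  by rewrite !mul0r subr0 addr0 ![_^-1 * _]mulrC !eqxx.
have sumE N : cexps (0 +i* x)%C N = (series (cos_coeff x) N +i* series (sin_coeff x) N)%C.
  rewrite /cexps /series /= !big_mkord.
  elim/big_rec3: _ => [|k a b c _ ->] //.
  by rewrite term.
split; under eq_fun do rewrite sumE; rewrite /cis /= unlock.
  exact: is_cvg_series_cos_coeff.
exact: is_cvg_series_sin_coeff.
Qed.

(** For nonzero s, t = pi / s would give cis pi = -1. *)
Lemma cis_eq1 (s : R) : (forall t, cis (t * s) = 1) -> s = 0.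
Proof.
move=> s1; apply/eqP; apply/negP => /negP s0.
have := s1 (pi / s); rewrite divfK // /cis cospi => /eqP.
rewrite eq_complex /= => /andP[/eqP]; move/eqP; rewrite -subr_eq0.
by rewrite -opprD oppr_eq0 -[1 + 1 : R]/(2 : R) pnatr_eq0.
Qed.

End ComplexLimits.

Section ComplexContinuity.
Variables (R : realType) (C : falgType R).
Implicit Types (F G : C -> R[i]).

Definition cvcont F : Prop :=
  vcont (fun x => complex.Re (F x)) /\ vcont (fun x => complex.Im (F x)).

Lemma cvcontM F G : cvcont F -> cvcont G -> cvcont (fun x => F x * G x).
Proof.
move=> [FR FI] [GR GI]; split.
  have -> : (fun x => complex.Re (F x * G x)) = fun x =>
    complex.Re (F x) * complex.Re (G x) + -1 * (complex.Im (F x) * complex.Im (G x)).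
    by apply/funext => x; rewrite ReM mulN1r.
  by apply: vcontD; [apply: vcontM|apply: vcontM; [exact: vcont_cst|exact: vcontM]].
have -> : (fun x => complex.Im (F x * G x)) = fun x =>
    complex.Re (F x) * complex.Im (G x) + complex.Im (F x) * complex.Re (G x).
  by apply/funext => x; rewrite ImM.
by apply: vcontD; apply: vcontM.
Qed.

Lemma cvcont_cst z : cvcont (fun=> z).
Proof. by split; apply: vcont_cst. Qed.

Lemma cvcont_sum (I : Type) (r : seq I) (F : I -> C -> R[i]) :
  (forall i, cvcont (F i)) -> cvcont (fun x => \sum_(i <- r) F i x).
Proof.
move=> Fc; split.
  have -> : (fun x => complex.Re (\sum_(i <- r) F i x)) =
      fun x => \sum_(i <- r) complex.Re (F i x).
    by apply/funext => x; rewrite (raddf_sum (@complex.Re R)).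
  by apply: vcont_sum => i; have [] := Fc i.
have -> : (fun x => complex.Im (\sum_(i <- r) F i x)) =
    fun x => \sum_(i <- r) complex.Im (F i x).
  by apply/funext => x; rewrite (raddf_sum (@complex.Im R)).
by apply: vcont_sum => i; have [] := Fc i.
Qed.

Lemma cvcont_prod (I : Type) (r : seq I) (F : I -> C -> R[i]) :
  (forall i, cvcont (F i)) -> cvcont (fun x => \prod_(i <- r) F i x).
Proof.
move=> Fc; elim: r => [|i r IH].
  have -> : (fun x => \prod_(i <- [::]) F i x) = fun=> 1.
    by apply/funext => x; rewrite big_nil.
  exact: cvcont_cst.
have -> : (fun x => \prod_(j <- i :: r) F j x) =
    fun x => F i x * \prod_(j <- r) F j x by apply/funext => x; rewrite big_cons.
exact: cvcontM.
Qed.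

Lemma cvcont_det (m : nat) (phi : {lrmorphism C -> matrix_algebra (Rcomplex R) m}) :
  cvcont (fun x => \det (phi x) : R[i]).
Proof.
rewrite /determinant; apply: cvcont_sum => s; apply: cvcontM.
  exact: cvcont_cst.
apply: cvcont_prod => i; split; apply: vcont_linear => a x y.
  by rewrite linearP /= !mxE; case: (phi x _ _) => ? ?; case: (phi y _ _).
by rewrite linearP /= !mxE; case: (phi x _ _) => ? ?; case: (phi y _ _).
Qed.

End ComplexContinuity.

Section DiagonalConjugates.
Variables (K : fieldType) (m : nat) (P : 'M[K]_m.+1).
Hypothesis Pu : P \in unitmx.
Implicit Types (d : 'I_m.+1 -> K).

(** With P fixed, sums, scalings and powers act on d entrywise, so partial exponentials and their
    determinants reduce to the eigenvalues. *)
Definition diag_conj d : 'M[K]_m.+1 := invmx P *m diag_mx (\row_k d k) *m P.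

Lemma diag_conj_row (d : 'rV_m.+1) :
  invmx P *m diag_mx d *m P = diag_conj (fun k => d 0 k).
Proof. by congr (_ *m diag_mx _ *m _); apply/rowP => k; rewrite mxE. Qed.

Lemma diag_conjZ a d : a *: diag_conj d = diag_conj (fun k => a * d k).
Proof.
rewrite /diag_conj scalemxAl scalemxAr; congr (_ *m _ *m _).
by apply/matrixP => i j; rewrite !mxE mulrnAr.
Qed.

Lemma diag_conjM d e : diag_conj d *m diag_conj e = diag_conj (fun k => d k * e k).
Proof.
rewrite /diag_conj !mulmxA mulmxK // -!mulmxA; congr (_ *m _); rewrite mulmxA.
congr (_ *m _); apply/matrixP => i j; rewrite mul_diag_mx !mxE.
by rewrite mulrnAr; case: eqP => // ->.
Qed.

Lemma diag_conj1 : diag_conj (fun=> 1) = 1%:M.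
Proof.
rewrite /diag_conj (_ : diag_mx _ = 1%:M) ?mulmx1 ?mulVmx //.
by apply/matrixP => i j; rewrite !mxE.
Qed.

Lemma diag_conjX d k : diag_conj d ^+ k = diag_conj (fun l => d l ^+ k).
Proof.
elim: k => [|k IH].
  by rewrite expr0 -[LHS]diag_conj1; congr diag_conj; apply/funext => l; rewrite expr0.
by rewrite exprS IH -mulmxE diag_conjM; under eq_fun do rewrite -exprS.
Qed.

Lemma diag_conj_sum N (e : 'I_N -> 'I_m.+1 -> K) :
  \sum_(k < N) diag_conj (e k) = diag_conj (fun l => \sum_(k < N) e k l).
Proof.
rewrite -mulmx_suml -mulmx_sumr; congr (_ *m _ *m _).
apply/matrixP => i j; rewrite summxE !mxE -sumrMnl; apply: eq_bigr => k _.
by rewrite !mxE.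
Qed.

Lemma det_diag_conj d : \det (diag_conj d) = \prod_k d k.
Proof.
rewrite !det_mulmx det_diag mulrAC -det_mulmx mulVmx // det1 mul1r.
by apply: eq_bigr => k _; rewrite mxE.
Qed.

Lemma tr_diag_conj d : \tr (diag_conj d) = \sum_k d k.
Proof.
rewrite mxtrace_mulC mulmxA mulmxV // mul1mx mxtrace_diag.
by apply: eq_bigr => k _; rewrite mxE.
Qed.

End DiagonalConjugates.

Section SkewDeterminant.
Variables (R : realType) (m : nat).
Local Notation T := (matrix_algebra (Rcomplex R) m).
Local Notation star := (@conj_transpose R (Rcomplex R) (@conjc R : Rcomplex R -> Rcomplex R) m).

Lemma mxscale_complex (a : R) (M : T) : (a *: M : T) = a%:C%C *: (M : 'M[R[i]]_(m.-1.+1)).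
Proof.
apply/matrixP => i j; rewrite !mxE; case: (M i j) => x y.
by apply/eqP; rewrite eq_complex /= !mul0r subr0 addr0 !eqxx.
Qed.

Lemma skew_diagonal (M : T) : star M = - M ->
  exists (P : 'M[R[i]]_(m.-1.+1)) (th : 'I_(m.-1.+1) -> R), P \in unitmx /\
    M = diag_conj P (fun k => (0 +i* th k)%C).
Proof.
move=> Mskew; pose M' : 'M[R[i]]_(m.-1.+1) := M.
pose B : 'M[R[i]]_(m.-1.+1) := (0 +i* 1)%C *: M'.
have Bherm : B \is hermsymmx.
  apply/is_hermitianmxP; rewrite expr0 scale1r; apply/matrixP => i j.
  have Mij : M j i = (- conjc (M i j) : R[i]).
    by have := congr1 (fun A : T => A j i) Mskew; rewrite !mxE => ->; rewrite opprK.
  rewrite !mxE Mij; case: (M i j) => a b /=; apply/eqP; rewrite eq_complex /=.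
  by rewrite !mul0r !mul1r ?(add0r, sub0r, opprK, addr0, subr0, eqxx).
have Pu : spectralmx B \in unitmx := spectral_unit B.
have /orthomx_spectralP := hermitian_normalmx Bherm.
have := hermitian_spectral_diag_real Bherm.
move: (spectralmx B) (spectral_diag B) Pu => P d Pu dreal BE.
(* B is i M and hermitian, so its eigenvalues d are real and those of M are - i d. *)
exists P, (fun k => - complex.Re (d 0 k)); split; first exact: Pu.
have BE' : B = diag_conj P (fun k => d 0 k) := etrans BE (diag_conj_row P d).
have -> : M = (0 +i* -1)%C *: B.
  rewrite /B scalerA (_ : _ * _ = 1) ?scale1r //.
  by apply/eqP; rewrite eq_complex /= !(mul0r, mulr0, mulN1r, opprK, sub0r, addr0) !eqxx.
rewrite BE' diag_conjZ; congr diag_conj; apply/funext => k.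
have /RRe_real {1}<- : d 0 k \is Num.real by apply: (mxOverP dreal).
by apply/eqP; rewrite eq_complex /=; apply/andP; split; apply/eqP; ring.
Qed.

Lemma exps_complex (M : 'M[R[i]]_(m.-1.+1)) N :
  exps (M : T) N = \sum_(k < N) ((k`!%:R)^-1 : R)%:C%C *: M ^+ k.
Proof. by apply: eq_bigr => k _; rewrite mxscale_complex. Qed.

Lemma det_exps_diagonal (P : 'M[R[i]]_(m.-1.+1)) (d : 'I_(m.-1.+1) -> R[i]) N :
  P \in unitmx -> \det (exps (diag_conj P d : T) N) = \prod_k cexps (d k) N :> R[i].
Proof.
move=> Pu; rewrite exps_complex.
transitivity (\det (diag_conj P (fun l => cexps (d l) N))); last exact: det_diag_conj.
congr determinant; rewrite /cexps -diag_conj_sum; apply: eq_bigr => k _.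
by rewrite -diag_conjZ; congr (_ *: _); apply: diag_conjX.
Qed.

(** The identity det (exp (t M)) = exp (tr (t M)), read off the imaginary eigenvalues and stated as
    a limit of partial sums. *)
Lemma skew_exp_det (M : T) : star M = - M -> exists s : R,
  \tr (M : 'M[R[i]]_(m.-1.+1)) = (0 +i* s)%C :> R[i] /\
  forall t : R, ccvg (fun N => \det (exps (t *: M) N)) (cis (t * s)).
Proof.
move=> /skew_diagonal[P [th [Pu ->]]]; exists (\sum_k th k); split.
  rewrite tr_diag_conj //.
  by elim/big_rec2: _ => // k a b _ ->; apply/eqP; rewrite eq_complex /= addr0 !eqxx.
move=> t; rewrite mxscale_complex diag_conjZ.
have -> : (fun k => t%:C%C * (0 +i* th k)%C) = (fun k => (0 +i* (t * th k))%C).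
  apply/funext => k; apply/eqP; rewrite eq_complex /=.
  by apply/andP; split; apply/eqP; ring.
under [X in ccvg X]eq_fun do rewrite det_exps_diagonal //.
rewrite mulr_sumr -cis_prod; apply: ccvg_prod => k; exact: cexps_cis.
Qed.

End SkewDeterminant.

Section SpinRepresentation.
Variables (R : realType) (n : nat) (hn : (4 <= n)%N).
Variables (H : vectType R) (root : 'I_n -> 'Hom(H, R^o)) (coroot : 'I_n -> H).
Variables (g : lieAlgType R) (h : {linear H -> g}) (e f : 'I_n -> g).
Hypothesis hg : is_kac_moody (En_cartan n) root coroot h e f.
Variable omega : {lie g -> g}.
Hypothesis homega : is_chevalley_involution h e f omega.
Variables (C : falgType R) (v : 'I_n -> C).
Hypothesis hC : is_clifford v.
Variable rho : {lie fixed_subalg omega -> lie_of C}.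
Hypothesis hrho : is_spin_representation v e f rho.

(** One inclusion is generation inside [C], with K the set of values of [rho]; the other is
    generation of the fixed subalgebra by Berman generators, on which [rho] is prescribed. *)
Lemma spin_representation_image (tau : {linear C -> C}) :
  (forall x y, tau (x * y) = tau y * tau x) -> tau 1 = 1 ->
  (forall i, tau (v i) = v i) ->
  forall x : C, x \in spin_image v <-> exists y : fixed_subalg omega, rho y = x.
Proof.
move=> tauM tau1 tau_gen x; split=> [|[y <-]].
  apply: (@spin_image_sub R n C v hn hC.1 (fun x => exists y, rho y = x)) => [|a z t [y <-] [y' <-]|z t [y <-] [y' <-]|i].
  - by exists 0; rewrite linear0.
  - by exists (a *: y + y'); rewrite linearP.
  - by exists (lie y y'); rewrite lie_morph.
  have [oe of_ _] := homega.
  have fX : fixed_pred omega (e i - f i).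
    by rewrite /fixed_pred linearB /= oe of_ opprK addrC.
  by exists (FixedSubalg fX); apply: hrho.
apply: (@berman_generation _ _ _ _ _ _ _ _ _ _ hg _ homega _
  (fun y => (rho y : C) \in spin_image v)) => [|a z t zP tP|z t zP tP||i X XE].
- by rewrite pnatr_eq0.
- by rewrite linearP; apply: rpredD => //; apply: rpredZ.
- by rewrite lie_morph; apply: (spin_image_lie hC tauM tau1 tau_gen).
- by rewrite linear0; apply: rpred0.
by rewrite (hrho XE); apply: spin_generator_image.
Qed.

End SpinRepresentation.

(** * Transfer from a matrix model to the image *)

Section ModelConsequences.
Variables (R : realType) (n : nat) (C : falgType R) (v : 'I_n -> C).
Hypothesis hn : (4 <= n)%N.
Hypothesis hC : is_clifford v.

Definition reversal (tau : {linear C -> C}) : Prop :=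
  [/\ forall x y, tau (x * y) = tau y * tau x, tau 1 = 1 & forall i, tau (v i) = v i].

Lemma model_conclusion (T : algType R) (star : T -> T) (w : 'I_n -> T)
    (A : algType R) k (X : set T) :
  spin_model star w -> (n %% 4)%N != 3 -> (forall M, X M <-> star M = - M) ->
  tensor_basis A (matrix_algebra R^o k) T ->
  [/\ exists tau, reversal tau, isomorphic_within (spin_image v) A k X
    & is_maximal_semisimple_compact (spin_image v)].
Proof.
move=> hm n3 XP AT; have [phi [tau [phi_bij _ tauM tau1 [tau_gen phit]]]] := model_iso hC hm.
have imE := model_spin_imageE hC phi_bij tauM tau1 tau_gen phit n3.
split; first by exists tau.
  apply: isomorphic_within_model phi_bij _ AT => x.
  by split=> [/XP/imE//|/imE/XP].
split; first exact: (spin_image_semisimple hn hC tauM tau1 tau_gen).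
  apply: (spin_image_compact hC tauM tau1 tau_gen (Q := fun=> True)) => //.
  move=> x xN; split=> [_ t|_]; first by have [y ty] := exp_ex hC (t *: x); exists y.
  by apply/(spin_imageE hC tauM tau1 tau_gen); split=> // /eqP; rewrite (negbTE n3).
exact: (spin_image_maximal hn hC tauM tau1 tau_gen).
Qed.

Section Unitary.
Variable m : nat.
Local Notation T := (matrix_algebra (Rcomplex R) m).
Local Notation star := (@conj_transpose R (Rcomplex R) (@conjc R : Rcomplex R -> Rcomplex R) m).
Local Notation MC := 'M[R[i]]_(m.-1.+1).
Hypothesis n3 : (n %% 4 = 3)%N.
Variable phi : {lrmorphism C -> T}.
Hypothesis phi_bij : bijective phi.

Definition ctr (x : C) : R[i] := \tr (phi x : MC).

Lemma ctr_linear a x y : ctr (a *: x + y) = a%:C%C * ctr x + ctr y.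
Proof. by rewrite /ctr linearP /= mxscale_complex linearP. Qed.

Lemma ctrC x y : ctr (x * y) = ctr (y * x).
Proof. by rewrite /ctr !rmorphM; apply: (@mxtrace_mulC R[i]). Qed.

Lemma ctrN x : ctr (- x) = - ctr x.
Proof. by rewrite /ctr rmorphN; apply: (raddfN (@mxtrace R[i] _)). Qed.

(** Such a monomial is negated under conjugation by some [v i], while the trace is unchanged. *)
Lemma ctr_mon (S : {set 'I_n}) : S != finset.set0 -> S != finset.setTfor 'I_n -> ctr (mon v S) = 0.
Proof.
move=> S0 ST; have [|] := boolP [forall i, ~~ odd (#|S| + (i \in S))].
  by case/commutes_all => [SE|[_ SE]]; move: S0 ST; rewrite SE ?eqxx.
case/forallPn => i; rewrite negbK => oS.
have : ctr (mon v S) = - ctr (mon v S).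
  have := mon_conj hC.1 i S; rewrite -signr_odd oS scaleN1r => /(congr1 ctr).
  rewrite ctrC mulrA (cliff_sq hC.1) mul1r => {1}->.
  by rewrite ctrN.
by move/eqP; rewrite -addr_eq0 -mulr2n mulrn_eq0 => /eqP.
Qed.

Lemma ctrE x : ctr x = (cf hC finset.set0 x)%:C%C * ctr 1
  + (cf hC [set: 'I_n] x)%:C%C * ctr (mon v [set: 'I_n]).
Proof.
have ctr0 : ctr 0 = 0 by rewrite /ctr linear0 mxtrace0.
have T0 : finset.setTfor 'I_n != finset.set0.
  by rewrite -cards_eq0 cardsT card_ord; move: hn; lia.
rewrite {1}(cf_sum hC x) (big_morph ctr (_ : {morph ctr : a b / a + b >-> a + b}) ctr0); last first.
  by move=> a b; have := ctr_linear 1 a b; rewrite scale1r mul1r.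
have ctrZ a y : ctr (a *: y) = a%:C%C * ctr y.
  by have := ctr_linear a y 0; rewrite !addr0 ctr0 addr0.
rewrite (bigD1 finset.set0) //= (bigD1 (finset.setTfor 'I_n)) //= big1 ?addr0.
  by rewrite !ctrZ mon0.
by move=> S /andP[S0 ST]; rewrite ctrZ ctr_mon ?mulr0.
Qed.

(** Otherwise [ctr] would take only real values, but by surjectivity of phi it takes the trace of
    the scalar matrix i. *)
Lemma ctr_full_neq0 : ctr (mon v [set: 'I_n]) != 0.
Proof.
apply/eqP => T0; have [psi _ psiK] := phi_bij.
have tr1E : ctr 1 = ((m.-1.+1)%:R : R)%:C%C.
  by rewrite /ctr rmorph1 mxtrace1 rmorph_nat.
have := ctrE (psi ((0 +i* 1)%C%:M : MC)).
rewrite T0 mulr0 addr0 tr1E {1}/ctr psiK mxtrace_scalar.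
move/(congr1 (@complex.Im R)); rewrite raddfMn /= mulr0 mul0r addr0.
by move/eqP; rewrite pnatr_eq0.
Qed.

Variable tau : {linear C -> C}.
Hypothesis tauM : forall x y, tau (x * y) = tau y * tau x.
Hypothesis tau1 : tau 1 = 1.
Hypothesis tau_gen : forall i, tau (v i) = v i.
Hypothesis phit : forall x, phi (tau x) = star (phi x).

(** A skew element has no coefficient at 1, so its complex trace is the volume coefficient times a
    nonzero constant. *)
Lemma spin_image_ctr x : tau x = - x -> (x \in spin_image v <-> ctr x = 0).
Proof.
move=> xN; have x0 : cf hC finset.set0 x = 0.
  by have /(tau_skewP hC tauM tau1 tau_gen) := xN; apply; rewrite cards0.
rewrite ctrE x0 mul0r add0r.
split=> [/(spin_imageE hC tauM tau1 tau_gen)[_ xT]|].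
  by rewrite xT // mul0r.
move/eqP; rewrite mulf_eq0 (negbTE ctr_full_neq0) orbF => /eqP [xT].
by apply/(spin_imageE hC tauM tau1 tau_gen).
Qed.

Lemma su_spin_image x : @su R m (phi x) <-> x \in spin_image v.
Proof.
rewrite /su /= -phit -raddfN; split.
  by move=> [/(bij_inj phi_bij) xN x0]; apply/spin_image_ctr.
move=> xim; have /(spin_imageE hC tauM tau1 tau_gen)[xN _] := xim.
by split; [rewrite xN|apply/(spin_image_ctr xN)].
Qed.

Lemma det_exp x : tau x = - x -> exists s : R, ctr x = (0 +i* s)%C /\
  forall t y, is_exp (t *: x) y -> \det (phi y : MC) = cis (t * s).
Proof.
move=> xN; have phixN : star (phi x) = - phi x by rewrite -phit xN raddfN.
have [s [sE sP]] := skew_exp_det phixN; exists s; split=> // t y ty.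
apply: ccvg_uniq (sP t); have [cR cI] := cvcont_det phi.
have phiE N : phi (exps (t *: x) N) = exps (t *: phi x) N.
  rewrite linear_sum; apply: eq_bigr => k _.
  by rewrite linearZ /= rmorphXn /= linearZ.
split; under eq_fun do rewrite -phiE; [exact: (vcont_cvg cR ty)|exact: (vcont_cvg cI ty)].
Qed.

(** The extra condition on the group is determinant 1: along exp (t x) the determinant is cis (t s),
    where i s is the trace of x, so it is constantly 1 exactly for traceless x. *)
Lemma unitary_maximal_semisimple_compact : is_maximal_semisimple_compact (spin_image v).
Proof.
split; first exact: (spin_image_semisimple hn hC tauM tau1 tau_gen).
  apply: (spin_image_compact hC tauM tau1 tau_gen
    (Q := fun y => \det (phi y : MC) = 1)) => [||x xu detx||x xN].
  - by rewrite rmorph1 det1.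
  - by move=> x y dx dy; rewrite rmorphM -[RHS]mulr1 -{1}dx -dy; apply: det_mulmx.
  - have : \det (phi (tau x * x) : MC) = 1 by rewrite xu rmorph1 det1.
    by rewrite rmorphM => <-; rewrite (det_mulmx (phi (tau x) : MC)) detx mulr1.
  - have [cR cI] := cvcont_det phi.
    have -> : [set r | \det (phi (passmx.vecof (vbasis {:C}) r) : MC) = 1] =
      [set r | complex.Re (\det (phi (passmx.vecof (vbasis {:C}) r))) = 1] `&`
      [set r | complex.Im (\det (phi (passmx.vecof (vbasis {:C}) r))) = 0].
      apply/seteqP; split=> r /=; first by move=> ->.
      by case: (\det _) => a b /= [-> ->].
    by apply: closedI; [exact: (closed_vcont_eq cR)|exact: (closed_vcont_eq cI)].
  have [s [sE sP]] := det_exp xN.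
  split=> [/(spin_image_ctr xN)|xQ].
    rewrite sE => -[s0] t; have [y ty] := exp_ex hC (t *: x); exists y => //.
    by rewrite (sP t y ty) s0 mulr0 cis0.
  apply/(spin_image_ctr xN); rewrite sE.
  suff -> : s = 0 by [].
  by apply: cis_eq1 => t; have [y ty <-] := xQ t; rewrite (sP t y ty).
exact: (spin_image_maximal hn hC tauM tau1 tau_gen).
Qed.

End Unitary.
End ModelConsequences.

Section ScalarStars.
Variable R : realType.

Lemma star_real : @star_axioms R R^o (fun x => x).
Proof. by split=> // x y; rewrite mulrC. Qed.

Lemma star_complex : star_axioms (@conjc R : Rcomplex R -> Rcomplex R).
Proof.
split=> [a [x1 x2] [y1 y2]|[x1 x2] [y1 y2]|]; apply/eqP; rewrite eq_complex /=.
- by apply/andP; split; apply/eqP; ring.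
- by apply/andP; split; apply/eqP; ring.
- by rewrite oppr0 !eqxx.
Qed.

Lemma star_quaternion : star_axioms (@qconj R).
Proof.
split=> [a x y|x y|]; apply: quaternionP; rewrite /= ?oppr0 //; ring.
Qed.

Lemma conj_transpose_real m (M : matrix_algebra R^o m) :
  conj_transpose (fun x : R^o => x) M = trmx M.
Proof. exact: map_mx_id. Qed.

End ScalarStars.

(** * Hermitian Clifford families over the reals, complexes and quaternions *)

Section CliffordMatrices.
Variable R : realType.

(** Starting from the single generator 1 in size 1. All 8 k + 1 generators serve residue 1, where
    they are paired with their negatives; residue 0 drops one. *)
Lemma has_clifford_real k :
  has_clifford (@conj_transpose R R^o (fun x => x) (2 ^ (4 * k))) (8 * k + 1) 0.
Proof.
have := has_clifford_periods (star_real R) k (isT : 0 < 1)%N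
  (has_clifford_one (star_real R) 1).
by rewrite mul1n.
Qed.

Lemma has_clifford_real_double k :
  has_clifford (@conj_transpose R R^o (fun x => x) (2 ^ (4 * k + 1))) (8 * k + 2) 1.
Proof.
rewrite (_ : 8 * k + 2 = (8 * k + 1).+1)%N; last by lia.
apply: (has_clifford_double (star_real R) (m := 2 ^ (4 * k))).
- by rewrite expn_gt0.
- by rewrite expnD.
exact: has_clifford_real.
Qed.

Lemma has_clifford_quaternion_skew :
  has_clifford (@conj_transpose R (quaternion R) (@qconj R) 1) 0 3.
Proof.
pose s (x : quaternion R) : matrix_algebra (quaternion R) 1 := x%:M.
have sM x y : s x * s y = s (x * y) by rewrite /s -[LHS]scalar_mxM.
have sN x : - s x = s (- x) by apply/matrixP => i j; rewrite !mxE mulNrn.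
have sC x : conj_transpose (@qconj R) (s x) = s (qconj x).
  by apply/matrixP => i j; rewrite !mxE !ord1.
have s1 : 1 = s 1 by [].
exists [::], [:: s (Quaternion 0 1 0 0); s (Quaternion 0 0 1 0); s (Quaternion 0 0 0 1)].
split=> //.
  rewrite /antiherm /= !sM !sC s1 !sN andbT.
  by repeat (apply/andP; split); apply/eqP; congr s; apply: quaternionP => /=; ring.
rewrite /anti /= !sM !sN !andbT.
by repeat (apply/andP; split); apply/eqP; congr s; apply: quaternionP => /=; ring.
Qed.

(** The units i, j, k are three skew generators; doubling gives one hermitian and four skew ones,
    and swapping these four gives five hermitian ones in size 2. All are used for residue 5, all but
    one for residue 4. *)
Lemma has_clifford_quaternion k :
  has_clifford (@conj_transpose R (quaternion R) (@qconj R) (2 ^ (4 * k + 1)))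
    (8 * k + 5) 0.
Proof.
have H := has_clifford_double (star_quaternion R) (isT : 0 < 1)%N
  (erefl : 2 = (1 * 2)%N) has_clifford_quaternion_skew.
have := has_clifford_periods (star_quaternion R) k (isT : 0 < 2)%N
  (has_clifford_swap4 (star_matrix (star_quaternion R) 2) (p := 1) (q := 0) H).
by rewrite [in X in _ -> X]addn1 [in X in _ -> X]expnS.
Qed.

Lemma has_clifford_quaternion_double k :
  has_clifford (@conj_transpose R (quaternion R) (@qconj R) (2 ^ (4 * k + 2)))
    (8 * k + 6) 1.
Proof.
rewrite (_ : 8 * k + 6 = (8 * k + 5).+1)%N; last by lia.
apply: (has_clifford_double (star_quaternion R) (m := 2 ^ (4 * k + 1))).
- by rewrite expn_gt0.
- by rewrite (_ : 4 * k + 2 = (4 * k + 1).+1)%N ?expnSr //; lia.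
exact: has_clifford_quaternion.
Qed.

Lemma has_clifford_complex j :
  has_clifford (@conj_transpose R (Rcomplex R) (@conjc R : Rcomplex R -> Rcomplex R) (2 ^ j))
    j.+1 j.
Proof.
elim: j => [|j IH]; first exact: (has_clifford_one (star_complex R)).
apply: (has_clifford_double (star_complex R) (m := 2 ^ j)) => //.
  by rewrite expn_gt0.
by rewrite expnSr.
Qed.

(** Multiplication by the imaginary unit turns all j skew generators into hermitian ones, which
    covers every odd number 2 j + 1; residues 3 and 7 use it. *)
Lemma has_clifford_complex_herm j :
  has_clifford (@conj_transpose R (Rcomplex R) (@conjc R : Rcomplex R -> Rcomplex R) (2 ^ j))
    (j + j).+1 0.
Proof.
pose T := matrix_algebra (Rcomplex R) (2 ^ j).
pose J : T := ((0 +i* 1)%C : Rcomplex R)%:M.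
have JC (x : T) : J * x = x * J.
  exact: (etrans (@mul_scalar_mx R[i] _ _ _ x) (esym (@mul_mx_scalar R[i] _ _ _ x))).
have i2 : ((0 +i* 1)%C : R[i]) * (0 +i* 1)%C = -1.
  by apply/eqP; rewrite eq_complex /= !mul0r !mulr0 mul1r sub0r addr0 oppr0 !eqxx.
have JJ : J * J = -1.
  by rewrite -[LHS](scalar_mxM (R := R[i])) i2 raddfN.
have sJ : conj_transpose (@conjc R : Rcomplex R -> Rcomplex R) J = - J.
  apply/matrixP => a b; rewrite !mxE eq_sym; case: (_ == _).
    by apply/eqP; rewrite eq_complex /= oppr0 !eqxx.
  by rewrite !mulr0n oppr0; apply/eqP; rewrite eq_complex /= oppr0 !eqxx.
have step d e : has_clifford (@conj_transpose R (Rcomplex R)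
    (@conjc R : Rcomplex R -> Rcomplex R) (2 ^ j)) d e ->
    has_clifford (@conj_transpose R (Rcomplex R)
    (@conjc R : Rcomplex R -> Rcomplex R) (2 ^ j)) (d + e) 0.
  elim: e d => [|e IH] d; first by rewrite addn0.
  move/(has_clifford_imaginary (star_matrix (star_complex R) _) JC JJ sJ).
  by rewrite addnS -addSn; apply: IH.
exact: step (has_clifford_complex j).
Qed.

End CliffordMatrices.

Section Cases.
Variables (R : realType) (n : nat) (C : falgType R) (v : 'I_n -> C).
Hypothesis hn : (4 <= n)%N.
Hypothesis hC : is_clifford v.

Definition image_conclusion (A : algType R) k (T : algType R) (X : set T) : Prop :=
  [/\ exists tau, reversal v tau, isomorphic_within (spin_image v) A k X
    & is_maximal_semisimple_compact (spin_image v)].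

Lemma square_conclusion (D : algType R) (conj : D -> D) m d (A : algType R) k :
  star_axioms conj -> (0 < m)%N -> has_coordinates D d ->
  has_clifford (@conj_transpose R D conj m) n 0 -> ~~ odd n ->
  (m * m * d = 2 ^ n)%N ->
  tensor_basis A (matrix_algebra R^o k) (matrix_algebra D m) ->
  image_conclusion A k [set M : matrix_algebra D m | conj_transpose conj M = - M].
Proof.
move=> hconj m0 Dd /has_clifford_family[w [hw ws]] on dE AT.
apply: (model_conclusion hn hC (star := @conj_transpose R D conj m) (w := w)) => //.
  split=> //; first exact: star_matrix.
    exact: nscalar_even.
  by rewrite -dE; apply: coordinates_matrix.
by apply: contraNneq on; lia.
Qed.

Lemma double_conclusion (D : algType R) (conj : D -> D) m d (A : algType R) k :
  star_axioms conj -> (0 < m)%N -> has_coordinates D d ->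
  has_clifford (@conj_transpose R D conj m) n 0 -> (n %% 4 = 1)%N ->
  (m * m * d + m * m * d = 2 ^ n)%N ->
  tensor_basis A (matrix_algebra R^o k) (matrix_algebra D m) ->
  image_conclusion (A * A)%type k
    ([set M : matrix_algebra D m | conj_transpose conj M = - M] `*`
     [set M : matrix_algebra D m | conj_transpose conj M = - M]).
Proof.
move=> hconj m0 Dd /has_clifford_family[w [hw ws]] n1 dE AT.
apply: (model_conclusion hn hC (star := fun x : (matrix_algebra D m * matrix_algebra D m)%type =>
  (conj_transpose conj x.1, conj_transpose conj x.2)) (w := fun i => (w i, - w i))).
- apply: (pair_model (star_matrix hconj m) hw ws _ (coordinates_matrix m0 Dd) dE).
  by lia.
- by rewrite n1.
- move=> [x y]; split=> [[/= hx hy]|[hx hy]]; first by congr pair.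
  by split.
- exact: tensor_basis_square.
Qed.

Lemma unitary_conclusion m (A : algType R) k : (0 < m)%N ->
  has_clifford (@conj_transpose R (Rcomplex R) (@conjc R : Rcomplex R -> Rcomplex R) m) n 0 ->
  (n %% 4 = 3)%N -> (m * m * 2 = 2 ^ n)%N ->
  tensor_basis A (matrix_algebra R^o k) (matrix_algebra (Rcomplex R) m) ->
  image_conclusion A k (@su R m).
Proof.
move=> m0 /has_clifford_family[w [hw ws]] n3 dE AT.
have hs := star_matrix (star_complex R) m.
have md : spin_model (@conj_transpose R (Rcomplex R) (@conjc R : Rcomplex R -> Rcomplex R) m) w.
  split; [exact: hs|exact: hw|exact: ws|by move=> _; exact: nscalar_mod3|].
  rewrite -dE; exact: (coordinates_matrix m0 (coordinates_complex R)).
have [phi [tau [phi_bij _ tauM tau1 [tau_gen phit]]]] := model_iso hC md.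
split; first by exists tau.
  apply: (isomorphic_within_model phi_bij _ AT) => x.
  exact: (su_spin_image hn hC n3 phi_bij tauM tau1 tau_gen phit).
exact: (unitary_maximal_semisimple_compact hn hC n3 phi_bij tauM tau1 tau_gen phit).
Qed.

End Cases.

(** * The eight residues modulo 8 *)

Section Residues.
Variables (R : realType) (n : nat) (C : falgType R) (v : 'I_n -> C).
Hypothesis hn : (4 <= n)%N.
Hypothesis hC : is_clifford v.
Let k := (n %/ 8)%N.

Let nE r : (n %% 8 = r)%N -> n = (8 * k + r)%N.
Proof. by move=> <-; rewrite {1}(divn_eq n 8) mulnC. Qed.

Let pow_gt0 a : (0 < 2 ^ a)%N.
Proof. by rewrite expn_gt0. Qed.

(** The dimension count for matrices of size 2 ^ a, where 2 ^ b is 1, 2 or 4, the real dimension of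
    the reals, complexes or quaternions. *)
Let pow_sqr a b : n = (a + a + b)%N -> (2 ^ a * 2 ^ a * 2 ^ b = 2 ^ n)%N.
Proof. by move=> ->; rewrite !expnD. Qed.

Let pow_sqr2 a b : n = (a + a + b).+1 ->
  (2 ^ a * 2 ^ a * 2 ^ b + 2 ^ a * 2 ^ a * 2 ^ b = 2 ^ n)%N.
Proof. by move=> ->; rewrite addnn -mul2n expnS !expnD. Qed.

Let pow_mul a b c : a = (b + c)%N -> (2 ^ a = 2 ^ b * 2 ^ c)%N.
Proof. by move=> ->; rewrite expnD. Qed.

Lemma soE m : @so R m = [set M | conj_transpose (fun x : R^o => x) M = - M].
Proof. by apply/seteqP; split=> M; rewrite /so /= conj_transpose_real. Qed.

Lemma residue0 : (n %% 8 = 0)%N ->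
  image_conclusion v R^o (2 ^ (n %/ 2)) (@so R (2 ^ (n %/ 2))).
Proof.
move=> /nE n8; rewrite soE (_ : n %/ 2 = 4 * k)%N; last by rewrite n8; lia.
apply: (square_conclusion hn hC (star_real R) _ (coordinates_real R)) => //.
- apply: (has_clifford_weaken _ _ (has_clifford_real R k)); lia.
- by rewrite n8; lia.
- by apply: (@pow_sqr _ 0); lia.
exact: tensor_basis_scalar.
Qed.

Lemma residue1 : (n %% 8 = 1)%N ->
  image_conclusion v (R^o * R^o)%type (2 ^ ((n - 1) %/ 2))
        (@so R (2 ^ ((n - 1) %/ 2)) `*` @so R (2 ^ ((n - 1) %/ 2))).
Proof.
move=> /nE n8; rewrite !soE (_ : (n - 1) %/ 2 = 4 * k)%N; last by rewrite n8; lia.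
apply: (double_conclusion hn hC (star_real R) _ (coordinates_real R)) => //.
- by rewrite n8; apply: has_clifford_real.
- by rewrite n8; lia.
- by apply: (@pow_sqr2 _ 0); lia.
exact: tensor_basis_scalar.
Qed.

Lemma residue2 : (n %% 8 = 2)%N ->
  image_conclusion v (matrix_algebra R^o 2) (2 ^ ((n - 2) %/ 2))
        (@so R (2 ^ (n %/ 2))).
Proof.
move=> /nE n8; rewrite soE (_ : n %/ 2 = 4 * k + 1)%N; last by rewrite n8; lia.
apply: (square_conclusion hn hC (star_real R) _ (coordinates_real R)) => //.
- apply: (has_clifford_weaken _ _ (has_clifford_real_double R k)); lia.
- by rewrite n8; lia.
- by apply: (@pow_sqr _ 0); lia.
by apply: tensor_basis_kron => //; apply: (@pow_mul _ 1); lia.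
Qed.

Lemma residue3 : (n %% 8 = 3)%N ->
  image_conclusion v (matrix_algebra (Rcomplex R) 2) (2 ^ ((n - 3) %/ 2))
        (@su R (2 ^ ((n - 1) %/ 2))).
Proof.
move=> /nE n8; apply: (unitary_conclusion hn hC) => //.
- apply: (has_clifford_weaken _ _ (has_clifford_complex_herm R _)); lia.
- by rewrite n8; lia.
- by apply: (@pow_sqr _ 1); lia.
by apply: tensor_basis_kron => //; apply: (@pow_mul _ 1); lia.
Qed.

Lemma residue4 : (n %% 8 = 4)%N ->
  image_conclusion v (matrix_algebra (quaternion R) 2)
        (2 ^ ((n - 4) %/ 2)) (@sp R (2 ^ ((n - 2) %/ 2))).
Proof.
move=> /nE n8; rewrite (_ : (n - 2) %/ 2 = 4 * k + 1)%N; last by rewrite n8; lia.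
apply: (square_conclusion hn hC (star_quaternion R) _ (coordinates_quaternion R)) => //.
- apply: (has_clifford_weaken _ _ (has_clifford_quaternion R k)); lia.
- by rewrite n8; lia.
- by apply: (@pow_sqr _ 2); lia.
by apply: tensor_basis_kron => //; apply: (@pow_mul _ 1); lia.
Qed.

Lemma residue5 : (n %% 8 = 5)%N ->
  image_conclusion v
        (matrix_algebra (quaternion R) 2 * matrix_algebra (quaternion R) 2)%type
        (2 ^ ((n - 5) %/ 2))
        (@sp R (2 ^ ((n - 3) %/ 2)) `*` @sp R (2 ^ ((n - 3) %/ 2))).
Proof.
move=> /nE n8; rewrite (_ : (n - 3) %/ 2 = 4 * k + 1)%N; last by rewrite n8; lia.
apply: (double_conclusion hn hC (star_quaternion R) _ (coordinates_quaternion R)) => //.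
- by rewrite n8; apply: has_clifford_quaternion.
- by rewrite n8; lia.
- by apply: (@pow_sqr2 _ 2); lia.
by apply: tensor_basis_kron => //; apply: (@pow_mul _ 1); lia.
Qed.

Lemma residue6 : (n %% 8 = 6)%N ->
  image_conclusion v (matrix_algebra (quaternion R) 4)
        (2 ^ ((n - 6) %/ 2)) (@sp R (2 ^ ((n - 2) %/ 2))).
Proof.
move=> /nE n8; rewrite (_ : (n - 2) %/ 2 = 4 * k + 2)%N; last by rewrite n8; lia.
apply: (square_conclusion hn hC (star_quaternion R) _ (coordinates_quaternion R)) => //.
- apply: (has_clifford_weaken _ _ (has_clifford_quaternion_double R k)); lia.
- by rewrite n8; lia.
- by apply: (@pow_sqr _ 2); lia.
by apply: tensor_basis_kron => //; apply: (@pow_mul _ 2); lia.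
Qed.

Lemma residue7 : (n %% 8 = 7)%N ->
  image_conclusion v (matrix_algebra (Rcomplex R) 8) (2 ^ ((n - 7) %/ 2))
        (@su R (2 ^ ((n - 1) %/ 2))).
Proof.
move=> /nE n8; apply: (unitary_conclusion hn hC) => //.
- apply: (has_clifford_weaken _ _ (has_clifford_complex_herm R _)); lia.
- by rewrite n8; lia.
- by apply: (@pow_sqr _ 1); lia.
by apply: tensor_basis_kron => //; apply: (@pow_mul _ 3); lia.
Qed.

(** Each residue brings its own model and hence its own tau; only the existence of tau and the
    maximality are kept, free of the residue. *)
Lemma reversal_maximal : (exists tau, reversal v tau) /\
  is_maximal_semisimple_compact (spin_image v).
Proof.
have : (n %% 8 < 8)%N by rewrite ltn_mod.
case E : (n %% 8)%N => [|[|[|[|[|[|[|[|//]]]]]]]] _.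
- by have [] := residue0 E.
- by have [] := residue1 E.
- by have [] := residue2 E.
- by have [] := residue3 E.
- by have [] := residue4 E.
- by have [] := residue5 E.
- by have [] := residue6 E.
by have [] := residue7 E.
Qed.

End Residues.

Theorem theoremA (R : realType) (n : nat) (hn : (4 <= n)%N)
    (H : vectType R) (root : 'I_n -> 'Hom(H, R^o)) (coroot : 'I_n -> H)
    (g : lieAlgType R) (h : {linear H -> g}) (e f : 'I_n -> g)
    (hg : is_kac_moody (En_cartan n) root coroot h e f)
    (omega : {lie g -> g}) (homega : is_chevalley_involution h e f omega)
    (C : falgType R) (v : 'I_n -> C) (hC : is_clifford v)
    (rho : {lie fixed_subalg omega -> lie_of C})
    (hrho : is_spin_representation v e f rho) :
  exists im : {vspace C},
    (forall x : C, x \in im <-> exists y : fixed_subalg omega, rho y = x) /\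
    ((n %% 8 = 0)%N ->
      isomorphic_within im R^o (2 ^ (n %/ 2)) (@so R (2 ^ (n %/ 2)))) /\
    ((n %% 8 = 1)%N ->
      isomorphic_within im (R^o * R^o)%type (2 ^ ((n - 1) %/ 2))
        (@so R (2 ^ ((n - 1) %/ 2)) `*` @so R (2 ^ ((n - 1) %/ 2)))) /\
    ((n %% 8 = 2)%N ->
      isomorphic_within im (matrix_algebra R^o 2) (2 ^ ((n - 2) %/ 2))
        (@so R (2 ^ (n %/ 2)))) /\
    ((n %% 8 = 3)%N ->
      isomorphic_within im (matrix_algebra (Rcomplex R) 2) (2 ^ ((n - 3) %/ 2))
        (@su R (2 ^ ((n - 1) %/ 2)))) /\
    ((n %% 8 = 4)%N ->
      isomorphic_within im (matrix_algebra (quaternion R) 2)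
        (2 ^ ((n - 4) %/ 2)) (@sp R (2 ^ ((n - 2) %/ 2)))) /\
    ((n %% 8 = 5)%N ->
      isomorphic_within im
        (matrix_algebra (quaternion R) 2 * matrix_algebra (quaternion R) 2)%type
        (2 ^ ((n - 5) %/ 2))
        (@sp R (2 ^ ((n - 3) %/ 2)) `*` @sp R (2 ^ ((n - 3) %/ 2)))) /\
    ((n %% 8 = 6)%N ->
      isomorphic_within im (matrix_algebra (quaternion R) 4)
        (2 ^ ((n - 6) %/ 2)) (@sp R (2 ^ ((n - 2) %/ 2)))) /\
    ((n %% 8 = 7)%N ->
      isomorphic_within im (matrix_algebra (Rcomplex R) 8) (2 ^ ((n - 7) %/ 2))
        (@su R (2 ^ ((n - 1) %/ 2)))) /\
    is_maximal_semisimple_compact im.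
Proof.
have [[tau [tauM tau1 tau_gen]] im_max] := reversal_maximal hn hC.
exists (spin_image v); split.
  exact: (spin_representation_image hn hg homega hC hrho tauM tau1 tau_gen).
split; first by case/(residue0 hn hC).
split; first by case/(residue1 hn hC).
split; first by case/(residue2 hn hC).
split; first by case/(residue3 hn hC).
split; first by case/(residue4 hn hC).
split; first by case/(residue5 hn hC).
split; first by case/(residue6 hn hC).
by split; first by case/(residue7 hn hC).
Qed.
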